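(* Let $r\ge1$ and $s\ge2$ be integers, and let $T_I=(\mathrm{Diff}^r_+(I))^s$ be the space of all step skew products over the Bernoulli shift on $s$ symbols with fiber a segment $I$, where $\mathrm{Diff}^r_+(I)$ denotes the set of orientation preserving $C^r$-smooth maps of $I$ inside itself that are diffeomorphisms onto the image. There exists a residual set $R_I\subset T_I$ such that for any step skew product in $R_I$ the statistical attractor is Lyapunov stable and coincides with the Milnor attractor.
   Context: $\Sigma^s=\{1,\dots,s\}^{\mathbb Z}$ with distance $d(\omega,\tilde\omega)=2^{-m}$, $m=\min\{|n|:\omega_n\neq\tilde\omega_n\}$, and the $(1/s,\dots,1/s)$-Bernoulli probability measure $\mu_{\Sigma^s}$; $(\sigma\omega)_n=\omega_{n+1}$ is the Bernoulli shift. The step skew product with fiber $I$ and fiber maps $f_1,\dots,f_s$ is $F:X\to X$, $X=\Sigma^s\times I$, $F(\omega,p)=(\sigma\omega,f_{\omega_0}(p))$; it is identified with $(f_1,\dots,f_s)\in T_I$, and $T_I$ carries the $C^r$-topology. The metric on $X$ is the sum of the distances in the base and the fiber; $\mu_X$ is the product of $\mu_{\Sigma^s}$ and Lebesgue measure on $I$. A subset of a topological space is residual if it contains a countable intersection of open everywhere dense sets. The Milnor attractor $A_M(F)$ is the smallest closed subset of $X$ containing $\omega(x)$ for $\mu_X$-a.e. $x$. For $x\in X$ and $U\subset X$, let $Freq(x,U)=\limsup_{N\to\infty}\frac1N\#\{0\le n<N:F^n(x)\in U\}$; the statistical $\omega$-limit set $\omega_{stat}(x)$ is the set of $z\in X$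 such that $Freq(x,U)>0$ for every neighborhood $U$ of $z$. The statistical attractor $A_{stat}(F)$ is the smallest closed subset of $X$ containing $\omega_{stat}(x)$ for $\mu_X$-a.e. $x$. An invariant or absorbing ($F(A)\subset A$) closed set $A\subset X$ is Lyapunov stable if for any neighborhood $U$ of $A$ there is a smaller neighborhood $V$ of $A$ such that positive semi-trajectories starting in $V$ never leave $U$. *)

(* Defs.v *)
From HB Require Import structures.
From mathcomp Require Import all_boot all_order all_algebra.
From mathcomp Require Import all_classical all_reals all_analysis.

Set Implicit Arguments.
Unset Strict Implicit.
Unset Printing Implicit Defensive.

Import Order.TTheory GRing.Theory Num.Theory.
Import numFieldNormedType.Exports.

Local Open Scope classical_set_scope.
Local Open Scope ring_scope.

(* [hs] makes the type pointed, as measurable types require; [R] is the type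
   in which the distance takes its values. *)
Definition shift_space (R : realType) (s : nat) (hs : (2 <= s)%N) : Type :=
  int -> 'I_s.

Section ShiftSpace.
Context {R : realType} {s : nat} {hs : (2 <= s)%N}.
Local Notation S := (shift_space R hs).
Implicit Types w v u : S.

HB.instance Definition _ := gen_eqMixin S.
HB.instance Definition _ := gen_choiceMixin S.
HB.instance Definition _ := isPointed.Build S (fun=> Ordinal (ltnW hs)).

Definition differ_at w v (m : nat) : Prop :=
  exists n : int, `|n|%N = m /\ w n <> v n.

Definition shift_dist w v : R :=
  match pselect (exists m, `[< differ_at w v m >]) with
  | left wv => 2 ^- ex_minn wv
  | right _ => 0
  end.

Variant shift_dist_spec w v : R -> Prop :=
| ShiftDistEq of w = v : shift_dist_spec w v 0
| ShiftDistNeq m of differ_at w v m & (forall k, differ_at w v k -> (m <= k)%N) :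
    shift_dist_spec w v (2 ^- m).

Lemma shift_distP w v : shift_dist_spec w v (shift_dist w v).
Proof.
rewrite /shift_dist; case: pselect => [wv|nwv].
  case: ex_minnP => m /asboolP wvm mmin; constructor => // k wvk.
  by apply: mmin; apply/asboolP.
constructor; apply/funext => n; apply: contrapT => wvn.
by apply: nwv; exists `|n|%N; apply/asboolP; exists n.
Qed.

Let shift_distxx w : shift_dist w w = 0.
Proof. by case: shift_distP => // m [n []]. Qed.

Let shift_dist_eq0 w v : shift_dist w v = 0 -> w = v.
Proof.
case: shift_distP => // m _ _ /eqP.
by rewrite invr_eq0 expf_eq0 pnatr_eq0 andbF.
Qed.

Let differ_atC w v m : differ_at w v m -> differ_at v w m.
Proof. by move=> [n [nm wv]]; exists n; split => // /esym. Qed.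

Let shift_dist_sym w v : shift_dist w v = shift_dist v w.
Proof.
case: (shift_distP w v) => [->|m wv mmin]; first by rewrite shift_distxx.
case: shift_distP => [vw|k vw kmin].
  by move: wv => [n [_]]; rewrite vw.
congr (_ ^- _); apply/eqP; rewrite eqn_leq.
by rewrite mmin ?kmin//; exact: differ_atC.
Qed.

Let shift_dist_triangle v w u :
  shift_dist w u <= shift_dist w v + shift_dist v u.
Proof.
have p_ge0 k : 0 <= (2 ^- k : R) by rewrite invr_ge0 exprn_ge0.
have d_ge0 x y : 0 <= shift_dist x y by case: shift_distP.
have pm m k : (m <= k)%N -> (2 ^- k : R) <= 2 ^- m.
  by move=> mk; rewrite lef_pV2 ?posrE ?exprn_gt0// ler_weXn2l// ler1n.
case: (shift_distP w u) => [_|m [n [nm wun]] mmin]; first by rewrite addr_ge0.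
have [wvn|wvn] := pselect (w n = v n).
  apply: ler_wpDl => //; case: shift_distP => [vu|k _ kmin].
    by move: wun; rewrite wvn vu.
  by apply/pm/kmin; exists n; rewrite -wvn.
apply: ler_wpDr => //; case: shift_distP => [wv|k _ kmin].
  by move: wvn; rewrite wv.
by apply/pm/kmin; exists n.
Qed.

HB.instance Definition _ := isMetric.Build R S
  shift_distxx shift_dist_eq0 shift_dist_sym shift_dist_triangle.

Definition coord_sets : set (set S) :=
  [set A | exists (n : int) (i : 'I_s), A = [set w | w n = i]].

HB.instance Definition _ :=
  Measurable.copy S (@g_sigma_algebraType S coord_sets).

(* This determines [mu], the sets below being a pi-system that generates the
   sigma-algebra. *)
Definition is_bernoulli (mu : probability S R) : Prop :=
  forall (J : seq int) (c : int -> 'I_s), uniq J ->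
    mu [set w : S | forall j, j \in J -> w j = c j] = ((s%:R ^- size J)%:E)%E.

(* Existence: push Lebesgue measure on [0, 1[ forward along the expansion in
   base [s], the digits being indexed by [int] through [pickle]. *)
Let trunc_scale (k : nat) (x : R) : nat := Num.truncn (s%:R ^+ k * x).

Let s_gt0 : (0 < s)%N. Proof. exact: ltnW hs. Qed.

Let sX_gt0 k : 0 < s%:R ^+ k :> R. Proof. by rewrite exprn_gt0// ltr0n. Qed.

Let trunc_scaleS k x : (trunc_scale k.+1 x %/ s)%N = trunc_scale k x.
Proof.
have [x0|x0] := leP 0 x; last first.
  have neg j : trunc_scale j x = 0%N.
    by apply/eqP; rewrite -leqn0 truncn_le_nat (lt_trans _ ltr01)// pmulr_rlt0.
  by rewrite !neg div0n.
apply/eqP; rewrite eqn_leq -ltnS ltn_divLR// truncn_lt_nat//; last first.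
  by rewrite mulr_ge0// ltW.
rewrite natrM exprSr -mulrA [_ * x]mulrC mulrA ltr_pM2r ?ltr0n//.
rewrite truncnS_gt/= leq_divRL// truncn_ge_nat; last by rewrite mulr_ge0// ltW.
rewrite natrM exprSr -mulrA [_ * x]mulrC mulrA ler_pM2r ?ltr0n//.
by rewrite truncn_le mulr_ge0// ltW.
Qed.

Let digit (k : nat) (x : R) : 'I_s :=
  Ordinal (ltn_pmod (trunc_scale k.+1 x) s_gt0).

Let trunc_scaleE k x :
  trunc_scale k.+1 x = (trunc_scale k x * s + digit k x)%N.
Proof. by rewrite {1}(divn_eq (trunc_scale k.+1 x) s) trunc_scaleS. Qed.

Let measurable_trunc_scale k (Q : set nat) :
  measurable [set x | Q (trunc_scale k x)].
Proof.
have mle n : measurable [set x | (trunc_scale k x <= n)%N].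
  rewrite [X in measurable X](_ : _ = `]-oo, (n.+1%:R / s%:R ^+ k)[%classic).
    exact: measurable_itv.
  apply/seteqP; split => x /=;
    by rewrite in_itv/= truncn_le_nat ltr_pdivlMr// mulrC.
have meq n : measurable [set x | trunc_scale k x = n].
  case: n => [|n].
    rewrite [X in measurable X](_ : _ = [set x | (trunc_scale k x <= 0)%N])//.
    by apply/seteqP; split => x /=; rewrite leqn0 => /eqP.
  rewrite [X in measurable X](_ : _ =
      [set x | (trunc_scale k x <= n.+1)%N] `\` [set x | (trunc_scale k x <= n)%N]).
    exact: measurableD.
  apply/seteqP; split => x /= => [->|[le /negP]]; first by rewrite leqnn ltnn.
  by rewrite -ltnNge => lt; apply/eqP; rewrite eqn_leq le.
rewrite [X in measurable X](_ : _ = \bigcup_(n in Q) [set x | trunc_scale k x = n]).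
  by apply: bigcup_measurable.
by apply/seteqP; split => x /= => [Qx|[n Qn ->]//]; exists (trunc_scale k x).
Qed.

Let measurable_digit k i : measurable [set x | digit k x = i].
Proof.
rewrite [X in measurable X](_ : _ = [set x | [set m | (m %% s)%N = i] (trunc_scale k.+1 x)]).
  exact: measurable_trunc_scale.
by apply/seteqP; split => x /= => [<-//|xi]; exact/val_inj.
Qed.

Let expansion (x : R) : S := fun n => digit (pickle n) x.

Let measurable_expansion : measurable_fun setT expansion.
Proof.
apply: (@measurability _ _ R S setT expansion coord_sets) => //.
by move=> _ [_ [n [i ->]] <-]; rewrite setTI; exact: measurable_digit.
Qed.

Let I01 : set R := `[0, 1[%classic.

Let with_digits (J : seq nat) (c : nat -> 'I_s) : set R :=
  [set x | forall j, j \in J -> digit j x = c j].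

Let measurable_with_digits J c : measurable (I01 `&` with_digits J c).
Proof.
apply: measurableI; first exact: measurable_itv.
rewrite [X in measurable X](_ : _ = \bigcap_(j in [set` J]) [set x | digit j x = c j])//.
by apply: bigcap_measurableType => j _; exact: measurable_digit.
Qed.

Let lebesgue_prefix k c :
  lebesgue_measure (I01 `&` with_digits (iota 0 k) c) = ((s%:R ^- k)%:E)%E.
Proof.
have [m mk mE] : exists2 m, (m < s ^ k)%N & forall x, I01 x ->
    with_digits (iota 0 k) c x <-> trunc_scale k x = m.
  elim: k => [|k [m mk IH]].
    exists 0%N => // x; rewrite /I01/= in_itv/= => /andP[x0 x1]; split => // _.
    by apply/eqP; rewrite -leqn0 truncn_le_nat expr0 mul1r.
  exists (m * s + c k)%N => [|x Ix].
    rewrite expnSr (@leq_trans (m.+1 * s)%N) ?leq_pmul2r//.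
    by rewrite mulSn addnC ltn_add2r.
  rewrite trunc_scaleE; split.
    move=> xc; rewrite (proj1 (IH x Ix)) ?xc ?mem_iota ?leq0n ?add0n ?ltnSn//.
    move=> j; rewrite mem_iota => /= jk; apply: xc.
    by rewrite mem_iota/= add0n ltnW.
  move=> E.
  have digE : digit k x = c k :> nat.
    by have := congr1 (modn^~ s) E; rewrite !modnMDl !modn_small.
  have /(IH x Ix) pre : trunc_scale k x = m.
    by move/eqP: E; rewrite digE eqn_add2r eqn_pmul2r// => /eqP.
  move=> j; rewrite mem_iota/= add0n ltnS leq_eqVlt => /orP[/eqP ->|jk].
    exact: val_inj.
  by apply: pre; rewrite mem_iota.
have -> : I01 `&` with_digits (iota 0 k) c =
    `[m%:R / s%:R ^+ k, m.+1%:R / s%:R ^+ k[%classic.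
  apply/seteqP; split => x.
    move=> [Ix /(mE x Ix) xm]; move: Ix; rewrite /I01/= !in_itv/= => /andP[x0 _].
    rewrite ler_pdivrMr// ltr_pdivlMr// [x * _]mulrC -truncn_eq.
      by apply/eqP.
    by rewrite mulr_ge0// ltW.
  rewrite /= in_itv/= ler_pdivrMr// ltr_pdivlMr// [x * _]mulrC => /andP[lo hi].
  have x0 : 0 <= x by rewrite -(pmulr_rge0 _ (sX_gt0 k)) (le_trans _ lo).
  have Ix : I01 x.
    rewrite /I01/= in_itv/= x0/= -(ltr_pM2l (sX_gt0 k)) mulr1.
    by rewrite (lt_le_trans hi)// -natrX ler_nat.
  split => //; apply/(mE x Ix)/eqP.
  by rewrite truncn_eq ?lo ?hi// mulr_ge0// ltW.
rewrite lebesgue_measure_itv/= lte_fin ltr_pM2r ?invr_gt0// ltr_nat ltnSn.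
by rewrite -EFinD -mulrBl -natrB// subSnn mul1r.
Qed.

Let lebesgue_with_digits J c : uniq J ->
  lebesgue_measure (I01 `&` with_digits J c) = ((s%:R ^- size J)%:E)%E.
Proof.
have [k] : exists k, {subset J <= iota 0 k}.
  exists (\max_(j <- J) j).+1 => j jJ; rewrite mem_iota/= add0n ltnS.
  exact: (@leq_bigmax_seq _ J xpredT id).
have [d] : exists d, (k <= size J + d)%N by exists k; rewrite leq_addl.
elim: d J c => [|d IH] J c kd Jk uJ.
  have kJ : (size (iota 0 k) <= size J)%N by rewrite size_iota -(addn0 (size J)).
  have [sJ eJ] := uniq_min_size uJ Jk kJ.
  rewrite sJ size_iota -(lebesgue_prefix k c); congr (lebesgue_measure (_ `&` _)).
  by apply/seteqP; split => x xc j jJ; apply: xc; rewrite ?eJ// -eJ.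
have [/allP kJ|/allPn[j jk jJ]] := boolP (all (mem J) (iota 0 k)).
  apply: IH => //; rewrite (leq_trans _ (leq_addr _ _))//.
  by rewrite -(size_iota 0 k) uniq_leq_size ?iota_uniq.
pose upd i := fun n => if n == j then i else c n.
pose part i := I01 `&` with_digits (j :: J) (upd i).
have partE : I01 `&` with_digits J c = \big[setU/set0]_(i < s) part i.
  rewrite -bigcup_seq; apply/seteqP; split => x.
    move=> [Ix xc]; exists (digit j x); first exact: mem_index_enum.
    split => // n; rewrite in_cons /upd; case: eqP => [->//|_ /=]; exact: xc.
  move=> [i _ [Ix xc]]; split => // n nJ.
  have := xc n; rewrite in_cons nJ orbT /upd => /(_ isT).
  by case: eqP => // nj; move: jJ; rewrite /= -nj nJ.
have part_size i : lebesgue_measure (part i) = ((s%:R ^- (size J).+1)%:E)%E.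
  apply: IH => /=; rewrite ?addSnnS//; last by rewrite uJ andbT.
  by move=> n; rewrite in_cons => /orP[/eqP ->//|/Jk].
rewrite partE measure_semi_additive_ord.
- rewrite (eq_bigr (fun=> (s%:R ^- (size J).+1)%:E)) => [|i _]; last first.
    exact: part_size.
  rewrite sumEFin sumr_const card_ord exprS invfM -mulrnAl.
  rewrite -[s%:R^-1 *+ s]mulr_natl.
  by rewrite mulfV ?mul1r// pnatr_eq0 -lt0n.
- by move=> i; exact: measurable_with_digits.
- move=> i i' _ _ [x [[_ xi] [_ xi']]].
  have := xi' j; have := xi j; rewrite !in_cons eqxx /upd eqxx.
  by move=> /(_ isT) <- /(_ isT) <-.
- by rewrite -partE; exact: measurable_with_digits.
Qed.

Let bernoulli (A : set S) : \bar R :=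
  lebesgue_measure (I01 `&` expansion @^-1` A).

Let measurable_preimage (A : set S) :
  measurable A -> measurable (I01 `&` expansion @^-1` A).
Proof.
move=> mA; apply: measurableI; first exact: measurable_itv.
by rewrite -[X in measurable X]setTI; exact: measurable_expansion.
Qed.

Let bernoulli0 : bernoulli set0 = 0%E.
Proof. by rewrite /bernoulli preimage_set0 setI0 measure0. Qed.

Let bernoulli_ge0 A : (0 <= bernoulli A)%E.
Proof. exact: measure_ge0. Qed.

Let bernoulli_sigma_additive : semi_sigma_additive bernoulli.
Proof.
move=> F mF tF mUF; rewrite /bernoulli preimage_bigcup setI_bigcupr.
apply: measure_semi_sigma_additive.
- by move=> n; exact: measurable_preimage.
- apply/trivIsetP => i j _ _ ij; rewrite setIACA -[X in _ `&` X]preimage_setI.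
  move/trivIsetP : tF => /(_ i j Logic.I Logic.I ij) ->.
  by rewrite preimage_set0 setI0.
- by rewrite -setI_bigcupr -preimage_bigcup; exact: measurable_preimage.
Qed.

HB.instance Definition _ := isMeasure.Build _ S R bernoulli
  bernoulli0 bernoulli_ge0 bernoulli_sigma_additive.

Let bernoulliT : bernoulli setT = 1%E.
Proof.
rewrite /bernoulli preimage_setT setIT lebesgue_measure_itv/= lte_fin ltr01.
by rewrite -EFinD subr0.
Qed.

HB.instance Definition _ :=
  Measure_isProbability.Build _ S R bernoulli bernoulliT.

Lemma bernoulli_exists : exists mu : probability S R, is_bernoulli mu.
Proof.
exists bernoulli => J c uJ; rewrite /= /bernoulli.
pose c' n := if unpickle n is Some j then c j else c 0.
rewrite -(size_map (@pickle int)) -(lebesgue_with_digits c'); last first.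
  by rewrite map_inj_uniq//; exact: (pcan_inj pickleK).
congr (lebesgue_measure (_ `&` _)); apply/seteqP; split => x /= xc j.
  by move=> /mapP[k kJ ->]; rewrite /c' pickleK; exact: xc.
by move=> jJ; have := xc _ (map_f pickle jJ); rewrite /c' pickleK.
Qed.

Definition bernoulli_measure : probability S R := projT1 (cid bernoulli_exists).

Lemma bernoulli_measureP : is_bernoulli bernoulli_measure.
Proof. exact: projT2 (cid bernoulli_exists). Qed.

End ShiftSpace.

Definition segment (R : realType) (a b : R) (hab : a < b) : Type :=
  set_type `[a, b]%classic.

Section Segment.
Context {R : realType} {a b : R} {hab : a < b}.
Local Notation I := (segment hab).

HB.instance Definition _ := Choice.on I.
HB.instance Definition _ := PseudoMetric.copy I (set_type `[a, b]%classic).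

Let a_in : a \in `[a, b]%classic.
Proof. by rewrite inE/= in_itv/= lexx ltW. Qed.

HB.instance Definition _ := isPointed.Build I (exist _ a a_in).

HB.instance Definition _ :=
  Measurable.copy I (@g_sigma_algebra_preimageType _ I R set_val).

Definition segment_lebesgue (A : set I) : \bar R :=
  lebesgue_measure (set_val @` A).

Let image_measurable (A : set I) : measurable A ->
  measurable (set_val @` A : set R).
Proof.
move=> [B mB <-]; rewrite setTI.
suff -> : set_val @` (set_val @^-1` B : set I) = B `&` `[a, b]%classic.
  by apply: measurableI => //; exact: measurable_itv.
apply/seteqP; split => [_ [x Bx <-]|x [Bx abx]].
  by split => //; exact: set_valP.
by exists (exist _ x (mem_set abx)).
Qed.

Let segment_lebesgue0 : segment_lebesgue set0 = 0%E.
Proof. by rewrite /segment_lebesgue image_set0 measure0. Qed.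

Let segment_lebesgue_ge0 A : (0 <= segment_lebesgue A)%E.
Proof. exact: measure_ge0. Qed.

Let segment_lebesgue_sigma_additive : semi_sigma_additive segment_lebesgue.
Proof.
move=> F mF tF mUF; rewrite /segment_lebesgue image_bigcup.
apply: measure_semi_sigma_additive.
- by move=> n; exact: image_measurable.
- apply/trivIsetP => i j _ _ ij; rewrite -subset0 => _ [[x Fix <-] [y Fjy]].
  move=> /val_inj yx; move/trivIsetP : tF => /(_ i j Logic.I Logic.I ij).
  by rewrite -subset0 => /(_ x); apply; split => //; rewrite -yx.
- by rewrite -image_bigcup; exact: image_measurable.
Qed.

HB.instance Definition _ := isMeasure.Build _ I R segment_lebesgue
  segment_lebesgue0 segment_lebesgue_ge0 segment_lebesgue_sigma_additive.

Let segment_lebesgue_fin : fin_num_fun segment_lebesgue.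
Proof.
move=> A mA; rewrite ge0_fin_numE//.
apply: (@le_lt_trans _ _ (lebesgue_measure `[a, b]%classic)).
  apply: le_measure; rewrite ?inE; [exact: image_measurable|exact: measurable_itv|].
  by move=> _ [x _ <-]; exact: set_valP.
by rewrite lebesgue_measure_itv/= lte_fin hab -EFinD ltry.
Qed.

HB.instance Definition _ :=
  Measure_isFinite.Build _ I R segment_lebesgue segment_lebesgue_fin.

End Segment.

Section Smooth.
Context {R : realType} {D : set R}.
Implicit Types (f : D -> R) (x : D).

(* Filters on the subtype [D] only see points of [D]: at an endpoint of an
   interval this is the one-sided derivative. *)
Definition diff_quotient f x : D -> R :=
  fun y => (f y - f x) / (set_val y - set_val x).

Definition has_deriv f : Prop :=
  forall x, cvg (diff_quotient f x @ x^').

Definition deriv f : D -> R := fun x => lim (diff_quotient f x @ x^').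

Definition deriv_n (k : nat) f : D -> R := iter k deriv f.

Definition smooth (r : nat) f : Prop :=
  (forall k, (k < r)%N -> has_deriv (deriv_n k f)) /\ continuous (deriv_n r f).

End Smooth.

Section Diffeo.
Context {R : realType} {a b : R} {hab : a < b}.
Local Notation I := (segment hab).

Definition real_of (f : I -> I) : set_type `[a, b]%classic -> R :=
  set_val \o f.

Definition preserves_orientation (f : I -> I) : Prop :=
  forall x y : I, set_val x < set_val y -> real_of f x < real_of f y.

Definition diffeo_onto_image (r : nat) (f : I -> I) : Prop :=
  smooth r (real_of f) /\
  exists g : set_type (range (real_of f)) -> R,
    smooth r g /\ forall x y, set_val y = real_of f x -> g y = set_val x.

End Diffeo.

Definition Diff (r : nat) (R : realType) (a b : R) (hab : a < b) : Type :=
  set_type [set f : segment hab -> segment hab |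
    diffeo_onto_image r f /\ preserves_orientation f].

Section DiffTopology.
Context {r : nat} {R : realType} {a b : R} {hab : a < b}.
Local Notation I := (segment hab).
Local Notation T := (Diff r hab).
Implicit Types f g h : T.

Definition diff_fun f : I -> I := set_val f.
Coercion diff_fun : Diff >-> Funclass.

HB.instance Definition _ := Choice.on T.

(* The suprema over the compact segment are attained, so for [0 < e] these are
   the open balls of the C^r distance. *)
Definition cr_ball f (e : R) g : Prop :=
  forall k, (k <= r)%N -> forall x : I,
    `|deriv_n k (real_of f) x - deriv_n k (real_of g) x| < e.

HB.instance Definition _ := hasNbhs.Build T (nbhs_ (entourage_ cr_ball)).

Let cr_ball_center f (e : R) : 0 < e -> cr_ball f e f.
Proof. by move=> e0 k _ x; rewrite subrr normr0. Qed.

Let cr_ball_sym f g (e : R) : cr_ball f e g -> cr_ball g e f.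
Proof. by move=> fg k kr x; rewrite distrC; exact: fg. Qed.

Let cr_ball_triangle f g h (e1 e2 : R) :
  cr_ball f e1 g -> cr_ball g e2 h -> cr_ball f (e1 + e2) h.
Proof.
move=> fg gh k kr x; apply: le_lt_trans (ltrD (fg k kr x) (gh k kr x)).
exact: ler_distD.
Qed.

HB.instance Definition _ := @Nbhs_isPseudoMetric.Build R T
  (entourage_ cr_ball) erefl cr_ball cr_ball_center cr_ball_sym
  cr_ball_triangle erefl.

End DiffTopology.

Definition skew_products (r s : nat) (R : realType) (a b : R) (hab : a < b) :
  Type := prod_topology (fun _ : 'I_s => Diff r hab).

HB.instance Definition _ r s R a b hab :=
  Topological.on (@skew_products r s R a b hab).

Definition residual (T : topologicalType) (A : set T) : Prop :=
  exists2 O : nat -> set T,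
    (forall n, open (O n) /\ dense (O n)) & \bigcap_n O n `<=` A.

Section SkewProduct.
Context {r s : nat} {hs : (2 <= s)%N} {R : realType} {a b : R} {hab : a < b}.
Local Notation S := (shift_space R hs).
Local Notation I := (segment hab).

(* The product topology of [S * I] is that of the sum of the distances. *)
Lemma nbhs_sum_dist (x : S * I) (U : set (S * I)) :
  nbhs x U <->
  exists2 e : R, 0 < e & forall y,
    shift_dist x.1 y.1 + `|set_val x.2 - set_val y.2| < e -> U y.
Proof.
split.
  move=> [[P Q] /= [/nbhs_ballP[e1 e1_gt0 eP] /nbhs_ballP[e2 e2_gt0 eQ]] PQU].
  exists (Num.min e1 e2) => [|y]; first by rewrite lt_min; apply/andP.
  rewrite lt_min => /andP[lt1 lt2]; apply: PQU; split.
    by apply: eP; rewrite ballEmdist/=; apply: le_lt_trans lt1; rewrite lerDl.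
  apply: eQ; apply: le_lt_trans lt2; rewrite lerDr.
  by case: shift_distP => // m _ _; rewrite invr_ge0 exprn_ge0.
move=> [e e0 eU]; exists (ball x.1 (e / 2), ball x.2 (e / 2)).
  by split; apply: nbhsx_ballx; rewrite divr_gt0.
move=> y [/=]; rewrite ballEmdist/= => y1 y2; apply: eU.
by rewrite [e]splitr ltrD.
Qed.

Definition shift (w : S) : S := fun n => w (n + 1).

Definition skew_map (F : skew_products r s hab) (x : S * I) : S * I :=
  (shift x.1, F (x.1 0) x.2).

Definition skew_measure : set (S * I) -> \bar R :=
  (@bernoulli_measure R s hs \x @segment_lebesgue R a b hab)%E.

End SkewProduct.

Section Attractors.
Context {s : nat} {hs : (2 <= s)%N} {R : realType} {a b : R} {hab : a < b}.
Local Notation X := (shift_space R hs * segment hab)%type.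
Local Notation mu := (@skew_measure s hs R a b hab).
Variable F : X -> X.

Definition omega_limit (x : X) : set X := cluster ((fun n => iter n F x) @ \oo).

Definition visits (x : X) (U : set X) (N : nat) : nat :=
  #|[set n : 'I_N | `[< U (iter n F x) >]]|.

Definition freq (x : X) (U : set X) : \bar R :=
  limn_esup (fun N => ((visits x U N)%:R / N%:R)%:E).

Definition omega_stat (x : X) : set X :=
  [set z | forall U, nbhs z U -> (0 < freq x U)%E].

Definition is_attractor (L : X -> set X) (A : set X) : Prop :=
  let captures B := closed B /\ {ae mu, forall x, L x `<=` B} in
  captures A /\ forall B, captures B -> A `<=` B.

Definition is_milnor_attractor : set X -> Prop := is_attractor omega_limit.

Definition is_statistical_attractor : set X -> Prop := is_attractor omega_stat.

Definition lyapunov_stable (A : set X) : Prop :=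
  [/\ closed A, F @` A `<=` A &
    forall U, set_nbhs A U -> exists V,
      [/\ set_nbhs A V, V `<=` U & forall x n, V x -> U (iter n F x)]].

End Attractors.

(* Main.v *)
Require Import Defs.
From mathcomp Require Import all_boot all_order all_algebra.
From mathcomp Require Import all_classical all_reals all_analysis.
From mathcomp Require Import measurable_realfun.
From mathcomp Require Import ring lra zify.
Import Defs.

Set Implicit Arguments.
Unset Strict Implicit.
Unset Printing Implicit Defensive.

Import Order.TTheory GRing.Theory Num.Theory.
Import numFieldNormedType.Exports.
Local Open Scope classical_set_scope.
Local Open Scope ring_scope.

(** The fibers of a skew product are moved by increasing maps g_1, ..., g_s of
    [a, b] into itself, composed along the letters of the base sequence, so
    everything is read off from the action [act] of finite words on the line.

    Good intervals.  Suppose that every letter maps [c, d] into its own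
    interior, and that some word w maps [c, d] into an interval which a
    single letter i contracts; call (c, d) [good].  Let p be the fixed point of
    i in that interval.  The words w i^k bring the whole of [c, d] as close
    to p as desired, and each of them occurs with positive frequency in almost
    every sequence.  Hence an orbit that has entered (c, d) passes close to the
    images of p under all words, with positive frequency.  If moreover the
    orbit of p under words is stable, in the sense that points close to it
    remain close to it, then an orbit which was once close to p accumulates
    nowhere else.  Keeping track of the past symbols, this determines a closed
    set [piece] in the phase space which is both the omega-limit set and the
    statistical omega-limit set of almost every point over (c, d)
    ([omega_limit_piece], [piece_omega_stat]), and which inherits stability
    from the orbit of p ([piece_stable]).  If every point of [a, b] is sent
    into a good interval by some word, then by compactness finitely many good
    intervals suffice and a random word enters one of them almost surely
    ([ae_absorbed]), so that both attractors are the union of finitely many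
    pieces ([generic_attractor]).

    Genericity.  For an open set G of skew products, G together with the
    interior of its complement ([settled]) is open and dense.  A generic skew
    product therefore satisfies any given one of countably many open
    conditions as soon as arbitrarily small perturbations of it do.  All the
    perturbations below are pulls (1 - t) f + t q of the fiber maps towards a
    point q.  What a generic skew product needs is the following.

    - The maps have no common fixed point.  Pulling two of them towards b with
      two independent parameters, the common fixed points for different
      parameters are separated by an amount proportional to the distance of
      the parameters; there is no room on a segment for a two-dimensional
      family of such points ([exists_no_common_fixpoint]).

    - Every point reaches a good interval ([reach_good]).  Otherwise the points
      that do not form a compact invariant set Z.  Among the pairs m <= X in Z
      such that no letter moves m down or X up, choose one of minimal length;
      then m < X since there is no common fixed point.  Minimality implies that
      words bring X arbitrarily close to m, and that some letter fixes m and
      brings points close to m still closer, so that its slope at m is at most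
      1.  A slight pull towards a point just above m turns (m, X) into a good
      interval.  By genericity its points reach a good interval already for
      the unperturbed maps, and so does m or X: a contradiction.

    - The orbit of p is stable ([stable_orbit]).  Otherwise points arbitrarily
      close to the orbit of p are sent by words into an interval B that the
      orbit of p avoids.  A slight pull towards b (or a) raises (or lowers) the
      image of p past such a starting point, and by the intermediate value
      theorem a pull in between sends p, and with it an image of the whole of
      [c, d], into B.  By genericity the unperturbed maps have a word sending
      [c, d] into B: a contradiction. *)

(** * Calculus on subsets of the line *)

Section SubsetCalculus.
Context {R : realType}.

Lemma nbhs_set_typeP (D : set R) (x : D) (U : set D) :
  nbhs x U <-> exists2 e : R, 0 < e &
    forall y : D, `|set_val x - set_val y| < e -> U y.
Proof.
rewrite -(@nbhs_ballE R) /nbhs_ball_ /filter_from /=; split.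
  by move=> [e e0 xU]; exists e => // y xy; exact: xU.
by move=> [e e0 xU]; exists e => // y xy; exact: xU.
Qed.

Lemma dnbhs_set_typeP (D : set R) (x : D) (U : set D) :
  x^' U <-> exists2 e : R, 0 < e &
    forall y : D, y != x -> `|set_val x - set_val y| < e -> U y.
Proof.
split => [/nbhs_set_typeP[e e0 xU]|[e e0 xU]].
  by exists e => // y yx xy; exact: xU.
by apply/nbhs_set_typeP; exists e => // y xy yx; exact: xU.
Qed.

Lemma continuous_set_typeP (D : set R) (f : D -> R) :
  continuous f <-> forall x (e : R), 0 < e -> exists2 d : R, 0 < d &
    forall y : D, `|set_val x - set_val y| < d -> `|f x - f y| < e.
Proof.
split => [cf x e e0|H x U /nbhs_ballP[e e0 xU]].
  apply/(nbhs_set_typeP x (fun y => `|f x - f y| < e)).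
  exact: (cf x (ball (f x) e)) (nbhsx_ballx _ _ e0).
have [d d0 xd] := H x e e0; apply/nbhs_set_typeP; exists d => // y xy.
by apply: xU; exact: xd.
Qed.

(** Where it fails, [lim] along the trivial filter is arbitrary, and no rule of
    calculus holds for [deriv]. *)
Definition nonisolated (D : set R) := forall x : D, ProperFilter x^'.

Lemma deriv_affine (D : set R) (f : D -> R) (al be : R) : nonisolated D ->
  has_deriv f -> has_deriv (fun y => al * f y + be) /\
  deriv (fun y => al * f y + be) = (fun x => al * deriv f x).
Proof.
move=> nD df.
have E x : diff_quotient (fun y => al * f y + be) x @ x^' --> al * deriv f x.
  rewrite (_ : diff_quotient _ x = fun y => al * diff_quotient f x y).
    by apply: cvgMr; exact: df.
  apply/funext => y; rewrite /diff_quotient mulrA; congr (_ / _); ring.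
split; first by move=> x; apply/cvg_ex; eexists; exact: E.
by apply/funext => x; have := nD x => ?; apply: cvg_lim => //; exact: E.
Qed.

Lemma deriv_scale (D : set R) (f : D -> R) (al : R) : nonisolated D ->
  has_deriv f -> has_deriv (fun y => al * f y) /\
  deriv (fun y => al * f y) = (fun x => al * deriv f x).
Proof.
move=> nD df; rewrite (_ : (fun y => al * f y) = (fun y => al * f y + 0)).
  exact: deriv_affine.
by apply/funext => y; rewrite addr0.
Qed.

Lemma deriv_n_affine (D : set R) (f : D -> R) (al be : R) r k : nonisolated D ->
  smooth r f -> (k <= r)%N ->
  deriv_n k (fun y => al * f y + be) =
  (fun x => al * deriv_n k f x + (if k == 0%N then be else 0)).
Proof.
move=> nD [sf _]; elim: k => [//|k IH] kr.
rewrite /deriv_n iterS -/(deriv_n k _) IH 1?ltnW//.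
rewrite (deriv_affine _ _ nD (sf _ kr)).2; apply/funext => x.
by rewrite /= addr0.
Qed.

Lemma smooth_affine (D : set R) (f : D -> R) (al be : R) r : nonisolated D ->
  smooth r f -> smooth r (fun y => al * f y + be).
Proof.
move=> nD sf; split => [k kr|].
  rewrite (deriv_n_affine _ _ nD sf) 1?ltnW//.
  exact: (deriv_affine _ _ nD (sf.1 _ kr)).1.
rewrite (deriv_n_affine _ _ nD sf)// => x; have fx := @nbhs_filter _ x.
by apply: (@cvgD _ _ _ _ fx); [apply: (@cvgMr _ _ _ fx); exact: sf.2|exact: (@cvg_cst _ _ _ _ fx)].
Qed.

(** The inverse of a pulled map is the inverse of the original map after an
    affine change of variable; this is how its smoothness is obtained. *)
Section Reparam.
Variables (D1 D2 : set R) (phi : D2 -> D1) (al be : R).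
Hypothesis al0 : al != 0.
Hypothesis phiE : forall y, set_val (phi y) = al * set_val y + be.

Let phi_dnbhs (x : D2) : phi @ x^' --> (phi x)^'.
Proof.
move=> U /dnbhs_set_typeP[e e0 xU]; apply/dnbhs_set_typeP.
have na : 0 < `|al| by rewrite normr_gt0.
exists (e / `|al|) => [|y yx xy]; first by rewrite divr_gt0.
apply: xU.
  apply: contra_neq yx => /(congr1 set_val); rewrite !phiE => /addIr/(mulfI al0).
  exact: val_inj.
rewrite !phiE opprD addrACA subrr addr0 -mulrBr normrM mulrC.
by rewrite -ltr_pdivlMr.
Qed.

Lemma continuous_reparam : continuous phi.
Proof.
move=> x U /nbhs_set_typeP[e e0 xU]; apply/nbhs_set_typeP.
have na : 0 < `|al| by rewrite normr_gt0.
exists (e / `|al|) => [|y xy]; first by rewrite divr_gt0.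
apply: xU; rewrite !phiE opprD addrACA subrr addr0 -mulrBr normrM mulrC.
by rewrite -ltr_pdivlMr.
Qed.

Lemma deriv_reparam (g : D1 -> R) : nonisolated D2 ->
  has_deriv g -> has_deriv (g \o phi) /\
  deriv (g \o phi) = (fun x => al * deriv g (phi x)).
Proof.
move=> nD dg.
have E x : diff_quotient (g \o phi) x @ x^' --> al * deriv g (phi x).
  rewrite (_ : diff_quotient _ x = fun y => al * diff_quotient g (phi x) (phi y)).
    apply: cvgMr.
    exact: (@cvg_comp _ _ _ phi (diff_quotient g (phi x)) _ _ _ (@phi_dnbhs x) (dg (phi x))).
  apply/funext => y; rewrite /diff_quotient /= !phiE.
  rewrite opprD addrACA subrr addr0 -mulrBr invfM mulrCA !mulrA.
  by rewrite -[_ * al * _]mulrA mulfV// mulr1.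
split; first by move=> x; apply/cvg_ex; eexists; exact: E.
by apply/funext => x; have := nD x => ?; apply: cvg_lim => //; exact: E.
Qed.

Lemma deriv_n_reparam (g : D1 -> R) r k : nonisolated D1 -> nonisolated D2 ->
  smooth r g -> (k <= r)%N ->
  deriv_n k (g \o phi) = (fun x => al ^+ k * deriv_n k g (phi x)).
Proof.
move=> nD1 nD [sg _]; elim: k => [|k IH] kr.
  by apply/funext => x /=; rewrite mul1r.
rewrite /deriv_n iterS -/(deriv_n k _) IH 1?ltnW//.
have [dg E] := deriv_scale (al ^+ k) nD1 (sg _ kr).
have [_] := deriv_reparam nD dg; rewrite E /comp /= => ->.
by apply/funext => x; rewrite mulrA -exprS.
Qed.

Lemma smooth_reparam (g : D1 -> R) r : nonisolated D1 -> nonisolated D2 ->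
  smooth r g -> smooth r (g \o phi).
Proof.
move=> nD1 nD sg; split => [k kr|].
  rewrite (deriv_n_reparam nD1 nD sg) 1?ltnW//.
  exact: (deriv_reparam nD (deriv_scale (al ^+ k) nD1 (sg.1 _ kr)).1).1.
rewrite (deriv_n_reparam nD1 nD sg)// => x.
have fx := @nbhs_filter _ x; apply: (@cvgMr _ _ _ fx).
exact: (@cvg_comp _ _ _ phi (deriv_n r g) _ _ _ (@continuous_reparam x) (sg.2 (phi x))).
Qed.

End Reparam.

Lemma has_deriv_continuous (D : set R) (f : D -> R) : has_deriv f -> continuous f.
Proof.
move=> df; apply/continuous_set_typeP => x e e0.
have /cvgrPdist_lt/(_ 1 ltr01) := df x.
move=> /dnbhs_set_typeP[d d0 H].
set l := lim _ in H.
have l0 : 0 < `|l| + 1 by rewrite ltr_wpDl.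
exists (Num.min d (e / (`|l| + 1))).
  by rewrite lt_min d0 divr_gt0.
move=> y; rewrite lt_min => /andP[xyd xye].
have [->|yx] := eqVneq y x; first by rewrite subrr normr0.
have yx0 : set_val y - set_val x != 0.
  by rewrite subr_eq0; apply: contra_neq yx => /val_inj.
have E : f x - f y = - (diff_quotient f x y * (set_val y - set_val x)).
  by rewrite /diff_quotient divfK// opprB.
rewrite E normrN normrM distrC.
apply: (@le_lt_trans _ _ ((`|l| + 1) * `|set_val x - set_val y|)).
  apply: ler_wpM2r => //; have := H y yx xyd => {}H.
  rewrite -lerBlDl; apply: (le_trans (lerB_dist _ _)); rewrite distrC; exact: ltW.
by rewrite mulrC -ltr_pdivlMr.
Qed.

Lemma smooth_deriv_n_continuous (D : set R) (f : D -> R) r k :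
  smooth r f -> (k <= r)%N -> continuous (deriv_n k f).
Proof.
move=> [sf cf]; rewrite leq_eqVlt => /orP[/eqP-> //|kr].
exact/has_deriv_continuous/sf.
Qed.

End SubsetCalculus.

(** * Functions on the segment *)
Section SegmentFunctions.
Context {R : realType} {a b : R} {hab : a < b}.
Local Notation I := (segment hab).

Lemma clamp_subproof (x : R) : Num.max a (Num.min b x) \in `[a, b]%classic.
Proof. by rewrite inE /= in_itv /= le_max lexx ge_max ge_min (ltW hab) lexx. Qed.

Definition clamp (x : R) : I := exist _ (Num.max a (Num.min b x)) (clamp_subproof x).

Lemma val_clamp x : set_val (clamp x) = Num.max a (Num.min b x).
Proof. by []. Qed.

Lemma val_segment (p : I) : a <= set_val p <= b.
Proof. by have := set_valP p; rewrite /= in_itv. Qed.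

Lemma clampK (p : I) : clamp (set_val p) = p.
Proof.
apply: val_inj; change (Num.max a (Num.min b (set_val p)) = set_val p).
by have /andP[ap pb] := val_segment p; rewrite min_r// max_r.
Qed.

Lemma val_clampE x : a <= x <= b -> set_val (clamp x) = x.
Proof. by move=> /andP[ax xb]; rewrite val_clamp min_r// max_r. Qed.

Lemma le_clamp x y : x <= y -> set_val (clamp x) <= set_val (clamp y).
Proof. by move=> xy; rewrite !val_clamp; apply: le_max2 => //; exact: le_min2. Qed.

(** The retraction [clamp] moves points only towards the segment, so where it
    does not collapse an interval it shortens it from both ends. *)
Lemma clamp_cases x y : x <= y ->
  clamp x = clamp y \/ [/\ a <= set_val (clamp x), x <= set_val (clamp x),
     set_val (clamp x) < set_val (clamp y), set_val (clamp y) <= y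
     & set_val (clamp y) <= b].
Proof.
move=> xy; have [->|ne] := pselect (clamp x = clamp y); [by left|right].
have lt : set_val (clamp x) < set_val (clamp y).
  by rewrite lt_neqAle le_clamp// andbT; apply/eqP => /val_inj.
move: lt; have /andP[? ?] := val_segment (clamp x).
have /andP[? ?] := val_segment (clamp y); rewrite !val_clamp => lt.
split => //; move: lt; rewrite gt_max !lt_max !gt_min !lt_min.
  by rewrite !le_max !le_min; case: (lerP x b) => [|]; rewrite ?lexx ?orbT //= => bx; lra.
rewrite !ge_max !ge_min; case: (lerP a y) => [|]; rewrite ?lexx ?orbT //= => ya; lra.
Qed.

Lemma dist_clamp x y : x <= y ->
  0 <= set_val (clamp y) - set_val (clamp x) <= y - x.
Proof. by move=> xy; have [->|[]] := clamp_cases xy; [rewrite subrr; lra|lra]. Qed.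

Lemma nonisolated_segment : nonisolated `[a, b]%classic.
Proof.
move=> x; split; last exact: within_filter.
move=> /dnbhs_set_typeP[e e0 H].
have /andP[ax xb] := val_segment x.
pose d := Num.min (e / 2) ((b - a) / 2).
have d0 : 0 < d by rewrite lt_min !divr_gt0// subr_gt0.
have de : d < e by rewrite gt_min ltr_pdivrMr// ltr_pMr// ltrDl ltr01.
have [xm|xm] := leP (set_val x) ((a + b) / 2).
  have dE : set_val (clamp (set_val x + d)) = set_val x + d.
    apply: val_clampE; apply/andP; split; first by lra.
    have : d <= (b - a) / 2 by rewrite ge_min lexx orbT.
    lra.
  apply: (H (clamp (set_val x + d))).
    by apply/eqP => /(congr1 set_val); rewrite dE; lra.
  by rewrite dE opprD addrA subrr sub0r normrN gtr0_norm.
have dE : set_val (clamp (set_val x - d)) = set_val x - d.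
  apply: val_clampE; apply/andP; split; last by lra.
  have : d <= (b - a) / 2 by rewrite ge_min lexx orbT.
  lra.
apply: (H (clamp (set_val x - d))).
  by apply/eqP => /(congr1 set_val); rewrite dE; lra.
by rewrite dE opprB addrC subrK gtr0_norm.
Qed.

Lemma continuous_clamp_comp (f : set_type `[a, b]%classic -> R) :
  continuous f -> continuous (f \o clamp).
Proof.
move=> /continuous_set_typeP cf x; apply/cvgrPdist_lt => e e0.
have [d d0 H] := cf (clamp x) e e0.
near=> y; apply: H; apply: le_lt_trans (_ : `|x - y| < d); last first.
  by near: y; exact: (nbhsx_ballx x _ d0).
have [xy|yx] := leP x y.
  have := dist_clamp xy; rewrite distrC [`|x - y|]distrC => /andP[h1 h2].
  by rewrite ger0_norm// ger0_norm// subr_ge0.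
have := dist_clamp (ltW yx) => /andP[h1 h2].
by rewrite ger0_norm// ger0_norm// subr_ge0 ltW.
Unshelve. all: end_near. Qed.

(** At interior points the derivative relative to the segment is the ordinary
    one, which makes the mean value theorem on the line available. *)
Lemma is_derive_clamp_comp (f : set_type `[a, b]%classic -> R) x :
  has_deriv f -> a < x < b -> is_derive x 1 (f \o clamp) (deriv f (clamp x)).
Proof.
move=> df /andP[ax xb]; have xE : set_val (clamp x) = x by apply: val_clampE; lra.
have cv : h^-1 *: ((f \o clamp) (h *: 1 + x) - (f \o clamp) x) @[h --> 0^'] -->
    deriv f (clamp x).
  apply/cvgrPdist_lt => e e0.
  have /cvgrPdist_lt/(_ e e0)/dnbhs_set_typeP[d d0 H] := df (clamp x).
  near=> h.
  have h0 : h != 0 by near: h; exact: nbhs_dnbhs_neq.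
  have hd : `|h| < Num.min d (Num.min (x - a) (b - x)).
    near: h; apply: dnbhs0_lt; rewrite !lt_min d0 /=; lra.
  move: hd; rewrite !lt_min => /and3P[hd hxa hxb].
  have hE : set_val (clamp (h + x)) = h + x.
    apply: val_clampE; move: hxa hxb; rewrite !ltr_norml => /andP[? ?] /andP[? ?].
    lra.
  have := H (clamp (h + x)).
  rewrite [diff_quotient _ _ (clamp (h + x))]/diff_quotient hE xE addrK opprD addrCA subrr addr0 normrN => /(_ _ hd).
  have -> : h *: (1 : R) = h by exact: mulr1.
  rewrite -[h^-1 *: _]/(h^-1 * _) [h^-1 * _]mulrC; apply.
  by apply/eqP => /(congr1 set_val); rewrite hE xE; move/eqP: h0; lra.
apply: DeriveDef; first by apply/cvg_ex; eexists; exact: cv.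
exact: cvg_lim.
Unshelve. all: end_near. Qed.

Lemma deriv_le_increment (f : set_type `[a, b]%classic -> R) (K : R) (p q : I) :
  has_deriv f -> set_val p < set_val q ->
  (forall z : I, set_val p <= set_val z <= set_val q -> deriv f z <= K) ->
  f q - f p <= K * (set_val q - set_val p).
Proof.
move=> df pq dK.
have /andP[ap pb] := val_segment p; have /andP[aq qb] := val_segment q.
have [|c /=|c] := @MVT _ (f \o clamp) (fun x => deriv f (clamp x)) _ _ pq.
- move=> x; rewrite in_itv /= => /andP[px xq].
  apply: is_derive_clamp_comp => //; lra.
- apply: continuous_subspaceT; apply: continuous_clamp_comp.
  exact: has_deriv_continuous.
rewrite in_itv /= !clampK => /andP[pc cq] ->.
apply: ler_wpM2r; first by rewrite subr_ge0 ltW.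
by apply: dK; rewrite val_clampE; lra.
Qed.

Lemma continuous_bounded (f : set_type `[a, b]%classic -> R) :
  continuous f -> exists2 K : R, 0 < K & forall p, `|f p| <= K.
Proof.
move=> cf; have cF : {within `[a, b], continuous (f \o clamp)}.
  by apply: continuous_subspaceT; exact: continuous_clamp_comp.
have [c _ cmax] := EVT_max (ltW hab) cF.
have [d _ dmin] := EVT_min (ltW hab) cF.
exists (`|f (clamp c)| + `|f (clamp d)| + 1) => [|p].
  by rewrite ltr_wpDl// addr_ge0.
have pI : set_val p \in `[a, b] by rewrite in_itv; exact: val_segment.
have := cmax _ pI; have := dmin _ pI; rewrite /= clampK => h1 h2.
have := ler_norm (f (clamp c)); have := ler_norm (- f (clamp d)); rewrite normrN.
move=> h3 h4; have := normr_ge0 (f (clamp c)); have := normr_ge0 (f (clamp d)).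
by move=> h5 h6; rewrite ler_norml; lra.
Qed.

End SegmentFunctions.

(** * Diffeomorphisms of the segment and their contractions towards a point *)
Section DiffeoFacts.
Context {r : nat} {R : realType} {a b : R} {hab : a < b}.
Local Notation I := (segment hab).
Local Notation T := (Diff r hab).

(** A self-map of the segment as a self-map of the line: words of fiber maps,
    perturbations and inequalities can then be written without subtypes. *)
Definition ext (f : I -> I) (x : R) : R := set_val (f (clamp x)).

Lemma ext_val (f : I -> I) p : ext f (set_val p) = set_val (f p).
Proof. by rewrite /ext clampK. Qed.

Lemma ext_itv (f : I -> I) x : a <= ext f x <= b.
Proof. exact: val_segment. Qed.

Lemma Diff_preserves_orientation (f : T) : preserves_orientation f.
Proof. by case: (set_valP f). Qed.

Lemma Diff_smooth (f : T) : smooth r (real_of f).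
Proof. by case: (set_valP f) => -[]. Qed.

Lemma ext_homo (f : T) : {homo ext f : x y / x <= y}.
Proof.
move=> x y xy; have [E|[_ _ lt _ _]] := clamp_cases (hab := hab) xy.
  by rewrite /ext E.
exact/ltW/Diff_preserves_orientation.
Qed.

(** The interval [c, d] may stick out of the segment. *)
Lemma ext_increment (f : T) (c d K : R) : (0 < r)%N -> 0 <= K ->
  (forall p : I, c <= set_val p <= d -> deriv (real_of f) p <= K) ->
  forall x y, c <= x -> x <= y -> y <= d -> ext f y - ext f x <= K * (y - x).
Proof.
move=> r0 K0 fK x y cx xy yd.
have [E|[_ xc lt cy _]] := clamp_cases (hab := hab) xy.
  by rewrite /ext E subrr mulr_ge0// subr_ge0.
have hd : has_deriv (real_of f) := (Diff_smooth f).1 0%N r0.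
apply: le_trans (_ : K * (set_val (clamp (hab := hab) y) - set_val (clamp (hab := hab) x)) <= _).
  apply: (deriv_le_increment hd lt) => z /andP[? ?].
  by apply: fK; lra.
by apply: ler_wpM2l => //; lra.
Qed.

Lemma deriv_n_bounded (f : T) k : (k <= r)%N ->
  exists2 K : R, 0 < K & forall p : I, `|deriv_n k (real_of f) p| <= K.
Proof.
move=> kr; apply: (continuous_bounded (hab := hab)).
exact: (@smooth_deriv_n_continuous _ _ _ r k (Diff_smooth f) kr).
Qed.

Lemma ext_lipschitz (f : T) : (0 < r)%N -> exists2 L : R, 1 <= L &
  forall x y, x <= y -> ext f y - ext f x <= L * (y - x).
Proof.
move=> r0; have [K K0 fK] := deriv_n_bounded f r0.
exists (K + 1) => [|x y xy]; first by rewrite lerDr ltW.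
apply: (@ext_increment f x y (K + 1) r0) => //; first by rewrite addr_ge0// ltW.
move=> p _; apply: (le_trans (ler_norm _)); apply: (le_trans (fK p)).
by rewrite lerDl.
Qed.

(** The inverse of a fiber map lives on the range of that map, so its
    derivatives are meaningful only if the range has no isolated point. *)
Lemma nonisolated_range (f : set_type `[a, b]%classic -> R) :
  continuous f -> injective f -> nonisolated (range f).
Proof.
move=> /continuous_set_typeP cf fI y; split; last exact: within_filter.
move=> /dnbhs_set_typeP[e e0 H].
have [p _ py] := set_valP y.
have [d d0 pd] := cf p e e0.
have pf := nonisolated_segment (hab := hab) p.
have /filter_ex[q [qp pq]] : p^' [set q | q != p /\ `|set_val p - set_val q| < d].
  by apply/dnbhs_set_typeP; exists d.
have fq : f q \in range f by apply: mem_set; exists q.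
apply: (H (exist _ (f q) fq)).
  apply/eqP => /(congr1 set_val) E.
  have /fI/eqP : f q = f p by rewrite [RHS]py; exact: E.
  by rewrite (negbTE qp).
change (`|set_val y - f q| < e).
by have <- : f p = set_val y := py; exact: pd.
Qed.

Lemma continuous_real_of (f : T) : continuous (real_of f).
Proof. exact: (@smooth_deriv_n_continuous _ _ _ r 0 (Diff_smooth f) (leq0n r)). Qed.

Lemma real_of_inj (f : T) : injective (real_of f).
Proof.
move=> p q; have [lt E|gt E|/val_inj//] := ltgtP (set_val p) (set_val q).
  by have := Diff_preserves_orientation f lt; rewrite E ltxx.
by have := Diff_preserves_orientation f gt; rewrite E ltxx.
Qed.

Section Contraction.
Variables (f : T) (t q : R).
Hypothesis tq : 0 <= t < 1 /\ a <= q <= b.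

Definition pull_fun (p : I) : I := clamp ((1 - t) * set_val (f p) + t * q).

Lemma real_of_pull_fun :
  real_of pull_fun = fun p => (1 - t) * real_of f p + t * q.
Proof.
apply/funext => p; apply: val_clampE.
have /andP[fa fb] := val_segment (f p).
move: tq => [/andP[t0 t1] /andP[qa qb]]; apply/andP; split; nra.
Qed.

Lemma pull_fun_Diff :
  pull_fun \in [set f : I -> I | diffeo_onto_image r f /\ preserves_orientation f].
Proof.
apply: mem_set => /=.
have t1 : 0 < 1 - t by move: tq => [/andP[? ?] _]; lra.
split; last first.
  move=> x y xy; rewrite real_of_pull_fun ltrD2r ltr_pM2l//.
  exact: Diff_preserves_orientation.
split.
  rewrite real_of_pull_fun; apply: smooth_affine; last exact: Diff_smooth.
  exact: (nonisolated_segment (hab := hab)).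
have [[_ [g [sg gf]]] _] := set_valP f.
have inv_range (y : range (real_of pull_fun)) :
    (1 - t)^-1 * set_val y + - ((1 - t)^-1 * (t * q)) \in range (real_of f).
  apply: mem_set; have [p _ py] := set_valP y; exists p => //.
  have <- : real_of pull_fun p = set_val y := py.
  by rewrite real_of_pull_fun -mulrBr addrK mulKf// gt_eqF.
pose phi (y : range (real_of pull_fun)) : range (real_of f) :=
  exist _ ((1 - t)^-1 * set_val y + - ((1 - t)^-1 * (t * q))) (inv_range y).
have phiE y : set_val (phi y) = (1 - t)^-1 * set_val y + - ((1 - t)^-1 * (t * q)).
  by [].
have al0 : (1 - t)^-1 != 0 by rewrite invr_eq0 gt_eqF.
exists (g \o phi); split.
  apply: (smooth_reparam al0 phiE) => //; apply: nonisolated_range.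
  - exact: continuous_real_of.
  - exact: real_of_inj.
  - rewrite real_of_pull_fun.
    have /(smooth_affine (1 - t) (t * q) (nonisolated_segment (hab := hab))) sm := Diff_smooth f.
    exact: (@smooth_deriv_n_continuous _ _ _ r 0 sm (leq0n r)).
  - rewrite real_of_pull_fun => p1 p2 /addIr/(mulfI (lt0r_neq0 t1)).
    exact: real_of_inj.
move=> x y yx /=; apply: gf; rewrite phiE yx real_of_pull_fun -mulrBr addrK.
by rewrite mulKf// gt_eqF.
Qed.

End Contraction.

(** The value [f] outside of the parameter range is arbitrary. *)
Definition pull (t q : R) (f : T) : T :=
  match pselect (0 <= t < 1 /\ a <= q <= b) with
  | left tq => exist _ (pull_fun f t q) (pull_fun_Diff f tq)
  | right _ => f
  end.

Lemma real_of_pull f t q : 0 <= t < 1 -> a <= q <= b ->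
  real_of (pull t q f) = fun p => (1 - t) * real_of f p + t * q.
Proof.
move=> ht hq; rewrite /pull; case: pselect => [tq|[]//].
exact: real_of_pull_fun.
Qed.

Lemma ext_pull f t q x : 0 <= t < 1 -> a <= q <= b ->
  ext (pull t q f) x = (1 - t) * ext f x + t * q.
Proof.
move=> ht hq; rewrite -[LHS]/(real_of (pull t q f) (clamp x)).
by rewrite real_of_pull.
Qed.

Lemma deriv_pull f t q p : (0 < r)%N -> 0 <= t < 1 -> a <= q <= b ->
  deriv (real_of (pull t q f)) p = (1 - t) * deriv (real_of f) p.
Proof.
move=> r0 ht hq; rewrite real_of_pull//.
by rewrite (deriv_affine _ _ (nonisolated_segment (hab := hab)) ((Diff_smooth f).1 0%N r0)).2.
Qed.

Lemma pull_close f (e : R) : 0 < e -> exists2 d : R, 0 < d < 1 &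
  forall t q, 0 <= t < d -> a <= q <= b -> cr_ball f e (pull t q f).
Proof.
move=> e0.
(* f minus its pull is t (f - q), so it is enough to bound all derivatives *)
have [K K0 fK] : exists2 K : R, 0 < K & forall k, (k <= r)%N -> forall p : I,
    `|deriv_n k (real_of f) p| <= K.
  have : forall n, (n <= r)%N -> exists2 K : R, 0 < K & forall k, (k <= n)%N ->
      forall p : I, `|deriv_n k (real_of f) p| <= K.
    elim=> [|n IH] nr.
      have [K K0 fK] := deriv_n_bounded f nr; exists K => // k.
      by rewrite leqn0 => /eqP ->.
    have [K K0 fK] := IH (ltnW nr); have [K' K'0 fK'] := deriv_n_bounded f nr.
    exists (K + K') => [|k]; first by rewrite addr_gt0.
    rewrite leq_eqVlt => /orP[/eqP -> p|kn p].
      by apply: le_trans (fK' p) _; rewrite lerDr ltW.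
    by apply: le_trans (fK k kn p) _; rewrite lerDl ltW.
  by apply.
have B0 : 0 < K + (b - a) + 1 by rewrite addr_gt0// addr_gt0// subr_gt0.
exists (Num.min (1 / 2) (e / (K + (b - a) + 1))).
  rewrite lt_min divr_gt0//= divr_gt0//= gt_min; apply/orP; left; lra.
move=> t q /andP[t0]; rewrite lt_min => /andP[t1 te] hq k kr p.
have t01 : 0 <= t < 1 by lra.
have : t * (K + (b - a) + 1) < e by rewrite -ltr_pdivlMr.
rewrite real_of_pull// (deriv_n_affine _ _ (nonisolated_segment (hab := hab)) (Diff_smooth f) kr).
have := fK k kr p; case: (k =P 0%N) => [->|_] /=.
  have := val_segment (f p); have /andP[? ?] := hq.
  rewrite /deriv_n /= /real_of /comp /= => /andP[? ?] _ te'.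
  apply: le_lt_trans te'; rewrite ler_norml; apply/andP; split; nra.
set d := deriv_n k _ p; rewrite addr0 (_ : d - (1 - t) * d = t * d); last by ring.
rewrite normrM (ger0_norm t0) => h te'.
apply: le_lt_trans te'; apply: ler_wpM2l => //; lra.
Qed.

End DiffeoFacts.

(** * The topology of the space of skew products *)
Section SkewTopology.
Context {r s : nat} {R : realType} {a b : R} {hab : a < b}.
Local Notation T := (Diff r hab).
Local Notation TI := (skew_products r s hab).

Lemma cr_ball_le (f g : T) (e1 e2 : R) : e1 <= e2 -> cr_ball f e1 g -> cr_ball f e2 g.
Proof. by move=> e12 fg k kr x; apply: lt_le_trans e12; exact: fg. Qed.

Lemma nbhs_DiffP (f : T) (U : set T) :
  nbhs f U <-> exists2 e : R, 0 < e & forall g, cr_ball f e g -> U g.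
Proof.
rewrite -(@nbhs_ballE R) /nbhs_ball_ /filter_from /=.
by split=> -[e e0 H]; exists e.
Qed.

Let cr_balls (F : TI) : set_system TI :=
  filter_from [set e : R | 0 < e] (fun e => [set F' | forall i, cr_ball (F i) e (F' i)]).

Let cr_balls_filter F : Filter (cr_balls F).
Proof.
apply: filter_from_filter; first by exists 1 => /=.
move=> e1 e2 /= e10 e20; exists (Num.min e1 e2); first by rewrite /= lt_min e10.
move=> F' H; split=> i; apply: cr_ball_le (H i); by rewrite ge_min lexx ?orbT.
Qed.

Lemma nbhs_skew_productsP (F : TI) (U : set TI) :
  nbhs F U <-> exists2 e : R, 0 < e &
    forall F' : TI, (forall i, cr_ball (F i) e (F' i)) -> U F'.
Proof.
split => [FU|[e e0 H]]; last first.
  have : \forall F' \near F, forall i, cr_ball (F i) e ((F' : TI) i).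
    apply: (@filter_forall TI 'I_s (fun i F' => cr_ball (F i) e (F' i)) (nbhs F)) => i.
    apply: (@proj_continuous 'I_s (fun=> T) i F [set g | cr_ball (F i) e g]).
    by apply/nbhs_DiffP; exists e.
  by apply: (@filterS _ (nbhs F)) => F'; exact: H.
suff /(_ U FU) : cr_balls F --> F by case=> e e0 H; exists e.
have FF := cr_balls_filter F.
apply/cvg_sup => i A [B [[C oC <-] /= CF] BA].
have /nbhs_DiffP[e e0 H] : nbhs (F i) C by apply: open_nbhs_nbhs.
by exists e => //= F' F'e; apply: BA; apply: H; exact: F'e.
Qed.

Lemma nbhsS (F : TI) (U V : set TI) : (forall F', U F' -> V F') -> nbhs F U -> nbhs F V.
Proof. by move=> UV; apply: (@filterS _ (nbhs F)). Qed.

Lemma nbhsI (F : TI) (U V : set TI) : nbhs F U -> nbhs F V -> nbhs F (U `&` V).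
Proof. exact: (@filterI _ (nbhs F)). Qed.

Lemma open_skew_productsP (U : set TI) :
  open U <-> forall F, U F -> nbhs F U.
Proof. by rewrite openE; split => H F; exact: H. Qed.

(** A skew product in this set belongs to [G] as soon as it has arbitrarily
    small perturbations in [G].  For open [G] this is an open dense
    requirement. *)
Definition settled (G : set TI) := G `|` interior (~` G).

Lemma open_settled G : open G -> open (settled G).
Proof. by move=> oG; apply: openU => //; exact: open_interior. Qed.

Lemma dense_settled G : open G -> dense (settled G).
Proof.
move=> oG U [F UF] oU.
have [[F' [UF' GF']]|H] := pselect (exists F', U F' /\ G F').
  by exists F'; split => //; left.
exists F; split => //; right; apply: (filterS _ (open_nbhs_nbhs (conj oU UF))).
by move=> F' UF' GF'; apply: H; exists F'.
Qed.

Lemma residual_bigcap (X : topologicalType) (K : countType) (O : K -> set X) :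
  (forall k, open (O k) /\ dense (O k)) -> residual (\bigcap_k O k).
Proof.
move=> HO; exists (fun n => if unpickle n is Some k then O k else setT).
  move=> n; case: unpickle => [k|]; first exact: HO.
  split; first exact: openT.
  by move=> U U0 oU; rewrite setIT.
by move=> x Hx k _; have := Hx (pickle k) Logic.I; rewrite pickleK.
Qed.

Definition pull_all (t : 'I_s -> R) (q : R) (F : TI) : TI :=
  fun i => pull (t i) q (F i).

Lemma nbhs_pull_all (F : TI) (U : set TI) : nbhs F U ->
  exists2 d : R, 0 < d < 1 & forall t q, (forall i, 0 <= t i < d) ->
    a <= q <= b -> U (pull_all t q F).
Proof.
move=> /nbhs_skew_productsP[e e0 H].
have [d0 d01] : exists2 d : R, 0 < d < 1 & forall i t q, 0 <= t < d ->
    a <= q <= b -> cr_ball (F i) e (pull t q (F i)); last first.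
  by move=> H'; exists d0 => // t q ht hq; apply: H => i; exact: H'.
have /choice[d Hd] : forall i, exists d : R, 0 < d < 1 /\ forall t q,
    0 <= t < d -> a <= q <= b -> cr_ball (F i) e (pull t q (F i)).
  by move=> i; have [d d01 Hd] := pull_close (F i) e0; exists d.
exists (\big[Num.min/1 / 2]_i d i).
  apply/andP; split.
    by apply: lt_bigmin => [|i _]; [lra|case: (Hd i) => /andP[]].
  by apply: le_lt_trans (bigmin_le_id _ _ _ _) _; lra.
move=> i t q /andP[t0 td] hq; apply: (Hd i).2 => //; rewrite t0 /=.
by apply: lt_le_trans td _; exact: bigmin_le_cond.
Qed.

End SkewTopology.

(** * Words and good intervals *)
Section Words.
Context {R : realType} {s : nat}.
Implicit Types (g : 'I_s -> R -> R) (w : seq 'I_s).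

Lemma increment_dist (f : R -> R) (K : R) : {homo f : x y / x <= y} ->
  (forall x y, x <= y -> f y - f x <= K * (y - x)) ->
  forall x y, `|f x - f y| <= K * `|x - y|.
Proof.
move=> fh fK x y; have key u v : u <= v -> `|f v - f u| <= K * `|v - u|.
  move=> uv; rewrite (ger0_norm (_ : 0 <= v - u)) ?subr_ge0//.
  by rewrite ger0_norm ?subr_ge0 ?fh//; exact: fK.
have [xy|/ltW xy] := leP y x; first exact: key.
by rewrite distrC [`|x - y|]distrC; exact: key.
Qed.

(** The first letter acts first, in the order in which an orbit of the skew
    product reads its symbols. *)
Definition act g w (x : R) : R := foldl (fun y i => g i y) x w.

Lemma act_cat g v w x : act g (v ++ w) x = act g w (act g v x).
Proof. exact: foldl_cat. Qed.

Lemma act_rcons g w i x : act g (rcons w i) x = g i (act g w x).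
Proof. by rewrite /act foldl_rcons. Qed.

Lemma act_homo g w : (forall i, {homo g i : x y / x <= y}) ->
  {homo act g w : x y / x <= y}.
Proof. by move=> gh; elim: w => //= i w IH x y xy; apply: IH; exact: gh. Qed.

Lemma act_lipschitz g (L : R) w : 0 <= L -> (forall i, {homo g i : x y / x <= y}) ->
  (forall i x y, x <= y -> g i y - g i x <= L * (y - x)) ->
  forall x y, x <= y -> act g w y - act g w x <= L ^+ size w * (y - x).
Proof.
move=> L0 gh gL; elim: w => [|i w IH] x y xy; first by rewrite mul1r.
apply: le_trans (IH _ _ (gh i _ _ xy)) _.
by rewrite /= exprSr -mulrA ler_wpM2l ?exprn_ge0// gL.
Qed.

Lemma act_itv g (a b : R) w x : (forall i y, a <= g i y <= b) ->
  a <= x <= b -> a <= act g w x <= b.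
Proof. by move=> gab; elim: w x => //= i w IH x _; exact: IH. Qed.

End Words.

Section GoodIntervals.
Context {r s : nat} {R : realType} {a b : R} {hab : a < b}.
Hypothesis r0 : (0 < r)%N.
Local Notation T := (Diff r hab).
Local Notation TI := (skew_products r s hab).
Implicit Types (F : TI) (w : seq 'I_s).

Definition fibers F : 'I_s -> R -> R := fun i => ext (F i).

Lemma fibers_homo F i : {homo fibers F i : x y / x <= y}.
Proof. exact: ext_homo. Qed.

Lemma act_fibers_homo F w : {homo act (fibers F) w : x y / x <= y}.
Proof. by apply: act_homo => i; exact: fibers_homo. Qed.

Lemma fibers_itv F i x : a <= fibers F i x <= b.
Proof. exact: ext_itv. Qed.

Lemma fibers_lipschitz F : exists2 L : R, 1 <= L &
  forall i x y, x <= y -> fibers F i y - fibers F i x <= L * (y - x).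
Proof.
have /choice[L HL] : forall i, exists L : R, 1 <= L /\
    forall x y, x <= y -> fibers F i y - fibers F i x <= L * (y - x).
  by move=> i; have [L L1 HL] := ext_lipschitz (F i) r0; exists L.
exists (\big[Num.max/1]_i L i); first exact: bigmax_ge_id.
move=> i x y xy; apply: le_trans ((HL i).2 x y xy) _.
by apply: ler_wpM2r; [rewrite subr_ge0|exact: le_bigmax].
Qed.

Lemma near_fibers F (e : R) : 0 < e ->
  nbhs F [set F' | forall i x, `|fibers F' i x - fibers F i x| < e].
Proof.
move=> e0; apply/nbhs_skew_productsP; exists e => // F' FF' i x.
by have := FF' i 0%N (leq0n r) (clamp x); rewrite distrC.
Qed.

Lemma near_deriv F (e : R) : 0 < e ->
  nbhs F [set F' | forall i p, deriv (real_of (F' i)) p < deriv (real_of (F i)) p + e].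
Proof.
move=> e0; apply/nbhs_skew_productsP; exists e => // F' FF' i p.
have := FF' i 1%N r0 p; rewrite /deriv_n /= ltr_norml => /andP[? ?]; lra.
Qed.

Lemma near_act F w x (e : R) : 0 < e ->
  nbhs F [set F' | `|act (fibers F') w x - act (fibers F) w x| < e].
Proof.
have [L L1 HL] := fibers_lipschitz F.
have L0 : 0 < L by lra.
elim/last_ind: w e => [|w i IH] e e0.
  by apply/nbhs_skew_productsP; exists 1 => // F' _ /=; rewrite subrr normr0.
have e2 : 0 < e / 2 by rewrite divr_gt0.
have eL : 0 < e / 2 / L by rewrite divr_gt0.
have := nbhsI (IH _ eL) (near_fibers F e2).
apply: nbhsS => F' [/= H1 H2].
rewrite !act_rcons; set y' := act (fibers F') w x; set y := act (fibers F) w x.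
have h1 := H2 i y'.
have h2 : `|fibers F i y' - fibers F i y| <= L * `|y' - y|.
  exact: increment_dist (@fibers_homo F i) (HL i) _ _.
have h3 : L * `|y' - y| < e / 2 by rewrite mulrC -ltr_pdivlMr.
apply: le_lt_trans (ler_distD (fibers F i y') _ _) _; lra.
Qed.

Lemma near_act_gt F w x c : c < act (fibers F) w x ->
  nbhs F [set F' | c < act (fibers F') w x].
Proof.
rewrite -subr_gt0 => /(near_act F w x).
by apply: nbhsS => F' /=; rewrite ltr_norml => /andP[? ?]; lra.
Qed.

Lemma near_act_lt F w x c : act (fibers F) w x < c ->
  nbhs F [set F' | act (fibers F') w x < c].
Proof.
rewrite -subr_gt0 => /(near_act F w x).
by apply: nbhsS => F' /=; rewrite ltr_norml => /andP[? ?]; lra.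
Qed.

Definition trapped F (c d : R) : Prop :=
  c < d /\ forall i, c < fibers F i c /\ fibers F i d < d.

(** The letter [i] contracts [c1, d1] with rate [lam] and maps it into its own
    interior, where [w] also sends [c, d].  The inequalities on the maps are
    strict, and those on the slopes survive small perturbations with a slightly
    larger [lam]; this is why goodness is an open condition. *)
Definition contracting F (c d : R) (i : 'I_s) (c1 d1 lam : R) w : Prop :=
  [/\ 0 <= lam < 1,
      (forall p, c1 <= set_val p <= d1 -> deriv (real_of (F i)) p <= lam),
      c1 < fibers F i c1 /\ fibers F i d1 < d1
    & c1 < act (fibers F) w c /\ act (fibers F) w d < d1].

Definition good F (c d : R) : Prop :=
  trapped F c d /\ exists i c1 d1 lam w, contracting F c d i c1 d1 lam w.

Lemma near_trapped F c d : trapped F c d -> nbhs F [set F' | trapped F' c d].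
Proof.
move=> [cd H].
have N : nbhs F [set F' : TI | forall i, c < fibers F' i c /\ fibers F' i d < d].
  apply: (@filter_forall TI 'I_s (fun i F' => c < fibers F' i c /\ fibers F' i d < d) (nbhs F)).
  move=> i; have [h1 h2] := H i.
  exact: (nbhsI (@near_act_gt F [:: i] c c h1)
    (@near_act_lt F [:: i] d d h2)).
by apply: (nbhsS _ N) => F' H'; split.
Qed.

Lemma near_contracting F c d i c1 d1 lam lam' w : lam < lam' < 1 ->
  contracting F c d i c1 d1 lam w ->
  nbhs F [set F' | contracting F' c d i c1 d1 lam' w].
Proof.
move=> /andP[ll' l'1] [/andP[l0 l1] dl [h1 h2] [h3 h4]].
have e0 : 0 < lam' - lam by rewrite subr_gt0.
have := nbhsI (near_deriv F e0) (nbhsI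
  (nbhsI (@near_act_gt F [:: i] c1 c1 h1) (@near_act_lt F [:: i] d1 d1 h2))
  (nbhsI (near_act_gt h3) (near_act_lt h4))).
apply: nbhsS => F' [/= D [H12 H34]]; split => //; first lra.
by move=> p hp; have := D i p; have := dl p hp; lra.
Qed.

Lemma open_good c d : open [set F | good F c d].
Proof.
apply/open_skew_productsP => F [tr [i [c1 [d1 [lam [w ctr]]]]]].
have [/andP[l0 l1] _ _ _] := ctr.
have ll' : lam < (lam + 1) / 2 < 1 by lra.
have := nbhsI (near_trapped tr) (near_contracting ll' ctr).
apply: nbhsS => F' [/= H1 H2]; split => //.
by exists i, c1, d1, ((lam + 1) / 2), w.
Qed.

Definition good_around (x : R) : set TI :=
  [set F | exists c d, c < x < d /\ good F c d].

Lemma open_good_around x : open (good_around x).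
Proof.
apply/open_skew_productsP => F [c [d [cxd gcd]]].
have := open_nbhs_nbhs (conj (open_good c d) gcd).
by apply: nbhsS => F' g'; exists c, d.
Qed.

Definition good_hitting (c d u v : R) : set TI :=
  [set F | good F c d /\
    exists w, u < act (fibers F) w c /\ act (fibers F) w d < v].

Lemma open_good_hitting c d u v : open (good_hitting c d u v).
Proof.
apply/open_skew_productsP => F [gcd [w [h1 h2]]].
have := nbhsI (open_nbhs_nbhs (conj (open_good c d) gcd))
  (nbhsI (near_act_gt h1) (near_act_lt h2)).
by apply: nbhsS => F' [/= H1 H2]; split => //; exists w.
Qed.

Definition maps_inside : set TI := [set F | forall i, a < fibers F i a /\ fibers F i b < b].

Definition no_common_fixpoint : set TI :=
  [set F | ~ exists x, forall i, fibers F i x = x].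

Lemma open_maps_inside : open maps_inside.
Proof.
apply/open_skew_productsP => F H.
by have := near_trapped (conj hab H); apply: nbhsS => F' [].
Qed.

Lemma continuous_fibers F i : continuous (fibers F i).
Proof. exact: (continuous_clamp_comp (@continuous_real_of _ _ _ _ _ (F i))). Qed.

(** The sum of the displacements of a point is continuous, so it is bounded away
    from 0 on the compact segment. *)
Lemma open_no_common_fixpoint : open no_common_fixpoint.
Proof.
apply/open_skew_productsP => F H.
pose h x := \sum_i `|fibers F i x - x|.
have hc : {within `[a, b], continuous h}.
  apply: continuous_subspaceT => x; rewrite /h.
  apply: cvg_big => [|i _]; first exact: add_continuous.
  apply: cvg_norm.
  by apply: cvgB; [exact: continuous_fibers|exact: cvg_id].
have [x0 x0ab x0min] := EVT_min (ltW hab) hc.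
have h0 : 0 < h x0.
  rewrite lt_neqAle sumr_ge0// andbT eq_sym; apply/negP.
  rewrite psumr_eq0// => /allP H0; apply: H; exists x0 => i.
  by have /= := H0 i (mem_index_enum i); rewrite normr_eq0 subr_eq0 => /eqP.
pose e := h x0 / (s%:R + 1).
have e0 : 0 < e by rewrite divr_gt0// ltr_wpDl.
have := near_fibers F e0.
apply: nbhsS => F' /= H' [x xfix].
have s0 : (0 < s)%N.
  case: (posnP s) => // s0; exfalso; apply: H; exists x => i.
  by have := ltn_ord i; rewrite {2}s0.
have xab : x \in `[a, b].
  by rewrite in_itv -(xfix (Ordinal s0)); exact: fibers_itv.
have hx : h x <= s%:R * e.
  rewrite /h (le_trans (ler_sum _ (G := fun=> e) _))//.
    by move=> i _; have := H' i x; rewrite xfix distrC; exact: ltW.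
  by rewrite sumr_const card_ord mulr_natl.
have := x0min x xab.
have : s%:R * e < h x0.
  have s1 : 0 < s%:R + 1 :> R by rewrite ltr_wpDl.
  rewrite /e mulrCA gtr_pMr// ltr_pdivrMr// mul1r; lra.
lra.
Qed.

(** Rational parameters make the conditions countable.  Good intervals around
    rational points serve in [reach_good], words that send a good interval into a
    given one in [stable_orbit]. *)
Definition generic_condition
    (k : option (rat + (rat * rat) * (rat * rat))) : set TI :=
  match k with
  | None => maps_inside `&` no_common_fixpoint
  | Some (inl q) => settled (good_around (ratr q))
  | Some (inr (J, B)) =>
      settled (good_hitting (ratr J.1) (ratr J.2) (ratr B.1) (ratr B.2))
  end.

Definition generic : set TI := \bigcap_k generic_condition k.

End GoodIntervals.

(** * Generic skew products *)
Section FixedPointPerturbation.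
Context {r s : nat} {R : realType} {a b : R} {hab : a < b}.
Hypothesis r0 : (0 < r)%N.
Local Notation TI := (skew_products r s hab).
Implicit Types (F : TI) (w : seq 'I_s).

Lemma fibers_pull_all F t q i x : (forall i, 0 <= t i < 1) -> a <= q <= b ->
  fibers (pull_all t q F) i x = (1 - t i) * fibers F i x + t i * q.
Proof. by move=> ht hq; exact: ext_pull. Qed.

Lemma dense_maps_inside : dense (@maps_inside r s R a b hab).
Proof.
move=> U [F UF] oU.
have [d /andP[d0 d1] H] := nbhs_pull_all (open_nbhs_nbhs (conj oU UF)).
exists (pull_all (fun=> d / 2) ((a + b) / 2) F); split; first by apply: H => [i /=|]; have := hab; lra.
have hq : a <= (a + b) / 2 <= b by have := hab; lra.
have ht (i : 'I_s) : 0 <= d / 2 < 1 by lra.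
move=> i; rewrite !(fibers_pull_all _ _ _ ht hq) {ht H}.
have /andP[? ?] := fibers_itv F i a; have /andP[? ?] := fibers_itv F i b.
have := hab; split; nra.
Qed.

(** Let x and x' be fixed by the maps g and g', of the same letter at the points
    x and x', pulled towards [b] with parameters u and u'.  Since a pull moves
    points by at least c per unit of parameter, different parameters require
    different fixed points. *)
Lemma parameter_separation (u u' g g' x x' c L : R) : 0 <= u' <= 1 ->
  (1 - u) * g + u * b = x -> (1 - u') * g' + u' * b = x' ->
  0 <= c <= b - g -> `|g - g'| <= L * `|x - x'| ->
  `|u - u'| * c <= (1 + L) * `|x - x'|.
Proof.
move=> /andP[u0 u1] ux ux' /andP[c0 cg] gL.
apply: (@le_trans _ _ (`|u - u'| * (b - g))); first exact: ler_wpM2l.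
rewrite -[X in _ * X]ger0_norm ?(le_trans c0)// -normrM.
have -> : (u - u') * (b - g) = (x - x') - (1 - u') * (g - g') by rewrite -ux -ux'; ring.
apply: le_trans (ler_normB _ _) _; rewrite [X in _ <= X]mulrDl mul1r lerD2l.
rewrite normrM ger0_norm ?subr_ge0//; apply: le_trans gL.
by rewrite ler_piMl// lerBlDr lerDl.
Qed.

(** Two letters are pulled towards [b] with parameters in a grid of step d / N.
    If all these N^2 skew products had a common fixed point, then by
    [parameter_separation] these points would be at distance at least of order
    d / N from each other.  There is room for order of N of them only. *)
Lemma exists_no_common_fixpoint F U : (2 <= s)%N -> maps_inside F -> nbhs F U ->
  exists F', U F' /\ no_common_fixpoint F'.
Proof.
move=> s2 inF /nbhs_pull_all[d /andP[d0 d1] H]; apply: contrapT => NU.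
have [L L1 HL] := fibers_lipschitz r0 F.
pose i0 : 'I_s := Ordinal (ltnW s2); pose i1 : 'I_s := Ordinal s2.
pose c := Num.min (b - fibers F i0 b) (b - fibers F i1 b).
have c0 : 0 < c by rewrite lt_min !subr_gt0 (inF i0).2 (inF i1).2.
(* Two points in the same of K = N q buckets of [a, b] are so close that, by
   separation, their parameters are less than a step of the grid apart; the
   number q does not depend on N, which may then be taken larger than q. *)
pose q := (Num.truncn ((1 + L) * (b - a) / (d * c))).+1.
have q_gt : (1 + L) * (b - a) / (d * c) < q%:R.
  by rewrite /q truncnS_gt.
pose N := q.+2; pose K := (N * q)%N.
pose u (j : 'I_N) : R := d * j%:R / N%:R.
have N0 : 0 < N%:R :> R by rewrite ltr0n.
have u01 j : 0 <= u j < d.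
  rewrite /u divr_ge0 ?mulr_ge0 ?(ltW d0)//=.
  by rewrite -mulrA gtr_pMr// ltr_pdivrMr// mul1r ltr_nat.
pose t (jk : 'I_N * 'I_N) i : R :=
  if i == i0 then u jk.1 else if i == i1 then u jk.2 else 0.
have t0d jk i : 0 <= t jk i < d by rewrite /t; do 2?case: ifP => // _; rewrite lexx.
have t01 jk i : 0 <= t jk i < 1 by have := t0d jk i; lra.
have hb : a <= b <= b by rewrite lexx ltW.
have /choice[x Hx] : forall jk, exists x, forall i,
    (1 - t jk i) * fibers F i x + t jk i * b = x.
  move=> jk; apply: contrapT => Nx; apply: NU.
  exists (pull_all (t jk) b F); split; first exact: H.
  move=> [x Hx]; apply: Nx; exists x => i.
  by rewrite -[RHS](Hx i) fibers_pull_all.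
have xab jk : a <= x jk <= b.
  have := t01 jk i0; have := fibers_itv F i0 (x jk); rewrite -{3 4}(Hx jk i0).
  move=> /andP[? ?] /andP[? ?]; apply/andP; split; nra.
have ba0 : 0 < b - a by rewrite subr_gt0.
have K0 : 0 < K%:R :> R by rewrite ltr0n.
pose z jk := (x jk - a) / (b - a) * K%:R.
have z0 jk : 0 <= z jk.
  by rewrite mulr_ge0 ?ler0n// divr_ge0 ?(ltW ba0)// subr_ge0; case/andP: (xab jk).
have zK jk : (Num.truncn (z jk) < K.+1)%N.
  rewrite truncn_lt_nat// (@le_lt_trans _ _ K%:R) ?ltr_nat//.
  by rewrite ler_piMl ?ler0n// ler_pdivrMr// mul1r lerD2r; case/andP: (xab jk).
pose bucket jk : 'I_K.+1 := Ordinal (zK jk).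
(* there are N^2 points and only N q + 1 < N^2 buckets *)
have : ~ injective bucket.
  move=> /leq_card; rewrite card_prod !card_ord /K /N; clear; lia.
apply=> jk jk' /(congr1 val) /= zz.
have xx : `|x jk - x jk'| < (b - a) / K%:R.
  have -> : x jk - x jk' = (z jk - z jk') * ((b - a) / K%:R).
    rewrite /z; move: (K%:R) K0 => k k0; field.
    by rewrite !gt_eqF.
  rewrite normrM [`|_ / _|]gtr0_norm ?divr_gt0// gtr_pMl ?divr_gt0//.
  have := truncn_itv (z0 jk); have := truncn_itv (z0 jk'); rewrite -zz -addn1 natrD.
  by move=> /andP[? ?] /andP[? ?]; rewrite ltr_norml; lra.
have sep i (j j' : 'I_N) : (i = i0 \/ i = i1) -> t jk i = u j -> t jk' i = u j' -> j = j'.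
  move=> hi tj tj'; apply: contrapT => jj.
  have uu : d / N%:R <= `|u j - u j'|.
    have -> : u j - u j' = d / N%:R * (j%:R - j'%:R) by rewrite /u; ring.
    rewrite normrM gtr0_norm ?divr_gt0// ler_pMr ?divr_gt0//.
    have [lt|gt|/val_inj//] := ltngtP j j'.
      by rewrite distrC ger0_norm ?subr_ge0 ?ler_nat ?(ltnW lt)// lerBrDr nat1r ler_nat.
    by rewrite ger0_norm ?subr_ge0 ?ler_nat ?(ltnW gt)// lerBrDr nat1r ler_nat.
  have gL : `|fibers F i (x jk) - fibers F i (x jk')| <= L * `|x jk - x jk'|.
    exact: increment_dist (@fibers_homo _ _ _ _ _ _ F i) (HL i) _ _.
  have cg : 0 <= c <= b - fibers F i (x jk).
    rewrite (ltW c0)/=; have : fibers F i (x jk) <= fibers F i b.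
      by apply: fibers_homo; case/andP: (xab jk).
    have : c <= b - fibers F i b.
      by case: hi => ->; rewrite ge_min lexx ?orbT.
    lra.
  have t'1 : 0 <= t jk' i <= 1 by have := t01 jk' i; lra.
  have := parameter_separation t'1 (Hx jk i) (Hx jk' i) cg gL.
  rewrite tj tj' => h.
  have : d / N%:R * c < (1 + L) * ((b - a) / K%:R).
    apply: (@le_lt_trans _ _ (`|u j - u j'| * c)); first by rewrite ler_wpM2r// ltW.
    by apply: le_lt_trans h _; rewrite ltr_pM2l//; lra.
  have -> : (1 + L) * ((b - a) / K%:R) = (1 + L) * (b - a) / (d * c) / q%:R * (d / N%:R * c).
    have q0 : 0 < q%:R :> R by rewrite ltr0n.
    rewrite /K natrM; move: (N%:R) N0 (q%:R) q0 => n n0 q' q'0; field.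
    by rewrite !gt_eqF.
  rewrite -[X in X < _]mul1r ltr_pM2r ?mulr_gt0 ?divr_gt0 ?invr_gt0//.
  by rewrite ltr_pdivlMr ?ltr0n// mul1r ltNge ltW.
have e1 : jk.1 = jk'.1 by apply: (sep i0); [left|rewrite /t eqxx..].
have i10 : (i1 == i0) = false by [].
have e2 : jk.2 = jk'.2 by apply: (sep i1); [right|rewrite /t i10 eqxx..].
by rewrite [jk]surjective_pairing [jk']surjective_pairing e1 e2.
Qed.

Lemma dense_maps_inside_no_common_fixpoint : (2 <= s)%N ->
  dense (@maps_inside r s R a b hab `&` no_common_fixpoint).
Proof.
move=> s2 U [F UF] oU.
have [F1 [UF1 inF1]] := dense_maps_inside (ex_intro _ F UF) oU.
have N1 := nbhsI (open_nbhs_nbhs (conj oU UF1)) (open_nbhs_nbhs (conj (open_maps_inside r0) inF1)).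
have [F' [[UF' inF'] ncF']] := exists_no_common_fixpoint s2 inF1 N1.
by exists F'.
Qed.

Lemma residual_generic : (2 <= s)%N -> residual (@generic r s R a b hab).
Proof.
move=> s2; apply: residual_bigcap => -[[q|[J B]]|] /=.
- by split; [apply: open_settled|apply: dense_settled]; exact: open_good_around.
- by split; [apply: open_settled|apply: dense_settled]; exact: open_good_hitting.
- split; last exact: dense_maps_inside_no_common_fixpoint.
  by apply: openI; [exact: open_maps_inside|exact: open_no_common_fixpoint].
Qed.

End FixedPointPerturbation.

(** * Good intervals are reached from everywhere *)
Section MinimalIntervals.
Context {r s : nat} {R : realType} {a b : R} {hab : a < b}.
Hypothesis r0 : (0 < r)%N.
Local Notation TI := (skew_products r s hab).
Local Notation clampI := (@clamp R a b hab).
Implicit Types (F : TI) (w : seq 'I_s).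

Lemma trapped_act F c d w x : trapped F c d -> c < x < d ->
  c < act (fibers F) w x < d.
Proof.
move=> [_ tr]; elim: w x => //= i w IH x /andP[cx xd]; apply: IH.
have := fibers_homo F i (ltW cx); have := fibers_homo F i (ltW xd).
have := tr i; lra.
Qed.

Lemma continuous_act_fibers F w : continuous (act (fibers F) w).
Proof.
elim/last_ind: w => [|w i IH]; first by move=> x; exact: cvg_id.
rewrite (_ : act _ _ = fibers F i \o act (fibers F) w); last first.
  by apply/funext => x /=; rewrite act_rcons.
by move=> x; apply: continuous_comp; [exact: IH|exact: continuous_fibers].
Qed.

(** The last two hypotheses are what minimality gives for the interval [m, X] in
    the proof of [reach_good]. *)
Section Interval.
Variables (F : TI) (m X : R).
Hypotheses (am : a <= m) (mX : m < X) (Xb : X <= b).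
Hypothesis gm : forall i, m <= fibers F i m.
Hypothesis gX : forall i, fibers F i X <= X.
Hypothesis shrinks : forall del, 0 < del <= X - m ->
  exists i, fibers F i (m + del) < m + del.
Hypothesis reaches : forall del, 0 < del ->
  exists w, act (fibers F) w X < m + del.

(** One letter has to serve for arbitrarily small [del], since the alphabet is
    finite. *)
Lemma exists_attracting_letter : exists i, forall del, 0 < del <= X - m ->
  exists2 del', 0 < del' <= del & fibers F i (m + del') < m + del'.
Proof.
apply: contrapT => N.
have /choice[e He] : forall i, exists e, 0 < e <= X - m /\
    forall del', 0 < del' <= e -> m + del' <= fibers F i (m + del').
  move=> i; apply: contrapT => Ni; apply: N; exists i => del hdel.
  apply: contrapT => Nd; apply: Ni; exists del; split => // del' h'.
  by rewrite leNgt; apply/negP => lt; apply: Nd; exists del'.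
pose del := \big[Num.min/X - m]_i e i.
have del0 : 0 < del.
  by apply: lt_bigmin => [|i _]; [rewrite subr_gt0|case: (He i) => /andP[]].
have delX : del <= X - m by exact: bigmin_le_id.
have [|i] := @shrinks del; first by rewrite del0.
apply/negP; rewrite -leNgt; apply: (He i).2; rewrite del0 /=.
exact: bigmin_le.
Qed.

Section AttractingLetter.
Variable i : 'I_s.
Hypothesis attr : forall del, 0 < del <= X - m ->
  exists2 del', 0 < del' <= del & fibers F i (m + del') < m + del'.

Lemma attracting_letter_fixes : fibers F i m = m.
Proof.
apply/eqP; rewrite eq_le gm andbT leNgt; apply/negP => mlt.
have [|del /andP[d0 dle]] := @attr (Num.min (X - m) (fibers F i m - m)).
  by rewrite lt_min !subr_gt0 mX mlt ge_min lexx.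
apply/negP; rewrite -leNgt.
have : fibers F i m <= fibers F i (m + del) by apply: fibers_homo; rewrite lerDl ltW.
move: dle; rewrite le_min => /andP[_ ?]; lra.
Qed.

Lemma attracting_letter_deriv : deriv (real_of (F i)) (clampI m) <= 1.
Proof.
rewrite leNgt; apply/negP => lt1; set l := deriv _ _ in lt1.
have mE : set_val (clampI m) = m by apply: val_clampE; rewrite am /= (le_trans (ltW mX)).
have hd : has_deriv (real_of (F i)) := (Diff_smooth (F i)).1 0%N r0.
have l1 : 0 < l - 1 by rewrite subr_gt0.
have /cvgrPdist_lt/(_ _ l1)/dnbhs_set_typeP[d d0 H] := hd (clampI m).
have [|del /andP[del0 dle] lt] := @attr (Num.min (X - m) (d / 2)).
  by rewrite lt_min subr_gt0 mX divr_gt0// ge_min lexx.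
move: dle; rewrite le_min => /andP[delX deld].
have yE : set_val (clampI (m + del)) = m + del.
  by apply: val_clampE; have := am; have := Xb; lra.
have ne : clampI (m + del) != clampI m.
  by apply/eqP => /(congr1 set_val); rewrite mE yE; lra.
have near : `|set_val (clampI m) - set_val (clampI (m + del))| < d.
  by rewrite mE yE opprD addrA subrr sub0r normrN gtr0_norm//; lra.
have : `|l - diff_quotient (real_of (F i)) (clampI m) (clampI (m + del))| < l - 1.
  exact: H ne near.
rewrite /diff_quotient mE yE.
have -> : real_of (F i) (clampI m) = m.
  by rewrite -[RHS]attracting_letter_fixes.
have -> : real_of (F i) (clampI (m + del)) = fibers F i (m + del) by [].
move=> h; have : (fibers F i (m + del) - m) / (m + del - m) < 1.
  by rewrite addrAC subrr add0r ltr_pdivrMr// mul1r ltrBlDl.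
move: h; rewrite ltr_norml => /andP[? ?]; lra.
Qed.

End AttractingLetter.

(** A pull towards m + u has its target so low that it raises images of X at most
    in proportion to u, whatever the strength t of the pull.  The strength may
    therefore be fixed first, and u be chosen small with respect to it. *)
Lemma act_pull_le w : exists2 K : R, 0 <= K & forall t u, 0 <= t < 1 -> 0 <= u ->
  m + u <= b ->
  m <= act (fibers (pull_all (fun=> t) (m + u) F)) w X <=
  act (fibers F) w X + K * u.
Proof.
have [L L1 HL] := fibers_lipschitz r0 F.
elim/last_ind: w => [|w i [K K0 IH]].
  by exists 0 => // t u _ _ _; rewrite mul0r addr0 /= lexx ltW.
exists (L * K + 1) => [|t u ht u0 ub]; first by rewrite addr_ge0 ?mulr_ge0; lra.
have /andP[my yK] := IH t u ht u0 ub.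
rewrite !act_rcons fibers_pull_all //; last by have := am; lra.
set y' := act _ w X in my yK *; set y := act _ w X in yK *.
have Gm : m <= fibers F i y' by apply: le_trans (gm i) _; exact: fibers_homo.
have Gle : fibers F i y' <= fibers F i y + L * (K * u).
  apply: (@le_trans _ _ (fibers F i (y + K * u))); first exact: fibers_homo.
  have : y <= y + K * u by rewrite lerDl mulr_ge0.
  by move=> /(HL i); rewrite addrAC subrr add0r lerBlDl.
move: ht => /andP[t0 t1].
apply/andP; split; first by nra.
rewrite mulrDl mul1r mulrA in Gle *.
have : t * (m - fibers F i y') <= 0 by rewrite mulr_ge0_le0// subr_le0.
have : t * u <= u by rewrite ler_piMl// ltW.
nra.
Qed.

(** Pulling by t towards m + u lifts m strictly and multiplies slopes by 1 - t.
    The slope of the attracting letter at m is at most 1, hence below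
    1 + t near m, and (1 - t)(1 + t) < 1 makes that letter a contraction of
    some [m, m + del]. *)
Lemma perturb_to_good x U : m < x < X -> nbhs F U -> exists F', U F' /\ good_around x F'.
Proof.
move=> mxX /nbhs_pull_all[d /andP[d0 d1] H].
have [i attr] := exists_attracting_letter.
have fixm := attracting_letter_fixes attr.
have der := attracting_letter_deriv attr.
pose t := d / 2.
have t0 : 0 < t by rewrite divr_gt0.
have t1 : t < 1 by rewrite /t; lra.
have cd : continuous (deriv (real_of (F i))).
  exact: (@smooth_deriv_n_continuous _ _ _ r 1 (Diff_smooth (F i)) r0).
have [e e0 He] := (continuous_set_typeP _).1 cd (clampI m) t t0.
have mE : set_val (clampI m) = m by apply: val_clampE; rewrite am /= (le_trans (ltW mX)).
pose del := Num.min (e / 2) (X - m).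
have del0 : 0 < del by rewrite lt_min divr_gt0//= subr_gt0.
have dele : del < e by rewrite gt_min; apply/orP; left; lra.
have delX : del <= X - m by rewrite ge_min lexx orbT.
have dle p : m <= set_val p <= m + del -> deriv (real_of (F i)) p <= 1 + t.
  move=> hp; have near : `|set_val (clampI m) - set_val p| < e.
    by rewrite mE distrC ger0_norm; lra.
  by have := He p near; rewrite ltr_norml => /andP[? ?]; lra.
have [w Hw] := reaches del0.
have [K K0 HK] := act_pull_le w.
(* the three bounds keep m + u below X, make the contracting letter map
   m + del below itself, and keep the image of X under w below m + del *)
pose u := Num.min (Num.min ((X - m) / 2) (t * del / 2)) ((m + del - act (fibers F) w X) / (K + 1)).
have u0 : 0 < u.
  rewrite !lt_min !divr_gt0 ?mulr_gt0 ?subr_gt0//; lra.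
have uX : u < X - m by rewrite /u !gt_min; apply/orP; left; apply/orP; left; lra.
have ut : u < t * del.
  rewrite /u !gt_min; apply/orP; left; apply/orP; right.
  by rewrite ltr_pdivrMr// ltr_pMr ?mulr_gt0//; lra.
have uK : K * u < m + del - act (fibers F) w X.
  have : u <= (m + del - act (fibers F) w X) / (K + 1) by rewrite ge_min lexx orbT.
  by rewrite ler_pdivlMr; [nra|lra].
have ht : 0 <= t < 1 by rewrite ltW.
have hq : a <= m + u <= b by have := am; have := Xb; lra.
pose F' := pull_all (fun=> t) (m + u) F.
have E j y : fibers F' j y = (1 - t) * fibers F j y + t * (m + u).
  exact: (fibers_pull_all _ _ _ (fun=> ht) hq).
have tu0 : 0 < t * u by rewrite mulr_gt0.
have lowF' j y : m <= y -> m < fibers F' j y.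
  move=> my; rewrite E; have : m <= fibers F j y.
    by apply: le_trans (gm j) _; exact: fibers_homo.
  nra.
exists F'; split.
  by apply: H => // j; rewrite ltW//= /t; lra.
exists m, X; split => //; split.
  split => // j; split; first exact: lowF'.
  rewrite E; have := gX j; nra.
exists i, m, (m + del), ((1 - t) * (1 + t)), w; split.
- by apply/andP; split; nra.
- move=> p hp; rewrite deriv_pull//.
  by apply: ler_wpM2l; [lra|exact: dle].
- split; first exact: lowF'.
  have t1' : 0 <= 1 + t by lra.
  have := @ext_increment _ _ _ _ _ (F i) m (m + del) (1 + t) r0 t1' dle m (m + del).
  rewrite lexx lerDl (ltW del0) lexx => /(_ isT isT isT).
  rewrite -/(fibers F i m) -/(fibers F i (m + del)) fixm E => h.
  nra.
have low v : m <= act (fibers F') v m.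
  by elim/last_ind: v => [//|v j IH]; rewrite act_rcons ltW// lowF'.
split.
  have [v [j ->]] : exists v j, w = rcons v j.
    by case/lastP: w Hw {HK u ut uK u0 uX hq F' E tu0 lowF' low} => [/=|v j _]; [lra|exists v, j].
  by rewrite act_rcons; exact: lowF'.
have /andP[_ h] := HK t u ht (ltW u0) (proj2 (andP hq)).
by apply: le_lt_trans h _; lra.
Qed.

End Interval.

Lemma reach_good F x : generic F -> a <= x <= b ->
  exists w c d, good F c d /\ c < act (fibers F) w x < d.
Proof.
move=> gF xab; apply: contrapT => Nx.
have [_ ncF] := gF None Logic.I.
(* the points of the segment that reach no good interval *)
pose Z : set R := `[a, b] `&` [set y | forall w c d, good F c d ->
  ~ c < act (fibers F) w y < d].
have Zx : Z x.
  split; first by rewrite /= in_itv.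
  by move=> w c d gcd h; apply: Nx; exists w, c, d.
have Zinv i y : Z y -> Z (fibers F i y).
  move=> [_ Zy]; split; first by rewrite /= in_itv; exact: fibers_itv.
  by move=> w c d gcd; exact: (Zy (i :: w)).
have closed_act (A : set R) w : closed A -> closed [set y | A (act (fibers F) w y)].
  by move=> cA; have /continuous_closedP/(_ A cA) := @continuous_act_fibers F w.
have cZ : closed Z.
  apply: closedI; first exact: itv_closed.
  rewrite (_ : mkset _ = \bigcap_(wcd in [set wcd : seq 'I_s * (R * R) | good F wcd.2.1 wcd.2.2])
      [set y | (~` `]wcd.2.1, wcd.2.2[%classic) (act (fibers F) wcd.1 y)]).
    apply: closed_bigI => -[w [c d]] _ /=; apply: (closed_act (~` `]c, d[%classic) w).
    exact/open_closedC/itv_open.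
  apply/seteqP; split => y /=.
    by move=> Hy [w [c d]] /= gcd; rewrite in_itv /=; exact: Hy.
  by move=> Hy w c d gcd; have := Hy (w, (c, d)) gcd; rewrite /= in_itv.
have Zab y : Z y -> a <= y <= b by case; rewrite /= in_itv.
have compactZ Y : closed Y -> Y `<=` Z -> compact Y.
  move=> cY YZ; apply: (subclosed_compact cY (@segment_compact _ a b)).
  by move=> y /YZ[].
have minZ Y : closed Y -> Y `<=` Z -> Y !=set0 -> exists2 y, Y y & forall z, Y z -> y <= z.
  move=> cY YZ Y0.
  have [|y /set_mem Yy ymin] := @compact_EVT_min R R id Y Y0 (compactZ Y cY YZ).
    by apply: continuous_subspaceT => z; exact: cvg_id.
  by exists y => // z Yz; apply: ymin; exact: mem_set.
have maxZ Y : closed Y -> Y `<=` Z -> Y !=set0 -> exists2 y, Y y & forall z, Y z -> z <= y.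
  move=> cY YZ Y0.
  have [|y /set_mem Yy ymin] := @compact_EVT_max R R id Y Y0 (compactZ Y cY YZ).
    by apply: continuous_subspaceT => z; exact: cvg_id.
  by exists y => // z Yz; apply: ymin; exact: mem_set.
(* intervals with ends in Z which all letters map into themselves *)
pose S : set (R * R) := [set p | [/\ Z p.1, Z p.2, p.1 <= p.2,
  forall i, p.1 <= fibers F i p.1 & forall i, fibers F i p.2 <= p.2]].
have S0 : S !=set0.
  have Z0 : Z !=set0 by exists x.
  have [u Zu umin] := minZ Z cZ (fun=> id) Z0.
  have [v Zv vmax] := maxZ Z cZ (fun=> id) Z0.
  exists (u, v); split => //=; first exact: umin.
    by move=> i; apply: umin; exact: Zinv.
  by move=> i; apply: vmax; exact: Zinv.
have cle (f g : R * R -> R) : continuous f -> continuous g ->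
    closed [set p | f p <= g p].
  move=> cf cg; rewrite (_ : mkset _ = (fun p => g p - f p) @^-1` [set z | 0 <= z]).
    have c : continuous (fun p => g p - f p) by move=> p; apply: cvgB; [exact: cg|exact: cf].
    by move/continuous_closedP: c; apply; exact: closed_ge.
  by apply/seteqP; split => p /=; rewrite subr_ge0.
have cfst : continuous (fst : R * R -> R) by move=> p; exact: cvg_fst.
have csnd : continuous (snd : R * R -> R) by move=> p; exact: cvg_snd.
have compactS : compact S.
  apply: (subclosed_compact _ (compact_setX (@segment_compact _ a b) (@segment_compact _ a b))).
    rewrite (_ : S = (fst @^-1` Z `&` snd @^-1` Z) `&` ([set p | p.1 <= p.2] `&`
      (\bigcap_i [set p | p.1 <= fibers F i p.1] `&` \bigcap_i [set p | fibers F i p.2 <= p.2]))).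
      apply: closedI; first apply: closedI.
      - by move/continuous_closedP: cfst; apply.
      - by move/continuous_closedP: csnd; apply.
      apply: closedI; first exact: cle.
      apply: closedI; apply: closed_bigI => i _; apply: cle => // p; apply: continuous_comp;
        by [exact: cfst|exact: csnd|exact: continuous_fibers].
    apply/seteqP; split => [[u v] [/= ? ? ? h1 h2]|[u v] [[/= ? ?] [/= ? [h1 h2]]]].
      by split => //; split => //; split => i _ /=; [exact: h1|exact: h2].
    by split => // i; [exact: (h1 i Logic.I)|exact: (h2 i Logic.I)].
  by move=> [u v] [/= [uab _] [vab _] _ _ _].
have [|[m X] /set_mem [/= Zm ZX mX gm gX] minS] := @compact_EVT_min _ R (fun p : R * R => p.2 - p.1) S S0 compactS.
  by apply: continuous_subspaceT => p; apply: cvgB; [exact: csnd|exact: cfst].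
(* The minimum of such a Y would, with X, bound a shorter interval in S.  It is
   used with Y the part of Z above m + del when no letter brings m + del down,
   and with Y the points that stay above m + del under all words when X does. *)
have noY Y : closed Y -> Y `<=` Z -> Y X -> ~ Y m -> (forall y, Y y -> m <= y <= X) ->
    (forall i y, Y y -> Y (fibers F i y)) -> False.
  move=> cY YZ YX NYm YmX Yinv.
  have [y Yy ymin] := minZ Y cY YZ (ex_intro _ X YX).
  have /andP[my yX] := YmX y Yy.
  have /minS : (y, X) \in S.
    apply: mem_set; split => //=; [exact: YZ|by move=> i; apply: ymin; exact: Yinv].
  move=> /= h; apply: NYm; have -> // : m = y.
  by apply/eqP; rewrite eq_le my /=; lra.
have ltmX : m < X.
  rewrite lt_neqAle mX andbT; apply/eqP => E; apply: ncF; exists m => i.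
  by apply/eqP; rewrite eq_le gm E gX.
have /andP[am mb] := Zab m Zm; have /andP[aX Xb] := Zab X ZX.
have shrinks del : 0 < del <= X - m -> exists i, fibers F i (m + del) < m + del.
  move=> /andP[d0 dX]; apply: contrapT => N.
  have N' i : m + del <= fibers F i (m + del).
    by rewrite leNgt; apply/negP => lt; apply: N; exists i.
  apply: (noY (Z `&` `[m + del, X])).
  - by apply: closedI => //; exact: itv_closed.
  - by move=> y [].
  - by split => //; rewrite /= in_itv /= lexx andbT; lra.
  - by move=> [_]; rewrite /= in_itv /=; lra.
  - by move=> y [_]; rewrite /= in_itv /=; lra.
  - move=> i y [Zy]; rewrite /= in_itv /= => /andP[h1 h2]; split; first exact: Zinv.
    rewrite /= in_itv /=; apply/andP; split.
      by apply: le_trans (N' i) _; exact: fibers_homo.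
    by apply: le_trans (gX i); exact: fibers_homo.
have reaches del : 0 < del -> exists w, act (fibers F) w X < m + del.
  move=> d0; apply: contrapT => N.
  have N' w : m + del <= act (fibers F) w X.
    by rewrite leNgt; apply/negP => lt; apply: N; exists w.
  apply: (noY (Z `&` ([set y | forall w, m + del <= act (fibers F) w y] `&` [set y | y <= X]))).
  - apply: closedI => //; apply: closedI; last exact: closed_le.
    rewrite (_ : mkset _ = \bigcap_w [set y | [set z | m + del <= z] (act (fibers F) w y)]).
      by apply: closed_bigI => w _; apply: (closed_act [set z | m + del <= z] w); exact: closed_ge.
    by apply/seteqP; split => y /= Hy w; [move=> _; exact: Hy|exact: (Hy w)].
  - by move=> y [].
  - by split => //; split => //=.
  - by move=> [_ [/= /(_ [::]) /= h _]]; move: h; lra.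
  - by move=> y [_ [/= /(_ [::]) /= h1 h2]]; lra.
  - move=> i y [Zy [/= h1 h2]]; split; first exact: Zinv.
    split => /= [w|]; first exact: (h1 (i :: w)).
    by apply: le_trans (gX i); exact: fibers_homo.
(* Perturbations of F have good intervals around q, so F itself has one.  Its
   lower end is not m, fixed by a letter that should move it up; if it is below
   m it contains m, otherwise a word brings q, which lies below X, too low. *)
have [q] := rat_in_itvoo ltmX; rewrite in_itv /= => mqX.
case: (gF (Some (inl q)) Logic.I) => [[c [d [cqd gcd]]]|]; last first.
  by move=> /(perturb_to_good am ltmX Xb gm gX shrinks reaches mqX)[F' []].
have [tr _] := gcd; have [_ trH] := tr.
have [i attr] := exists_attracting_letter ltmX shrinks.
have fixm := attracting_letter_fixes ltmX gm attr.
have [cm|mc] := ltP c m.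
  have [_ /(_ [::] c d gcd)] := Zm; apply => /=; rewrite cm /=.
  by case/andP: cqd => _; case/andP: mqX => mq _; exact: lt_trans.
have [E|ne] := eqVneq c m; first by have := (trH i).1; rewrite E fixm ltxx.
have [|w Hw] := reaches (c - m); first by rewrite subr_gt0 lt_neqAle eq_sym ne.
have /andP[h _] := trapped_act w tr cqd.
have : act (fibers F) w (ratr q) <= act (fibers F) w X.
  by apply: act_fibers_homo; case/andP: mqX => _ /ltW.
by move: h Hw; lra.
Qed.

End MinimalIntervals.

(** * Orbits of the attracting fixed point are stable *)
Section Crossing.
Context {R : realType} {s : nat}.
Implicit Types (w v : seq 'I_s).

Lemma exists_expr_lt (lam e C : R) : 0 <= lam < 1 -> 0 < e -> 0 <= C ->
  exists k, (0 < k)%N /\ C * lam ^+ k < e.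
Proof.
move=> /andP[l0 l1] e0 C0.
have h : `|lam| < 1 by rewrite ger0_norm.
have eC : 0 < e / (C + 1) by rewrite divr_gt0//; lra.
have /cvgrPdist_lt/(_ _ eC)[N _ HN] := cvg_expr h.
exists N.+1; split => //; have := HN N.+1 (leqnSn N).
rewrite /= sub0r normrN ger0_norm ?exprn_ge0// ltr_pdivlMr; last by lra.
by have : 0 <= lam ^+ N.+1 := exprn_ge0 _ l0; nra.
Qed.

(** The common features of the pulls towards [b], and of the pulls towards [a] seen
    through the reflection of the line: every map is raised by at least c0 per
    unit of the parameter t. *)
Record raising (G : R -> 'I_s -> R -> R) (t0 c0 L : R) : Prop := Raising {
  raising_homo : forall t i, 0 <= t <= t0 -> {homo G t i : x y / x <= y};
  raising_lipschitz : forall t i x y, 0 <= t <= t0 -> x <= y ->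
    G t i y - G t i x <= L * (y - x);
  raising_continuous : forall i (h : R -> R), continuous h ->
    continuous (fun t => G t i (h t));
  raising_gt : forall t i x, 0 <= t <= t0 -> G 0 i x + t * c0 <= G t i x
}.

Section Raise.
Variables (G : R -> 'I_s -> R -> R) (t0 c0 L : R).
Hypotheses (t00 : 0 < t0) (c00 : 0 < c0) (L0 : 0 <= L) (GR : raising G t0 c0 L).

Lemma raising_act_continuous w (h : R -> R) : continuous h ->
  continuous (fun t => act (G t) w (h t)).
Proof.
elim: w h => //= i w IH h ch; apply: (IH (fun t => G t i (h t))).
exact: (raising_continuous GR).
Qed.

Lemma raising_act_homo t w : 0 <= t <= t0 -> {homo act (G t) w : x y / x <= y}.
Proof. by move=> ht; apply: act_homo => i; exact: (raising_homo GR). Qed.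

Lemma raising_act_ge t w x : 0 <= t <= t0 -> act (G 0) w x <= act (G t) w x.
Proof.
move=> ht; have h0 : 0 <= (0 : R) <= t0 by apply/andP; split; [exact: lexx|exact: ltW].
elim/last_ind: w => [//|w i IH]; rewrite !act_rcons.
apply: le_trans (raising_gt GR i _ ht); rewrite -[leLHS]addr0 lerD//; last first.
  by rewrite mulr_ge0 ?(ltW c00)//; case/andP: ht.
exact: (raising_homo GR).
Qed.

Lemma raising_act_gt t w x : 0 <= t <= t0 -> (0 < size w)%N ->
  act (G 0) w x + t * c0 <= act (G t) w x.
Proof.
move=> ht; have h0 : 0 <= (0 : R) <= t0 by apply/andP; split; [exact: lexx|exact: ltW].
case/lastP: w => [//|w i _]; rewrite !act_rcons.
apply: le_trans (raising_gt GR i _ ht); rewrite lerD2r.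
apply: (raising_homo GR) => //; exact: raising_act_ge.
Qed.

Lemma raising_act_dist t w x y : 0 <= t <= t0 ->
  `|act (G t) w x - act (G t) w y| <= L ^+ size w * `|x - y|.
Proof.
move=> ht; apply: increment_dist; first exact: raising_act_homo.
apply: act_lipschitz => // i; first exact: (raising_homo GR).
by move=> *; exact: (raising_lipschitz GR).
Qed.

(** Suppose that x is slightly above the image of p under v, and that w sends x
    into B = (b1, b2).  The words wk k, which collapse [c, d] to p, followed by
    v, send [c, d] below x at t = 0 and above x at t = t0.  As w sends
    the former image below and the latter above the w-image of x, an
    intermediate t sends [c, d] into B. *)
Lemma raising_crossing (c d C lam p : R) (wk : nat -> seq 'I_s) v w x (b1 b2 : R) :
  0 <= lam < 1 -> 0 <= C ->
  (forall k, (0 < k)%N -> (0 < size (wk k))%N) ->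
  (forall t k, 0 <= t <= t0 -> `|act (G t) (wk k) c - act (G t) (wk k) d| <= C * lam ^+ k) ->
  (forall k, `|act (G 0) (wk k) c - p| <= C * lam ^+ k) ->
  act (G 0) v p < x < act (G 0) v p + t0 * c0 ->
  b1 < act (G 0) w x < b2 ->
  exists t u, [/\ 0 <= t <= t0, b1 < act (G t) u c < b2 & b1 < act (G t) u d < b2].
Proof.
move=> hlam C0 wk0 Hcd Hp; set y := act (G 0) v p => /andP[yx xy] /andP[bz zb].
have h0 : 0 <= (0 : R) <= t0 by apply/andP; split; [exact: lexx|exact: ltW].
have ht0 : 0 <= t0 <= t0 by apply/andP; split; [exact: ltW|exact: lexx].
set z := act (G 0) w x in bz zb.
(* the room around x and around its w-image *)
pose e := Num.min (Num.min (x - y) (y + t0 * c0 - x)) (Num.min (z - b1) (b2 - z)).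
have e0 : 0 < e by rewrite !lt_min !subr_gt0 yx xy bz zb.
pose C' := (L ^+ size v + L ^+ size (v ++ w)) * C.
have C'0 : 0 <= C' by rewrite mulr_ge0// addr_ge0// exprn_ge0.
have [k [k0 Hk]] := exists_expr_lt hlam e0 C'0.
have lk0 : 0 <= C * lam ^+ k by case/andP: hlam => ? _; rewrite mulr_ge0// exprn_ge0.
have [Hkv Hkvw] : L ^+ size v * (C * lam ^+ k) < e /\
    L ^+ size (v ++ w) * (C * lam ^+ k) < e.
  move: Hk; rewrite /C' -mulrA mulrDl.
  have : 0 <= L ^+ size v * (C * lam ^+ k) by rewrite mulr_ge0// exprn_ge0.
  have : 0 <= L ^+ size (v ++ w) * (C * lam ^+ k) by rewrite mulr_ge0// exprn_ge0.
  by split; lra.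
pose q t := act (G t) (wk k ++ v) c.
have qy : `|q 0 - y| < e.
  apply: le_lt_trans Hkv; rewrite /q act_cat.
  by apply: le_trans (raising_act_dist _ _ _ h0) _; rewrite ler_wpM2l ?exprn_ge0.
have qx : q 0 <= x.
  have : e <= x - y by rewrite /e !ge_min lexx.
  by move: qy; rewrite ltr_norml => /andP[? ?]; lra.
have qx' : x <= q t0.
  have : q 0 + t0 * c0 <= q t0.
    by apply: raising_act_gt; rewrite ?size_cat ?(ltn_addr _ (wk0 k k0)).
  have : e <= y + t0 * c0 - x by rewrite /e !ge_min lexx orbT.
  by move: qy; rewrite ltr_norml => /andP[? ?]; lra.
pose phi t := act (G t) w (q t).
have cphi : continuous phi.
  apply: raising_act_continuous; apply: (raising_act_continuous _ (h := fun=> c)).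
  by move=> t; exact: cvg_cst.
have phi0 : phi 0 <= z by exact: raising_act_homo.
have phi1 : z <= phi t0.
  by apply: (@le_trans _ _ (act (G t0) w x)); [exact: raising_act_ge|exact: raising_act_homo].
have [|t] := IVT (ltW t00) (continuous_subspaceT cphi) (v := z).
  by rewrite ge_min phi0 le_max phi1 orbT.
rewrite in_itv /= => ht phit; exists t, (wk k ++ v ++ w); split => //.
  by rewrite catA act_cat -/(q t) -/(phi t) phit bz zb.
have E : act (G t) (wk k ++ v ++ w) c = z by rewrite catA act_cat -/(q t) -/(phi t).
have : `|act (G t) (wk k ++ v ++ w) c - act (G t) (wk k ++ v ++ w) d| < e.
  apply: le_lt_trans Hkvw; rewrite act_cat [X in `|_ - X|]act_cat.
  by apply: le_trans (raising_act_dist _ _ _ ht) _; rewrite ler_wpM2l ?exprn_ge0// Hcd.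
have : e <= z - b1 by rewrite /e !ge_min lexx !orbT.
have : e <= b2 - z by rewrite /e !ge_min lexx !orbT.
by rewrite E ltr_norml => ? ? /andP[? ?]; lra.
Qed.

End Raise.

Lemma act_opp (g : 'I_s -> R -> R) w x :
  act (fun i y => - g i (- y)) w x = - act g w (- x).
Proof. by elim: w x => /= [|i w IH] x; rewrite ?opprK// IH opprK. Qed.

End Crossing.

Section Stability.
Context {r s : nat} {R : realType} {a b : R} {hab : a < b}.
Hypothesis r0 : (0 < r)%N.
Local Notation TI := (skew_products r s hab).
Implicit Types (F : TI) (w v : seq 'I_s).

(** The words w0 i^k collapse [c, d] to the fixed point of i at a geometric
    rate. *)
Section Contracting.
Variables (F : TI) (c d : R) (i : 'I_s) (c1 d1 lam : R) (w0 : seq 'I_s).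
Hypothesis (cd : c <= d) (ctr : contracting F c d i c1 d1 lam w0).

Lemma contracting_step x y : c1 <= x -> x <= y -> y <= d1 ->
  fibers F i y - fibers F i x <= lam * (y - x).
Proof.
case: ctr => /andP[l0 _] dl _ _.
exact: (ext_increment (f := F i) r0 l0 dl).
Qed.

Lemma contracting_iter k x y : c1 <= x -> x <= y -> y <= d1 ->
  [/\ c1 <= act (fibers F) (nseq k i) x, act (fibers F) (nseq k i) y <= d1 &
   act (fibers F) (nseq k i) y - act (fibers F) (nseq k i) x <= lam ^+ k * (y - x)].
Proof.
case: ctr => /andP[l0 _] _ [h1 h2] _.
elim: k x y => [|k IH] x y cx xy yd /=; first by rewrite mul1r.
have [] := IH (fibers F i x) (fibers F i y).
- by apply: le_trans (ltW h1) _; exact: fibers_homo.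
- exact: fibers_homo.
- by apply: (le_trans _ (ltW h2)); exact: fibers_homo.
move=> ? ? h; split => //; apply: le_trans h _.
by rewrite exprSr -mulrA ler_wpM2l ?exprn_ge0// contracting_step.
Qed.

Lemma contracting_diam k : `|act (fibers F) (w0 ++ nseq k i) c -
  act (fibers F) (w0 ++ nseq k i) d| <= (d1 - c1) * lam ^+ k.
Proof.
case: ctr => /andP[l0 _] _ _ [h1 h2].
have le : act (fibers F) w0 c <= act (fibers F) w0 d by exact: act_fibers_homo.
have [_ _ h] := contracting_iter k (ltW h1) le (ltW h2).
rewrite distrC ger0_norm ?subr_ge0 ?act_fibers_homo// !act_cat.
apply: le_trans h _; rewrite mulrC ler_wpM2r ?exprn_ge0//; lra.
Qed.

Lemma contracting_fixpoint : exists2 p, c1 < p < d1 & fibers F i p = p.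
Proof.
case: ctr => _ _ [h1 h2] [h3 h4].
have c1d1 : c1 < d1.
  by apply: lt_trans h3 _; apply: le_lt_trans h4; exact: act_fibers_homo.
have cf : {within `[c1, d1], continuous (fun x => fibers F i x - x)}.
  apply: continuous_subspaceT => x.
  by apply: cvgB; [exact: continuous_fibers|exact: cvg_id].
have [|p] := IVT (ltW c1d1) cf (v := 0).
  rewrite ge_min le_max; apply/andP; split; apply/orP.
    by right; rewrite subr_le0 ltW.
  by left; rewrite subr_ge0 ltW.
rewrite in_itv /= => /andP[cp pd] /eqP; rewrite subr_eq0 => /eqP fp.
exists p => //; rewrite lt_neqAle cp andbT lt_neqAle pd andbT.
apply/andP; split; apply/eqP => E.
  by move: h1; rewrite E fp ltxx.
by move: h2; rewrite -E fp ltxx.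
Qed.

Lemma contracting_to_fixpoint p k x : c1 < p < d1 -> fibers F i p = p -> c <= x <= d ->
  `|act (fibers F) (w0 ++ nseq k i) x - p| <= (d1 - c1) * lam ^+ k.
Proof.
move=> /andP[cp pd] fp /andP[cx xd].
case: ctr => /andP[l0 _] _ _ [h1 h2].
have fk : act (fibers F) (nseq k i) p = p.
  by elim: k => //= k IH; rewrite fp.
have lk : 0 <= lam ^+ k by rewrite exprn_ge0.
rewrite act_cat; set y := act (fibers F) w0 x.
have c1y : c1 <= y by apply: le_trans (ltW h1) _; exact: act_fibers_homo.
have yd1 : y <= d1 by apply: (le_trans _ (ltW h2)); exact: act_fibers_homo.
have [yp|/ltW py] := leP y p.
  have [_ _] := contracting_iter k c1y yp (ltW pd); rewrite fk => h.
  rewrite distrC ger0_norm; last by rewrite subr_ge0 -[leRHS]fk act_fibers_homo.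
  by apply: le_trans h _; rewrite mulrC ler_wpM2r//; lra.
have [_ _] := contracting_iter k (ltW cp) py yd1; rewrite fk => h.
rewrite ger0_norm; last by rewrite subr_ge0 -[leLHS]fk act_fibers_homo.
by apply: le_trans h _; rewrite mulrC ler_wpM2r//; lra.
Qed.

End Contracting.

Lemma continuous_pull F (q : R) i (h : R -> R) : continuous h ->
  continuous (fun t : R => (1 - t) * fibers F i (h t) + t * q).
Proof.
move=> ch t; apply: cvgD; apply: cvgM.
- by apply: cvgB; [exact: cvg_cst|exact: cvg_id].
- by apply: (continuous_comp (ch t)); exact: continuous_fibers.
- exact: cvg_id.
- exact: cvg_cst.
Qed.

(** A pull towards an end of the segment moves all points, since the images of the
    fiber maps stay away from both ends. *)
Lemma maps_inside_gap F : maps_inside F -> exists2 c0, 0 < c0 &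
  forall i x, c0 <= b - fibers F i x /\ c0 <= fibers F i x - a.
Proof.
move=> inF.
pose gap i := Num.min (b - fibers F i b) (fibers F i a - a).
exists (\big[Num.min/1]_i gap i).
  by apply: lt_bigmin => // i _; rewrite lt_min !subr_gt0; have [-> ->] := inF i.
move=> i x; have : \big[Num.min/1]_i gap i <= gap i by exact: bigmin_le.
rewrite le_min => /andP[h1 h2].
have cx : fibers F i x = fibers F i (set_val (clamp (hab := hab) x)).
  by rewrite /fibers /ext clampK.
have /andP[ac cb] := val_segment (clamp (hab := hab) x).
have : fibers F i x <= fibers F i b by rewrite cx; exact: fibers_homo.
have : fibers F i a <= fibers F i x by rewrite cx; exact: fibers_homo.
lra.
Qed.

(** If a word sent a point near the orbit of p into (b1, b2), then
    [raising_crossing] would give, arbitrarily close to F, a skew product with a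
    word sending all of [c, d] there. *)
Lemma no_escape F c d i c1 d1 lam w0 p (b1 b2 : R) : maps_inside F -> trapped F c d ->
  contracting F c d i c1 d1 lam w0 -> c1 < p < d1 -> fibers F i p = p ->
  nbhs F (~` good_hitting c d b1 b2) ->
  (forall v, ~ (b1 < act (fibers F) v p < b2)) ->
  exists2 del, 0 < del & forall x v w, `|x - act (fibers F) v p| < del ->
    ~ (b1 < act (fibers F) w x < b2).
Proof.
move=> inF tr ctr hp fp NH Nv.
have cd : c <= d by apply: ltW; case: tr.
have [hl _ _ [hc hd]] := ctr.
have c1d1 : 0 <= d1 - c1.
  rewrite subr_ge0 ltW//; apply: lt_trans hc _; apply: le_lt_trans hd.
  exact: act_fibers_homo.
pose lam' := (lam + 1) / 2.
have ll' : lam < lam' < 1 by rewrite /lam'; lra.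
have hl' : 0 <= lam' < 1 by lra.
have [e /andP[e0 e1] He] := nbhs_pull_all (nbhsI NH (nbhsI (near_trapped r0 tr)
  (near_contracting r0 ll' ctr))).
pose t0 := e / 2.
have t00 : 0 < t0 by rewrite divr_gt0.
have te t : 0 <= t <= t0 -> 0 <= t < e by rewrite /t0; lra.
have [c0 c00 Hc0] := maps_inside_gap inF.
have [L L1 HL] := fibers_lipschitz r0 F.
have L0 : 0 <= L by lra.
have step t q i' x y : 0 <= t <= t0 -> x <= y ->
    0 <= ((1 - t) * fibers F i' y + t * q) - ((1 - t) * fibers F i' x + t * q) <= L * (y - x).
  move=> /te ht xy; have h1 := HL i' x y xy; have h2 := fibers_homo F i' xy.
  rewrite opprD addrACA subrr addr0 -mulrBr; apply/andP; split; first by rewrite mulr_ge0; lra.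
  by apply: le_trans h1; rewrite ler_piMl; lra.
have E t q : 0 <= t <= t0 -> a <= q <= b ->
    (fun i x => (1 - t) * fibers F i x + t * q) = fibers (pull_all (fun=> t) q F).
  move=> /te ht hq; apply/funext => j; apply/funext => x.
  by rewrite fibers_pull_all// => _; lra.
have E0 q : (fun i x => (1 - 0) * fibers F i x + 0 * q) = fibers F.
  by apply/funext => j; apply/funext => x; rewrite subr0 mul1r mul0r addr0.
have diam t q k : 0 <= t <= t0 -> a <= q <= b ->
    `|act (fun i x => (1 - t) * fibers F i x + t * q) (w0 ++ nseq k i) c -
      act (fun i x => (1 - t) * fibers F i x + t * q) (w0 ++ nseq k i) d|
    <= (d1 - c1) * lam' ^+ k.
  move=> ht hq; rewrite E//.
  have [|_ [_ ctr']] := He (fun=> t) q _ hq; first by move=> _; exact: te.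
  exact: (contracting_diam cd ctr').
have ctr0 : contracting F c d i c1 d1 lam' w0.
  case: ctr => _ dl h1 h2; split => // q hq.
  by apply: le_trans (dl q hq) _; lra.
have hcc : c <= c <= d by rewrite lexx.
have wk0 k : (0 < k)%N -> (0 < size (w0 ++ nseq k i))%N.
  by move=> k0; rewrite size_cat size_nseq ltn_addl.
have contra t q u : 0 <= t <= t0 -> a <= q <= b ->
    b1 < act (fun i x => (1 - t) * fibers F i x + t * q) u c ->
    act (fun i x => (1 - t) * fibers F i x + t * q) u d < b2 -> False.
  move=> ht hq; rewrite E// => h1 h2.
  have [|+ [tr' ctr']] := He (fun=> t) q _ hq; first by move=> _; exact: te.
  by apply; split; [split => //; exists i, c1, d1, lam', w0|exists u].
exists (t0 * c0) => [|x v w xv bw]; first exact: mulr_gt0.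
have [lt|gt|eq] := ltgtP (act (fibers F) v p) x.
- pose G t (i : 'I_s) x := (1 - t) * fibers F i x + t * b.
  have hb : a <= b <= b by rewrite lexx ltW.
  have GR : raising G t0 c0 L.
    split.
    + by move=> t j ht y z yz; have := step t b j y z ht yz; rewrite subr_ge0 => /andP[].
    + by move=> t j y z ht yz; have := step t b j y z ht yz => /andP[].
    + by move=> j h; exact: continuous_pull.
    + move=> t j y /andP[t_ge0 _]; have [+ _] := Hc0 j y; rewrite /G; nra.
  have [||||t [u [ht /andP[h1 _] /andP[_ h2]]]] := @raising_crossing _ _ G t0 c0 L t00 c00 L0 GR c d (d1 - c1) lam' p
    (fun k => w0 ++ nseq k i) v w x b1 b2 hl' c1d1 wk0.
  + by move=> t k ht; exact: diam.
  + by move=> k; rewrite /G E0; exact: (contracting_to_fixpoint ctr0 k hp fp hcc).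
  + by rewrite /G E0 lt /=; move: xv; rewrite ltr_norml => /andP[_]; lra.
  + by rewrite /G E0.
  exact: (contra t b u).
(* a point below the orbit of p is one above it after reflection *)
- pose G t (i : 'I_s) x := - ((1 - t) * fibers F i (- x) + t * a).
  have ha : a <= a <= b by rewrite lexx ltW.
  have GR : raising G t0 c0 L.
    split.
    + move=> t j ht y z yz; rewrite /G lerN2.
      have yz' : - z <= - y by rewrite lerN2.
      by have := step t a j _ _ ht yz'; rewrite subr_ge0 => /andP[].
    + move=> t j y z ht yz; have yz' : - z <= - y by rewrite lerN2.
      have /andP[_] := step t a j _ _ ht yz'; rewrite /G; lra.
    + move=> j h ch t; apply: cvgN.
      have ch' : continuous (fun t => - h t) by move=> t'; apply: cvgN; exact: ch.
      exact: (@continuous_pull F a j _ ch' t).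
    + move=> t j y /andP[t_ge0 _]; have [_ +] := Hc0 j (- y); rewrite /G; nra.
  have GE t u y : act (G t) u (- y) =
      - act (fun i x => (1 - t) * fibers F i x + t * a) u y.
    by rewrite -[in RHS](opprK y) -act_opp.
  have [||||t [u [ht /andP[_ h1] /andP[h2 _]]]] := @raising_crossing _ _ G t0 c0 L t00 c00 L0 GR (- c) (- d) (d1 - c1) lam' (- p)
    (fun k => w0 ++ nseq k i) v w (- x) (- b2) (- b1) hl' c1d1 wk0.
  + by move=> t k ht; rewrite !GE -opprD normrN; exact: diam.
  + move=> k; rewrite GE E0 -opprD normrN.
    exact: (contracting_to_fixpoint ctr0 k hp fp hcc).
  + rewrite GE E0; move: xv; rewrite ltr_norml => /andP[? _]; lra.
  + by rewrite GE E0 !ltrN2 andbC.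
  move: h1 h2; rewrite !GE !ltrN2; exact: (contra t a u).
- by apply: (Nv (v ++ w)); rewrite act_cat eq.
Qed.

Lemma trapped_act_le F c d w x : trapped F c d -> c <= x <= d ->
  c <= act (fibers F) w x <= d.
Proof.
move=> [_ tr]; elim: w x => //= i w IH x /andP[cx xd]; apply: IH.
have := fibers_homo F i cx; have := fibers_homo F i xd; have := tr i; lra.
Qed.

Lemma fixpoint_in_trap F c d i c1 d1 lam w0 p : trapped F c d ->
  contracting F c d i c1 d1 lam w0 -> c1 < p < d1 -> fibers F i p = p -> c <= p <= d.
Proof.
move=> tr ctr hp fp; have [hl _ _ [hc hd]] := ctr.
have cd : c <= d by apply: ltW; case: tr.
have hcc : c <= c <= d by rewrite lexx.
have cd1 : 0 <= d1 - c1 by case/andP: hp; lra.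
have close e : 0 < e -> exists2 y, c <= y <= d & `|y - p| < e.
  move=> e0; have [k [_ Hk]] := exists_expr_lt hl e0 cd1.
  exists (act (fibers F) (w0 ++ nseq k i) c); first exact: trapped_act_le.
  exact: le_lt_trans (contracting_to_fixpoint ctr k hp fp hcc) Hk.
apply/andP; split; rewrite leNgt; apply/negP; rewrite -subr_gt0 => /close[y hy];
  rewrite ltr_norml; lra.
Qed.

(** Each point z at distance at least e from the orbit has a rational neighborhood
    which the orbit either meets or avoids; in the second case [no_escape]
    provides del, and compactness makes del uniform in z. *)
Lemma stable_orbit F c d i c1 d1 lam w0 p : maps_inside F -> trapped F c d ->
  contracting F c d i c1 d1 lam w0 -> c1 < p < d1 -> fibers F i p = p ->
  (forall q1 q2 : rat, settled (good_hitting c d (ratr q1 : R) (ratr q2 : R)) F) ->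
  forall e, 0 < e -> exists2 del, 0 < del & forall x v w, a <= x <= b ->
    `|x - act (fibers F) v p| < del ->
    exists v', `|act (fibers F) w x - act (fibers F) v' p| < e.
Proof.
move=> inF tr ctr hp fp setF e e0.
pose P (n : nat) z := (forall v, e <= `|z - act (fibers F) v p|) ->
  forall x v w, `|x - act (fibers F) v p| < n.+1%:R^-1 -> act (fibers F) w x <> z.
have /compact_near_coveringP cov := @segment_compact R a b.
have [z0 _|N _ HN] := cov nat \oo P _.
  have e20 : 0 < e / 2 by rewrite divr_gt0.
  have [q1] := @rat_in_itvoo R (z0 - e / 2) z0 ltac:(lra).
  have [q2] := @rat_in_itvoo R z0 (z0 + e / 2) ltac:(lra).
  rewrite !in_itv /= => /andP[zq2 q2e] /andP[eq1 q1z].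
  set b1 : R := ratr q1 in eq1 q1z; set b2 : R := ratr q2 in zq2 q2e.
  have nearz : \forall z \near z0, b1 < z < b2.
    have o : open `]b1, b2[%classic by exact: itv_open.
    have m : `]b1, b2[%classic z0 by rewrite /= in_itv /= q1z zq2.
    by apply: filterS (open_nbhs_nbhs (conj o m)) => z; rewrite /= in_itv.
  have [[v hv]|Nv] := pselect (exists v, b1 < act (fibers F) v p < b2).
    exists ([set z | b1 < z < b2], setT); first by split => //; exact: filterT.
    by move=> [z n] [/= hz _] /(_ v); rewrite leNgt => /negP[]; rewrite ltr_norml; lra.
  have {}Nv v : ~ b1 < act (fibers F) v p < b2 by move=> h; apply: Nv; exists v.
  case: (setF q1 q2) => [[_ [w [h1 h2]]]|NH].
    have /andP[cp pd] := fixpoint_in_trap tr ctr hp fp.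
    case: (Nv w); rewrite (lt_le_trans h1 (act_fibers_homo F w cp)).
    exact: le_lt_trans (act_fibers_homo F w pd) h2.
  have [del del0 Hdel] := no_escape inF tr ctr hp fp NH Nv.
  exists ([set z | b1 < z < b2], [set n : nat | n.+1%:R^-1 < del]).
    by split => //=; exact: (near_infty_natSinv_lt (PosNum del0)).
  move=> [z n] [/= hz hn] _ x v w xv xz; apply: (Hdel x v w) => //.
    exact: lt_trans hn.
  by rewrite xz.
exists (N.+1%:R^-1) => [|x v w xab xv]; first by rewrite invr_gt0.
apply: contrapT => Nv'; apply: (HN N (leqnn N) (act (fibers F) w x) _ _ x v w xv erefl).
- by rewrite /= in_itv /=; apply: act_itv => // j y; exact: fibers_itv.
- move=> v'; rewrite leNgt; apply/negP => h; apply: Nv'; exists v'; exact: h.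
Qed.

End Stability.

(** * Expectations over random words *)
Section WordExpectation.
Context {R : realType} {s : nat}.
Hypothesis s0 : (0 < s)%N.
Local Notation word := (seq 'I_s).
Implicit Types (phi psi : word -> R) (Q : set word) (w v u : word).

(** The independence of the letters is built into the recursion, and is used in the
    form of [wexp_cat]. *)
Fixpoint wexp n phi : R :=
  if n is n'.+1 then s%:R^-1 * \sum_(i < s) wexp n' (fun w => phi (i :: w))
  else phi [::].

Definition wprob n Q : R := wexp n (fun w => `[< Q w >]%:R).

Let s_gt0 : 0 < s%:R :> R. Proof. by rewrite ltr0n. Qed.

Lemma wexp_le n phi psi : (forall w, size w = n -> phi w <= psi w) ->
  wexp n phi <= wexp n psi.
Proof.
elim: n phi psi => [|n IH] phi psi H /=; first exact: H.
apply: ler_wpM2l; first by rewrite invr_ge0 ltW.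
by apply: ler_sum => i _; apply: IH => w wn; apply: H; rewrite /= wn.
Qed.

Lemma eq_wexp n phi psi : (forall w, size w = n -> phi w = psi w) ->
  wexp n phi = wexp n psi.
Proof. by move=> H; apply/eqP; rewrite eq_le !wexp_le// => w /H ->. Qed.

Lemma wexp_cst n (c : R) : wexp n (fun=> c) = c.
Proof.
elim: n => //= n IH; rewrite IH sumr_const card_ord -[c *+ s]mulr_natl.
by rewrite mulKf// gt_eqF.
Qed.

Lemma wexpZ n (c : R) phi : wexp n (fun w => c * phi w) = c * wexp n phi.
Proof.
elim: n phi => //= n IH phi; rewrite mulrCA; congr (_ * _).
by rewrite mulr_sumr; apply: eq_bigr => i _; exact: IH.
Qed.

Lemma wexpD n phi psi : wexp n (fun w => phi w + psi w) = wexp n phi + wexp n psi.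
Proof.
elim: n phi psi => //= n IH phi psi; rewrite -mulrDr; congr (_ * _).
by rewrite -big_split; apply: eq_bigr => i _; exact: IH.
Qed.

Lemma wexp_cat n m phi :
  wexp (n + m) phi = wexp n (fun v => wexp m (fun u => phi (v ++ u))).
Proof.
elim: n phi => //= n IH phi; congr (_ * _); apply: eq_bigr => i _.
exact: IH.
Qed.

Lemma wprob_le n Q Q' : (forall w, size w = n -> Q w -> Q' w) -> wprob n Q <= wprob n Q'.
Proof.
move=> H; apply: wexp_le => w wn; rewrite ler_nat.
by case: (asboolP (Q w)) => // /(H w wn)/asboolT ->.
Qed.

Lemma wprob_word v : wprob (size v) [set v] = s%:R^-1 ^+ size v.
Proof.
rewrite /wprob; elim: v => [|i v IH] /=; first by rewrite asboolT.
rewrite (bigD1 i)//= big1 ?addr0 => [|j ji].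
  rewrite exprS; congr (_ * _); rewrite -IH; apply: eq_wexp => w _; congr (_%:R).
  by congr nat_of_bool; apply/asboolP/asboolP => [[]|->].
rewrite -[RHS](wexp_cst (size v)); apply: eq_wexp => w _.
by case: asboolP => // -[E]; rewrite E eqxx in ji.
Qed.

(** Among n more letters at least one word, of probability s^-n, leads into W,
    wherever the point is; so every block of n letters multiplies the probability
    of having avoided W by at most 1 - s^-n. *)
Lemma wprob_absorption (g : 'I_s -> R -> R) (K W : set R) n k x :
  (forall i y, K y -> K (g i y)) -> (forall i y, W y -> W (g i y)) ->
  (forall y, K y -> exists2 v, size v = n & W (act g v y)) -> K x ->
  wprob (k * n) [set u | ~ W (act g u x)] <= (1 - s%:R^-1 ^+ n) ^+ k.
Proof.
move=> Kg Wg HW; elim: k x => [|k IH] x Kx.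
  rewrite mul0n expr0 -[leRHS](wexp_cst 0); apply: wexp_le => w _.
  by rewrite lern1 leq_b1.
have Wact v y : W y -> W (act g v y) by elim: v y => //= i v IHv y /(Wg i); exact: IHv.
have Kact v y : K y -> K (act g v y) by elim: v y => //= i v IHv y /(Kg i); exact: IHv.
have [v0 v0n Wv0] := HW x Kx.
set r := 1 - _ in IH *.
have r0 : 0 <= r.
  rewrite subr_ge0 exprn_ile1 ?invr_ge0 ?ler0n// invf_le1// ler1n//.
rewrite mulSn /wprob wexp_cat.
apply: (@le_trans _ _ (wexp n (fun v => r ^+ k * `[< ~ W (act g v x) >]%:R))).
  apply: wexp_le => v _; case: (asboolP (~ W (act g v x))) => [NW|/contrapT Wv].
    rewrite mulr1; apply: le_trans (IH (act g v x) (Kact v x Kx)).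
    by apply: wprob_le => u _ /=; rewrite act_cat.
  rewrite mulr0 -[leRHS](wexp_cst (k * n)); apply: wexp_le => u _.
  by case: asboolP => //= h; case: h; rewrite act_cat; exact: Wact.
rewrite wexpZ exprSr ler_wpM2l ?exprn_ge0// /r -v0n -wprob_word.
rewrite lerBrDl -wexpD -[leRHS](wexp_cst (size v0)); apply: wexp_le => v _.
case: (asboolP ([set v0] v)) => [->|_]; last by rewrite add0r lern1 leq_b1.
by rewrite asboolF ?addr0.
Qed.

Variable W : word.

(** The number of occurrences of W in u, overlapping ones included. *)
Fixpoint occ u : nat := if u is i :: u' then (prefix W u + occ u')%N else 0%N.

Lemma occ_size u : (occ u <= size u)%N.
Proof. by elim: u => //= i u IH; rewrite -add1n leq_add// leq_b1. Qed.

Local Notation dl := (s%:R^-1 ^+ size W : R).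

Lemma dl_gt0 : 0 < dl. Proof. by rewrite exprn_gt0// invr_gt0. Qed.
Lemma dl_le1 : dl <= 1.
Proof. by rewrite exprn_ile1 ?invr_ge0 ?ler0n// invf_le1// ler1n. Qed.

Lemma wexp_prefix n : (size W <= n)%N -> wexp n (fun u => (prefix W u)%:R) = dl.
Proof.
move=> /subnKC <-; rewrite wexp_cat -wprob_word; apply: eq_wexp => v vW.
rewrite -[RHS](wexp_cst (n - size W)); apply: eq_wexp => u _.
congr (_%:R); congr nat_of_bool; rewrite prefixE take_cat vW ltnn subnn take0 cats0.
by apply/eqP/asboolP.
Qed.

Lemma wexp_occ n : (n - size W)%:R * dl <= wexp n (fun u => (occ u)%:R).
Proof.
elim: n => [|n IH]; first by rewrite sub0n mul0r.
have E : wexp n.+1 (fun u => (occ u)%:R) =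
    wexp n.+1 (fun u => (prefix W u)%:R) + wexp n (fun u => (occ u)%:R).
  have -> : wexp n (fun u => (occ u)%:R) = wexp n.+1 (fun u => (occ (behead u))%:R).
    by rewrite /= -[LHS](wexp_cst 1).
  rewrite -wexpD; apply: eq_wexp => -[//|i u] _ /=; by rewrite natrD.
have d0 := ltW dl_gt0.
have occ0 : 0 <= wexp n (fun u => (occ u)%:R).
  by apply: le_trans IH; rewrite mulr_ge0.
rewrite E; have [Wn|nW] := leqP (size W) n.+1.
  rewrite wexp_prefix//; move: Wn; rewrite leq_eqVlt => /orP[/eqP Wn|].
    by rewrite Wn subnn mul0r -Wn; exact: addr_ge0.
  by rewrite ltnS => Wn; rewrite subSn// -nat1r mulrDl mul1r lerD2l.
rewrite (_ : (n.+1 - size W = 0)%N) ?mul0r; last by apply/eqP; rewrite subn_eq0 ltnW.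
by rewrite addr_ge0// -[leLHS](wexp_cst n.+1); apply: wexp_le => u _.
Qed.

(** The expected number of occurrences is about n dl, and that number never exceeds
    n; a random variable with values in [0, n] and mean at least n dl / 2 is at
    least n dl / 4 with probability at least dl / 4. *)
Lemma wprob_rare n : (size W * 2 <= n)%N -> (0 < n)%N ->
  wprob n [set u | (occ u)%:R < dl / 4 * n%:R] <= 1 - dl / 4.
Proof.
move=> Wn n0; have n0R : 0 < n%:R :> R by rewrite ltr0n.
pose p := wprob n [set u | (occ u)%:R < dl / 4 * n%:R].
have h1 : wexp n (fun u => (occ u)%:R) <= n%:R * (1 - p) + dl / 4 * n%:R.
  pose ind u : R := `[< (occ u)%:R < dl / 4 * n%:R >]%:R.
  have -> : n%:R * (1 - p) + dl / 4 * n%:R =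
      wexp n (fun u => n%:R * (1 + -1 * ind u) + dl / 4 * n%:R).
    rewrite (wexpD n (fun u => n%:R * (1 + -1 * ind u)) (fun=> dl / 4 * n%:R)).
    rewrite (wexpZ n n%:R (fun u => 1 + -1 * ind u)).
    rewrite (wexpD n (fun=> 1) (fun u => -1 * ind u)) (wexpZ n (-1) ind).
    by rewrite !wexp_cst mulN1r.
  apply: wexp_le => u un; rewrite /ind.
  have := occ_size u; rewrite un -(ler_nat R) => h.
  have := dl_gt0; case: asboolP => /= [lt|/negP]; first by nra.
  rewrite -leNgt => _ d0; rewrite mulr0 addr0 mulr1; nra.
have h2 := wexp_occ n.
have h3 : n%:R / 2 <= (n - size W)%:R :> R.
  rewrite ler_pdivrMr// -natrM ler_nat mulnBl muln2 -addnn.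
  by rewrite -addnBA ?leq_addr.
rewrite -/p.
have h4 : n%:R / 2 * dl <= n%:R * (1 - p) + dl / 4 * n%:R.
  by apply: le_trans h1; apply: le_trans h2; rewrite ler_wpM2r// ltW// dl_gt0.
have : n%:R * p <= n%:R * (1 - dl / 4) by lra.
by rewrite ler_pM2l.
Qed.

(** The windows [2^j, 2^(j+1)) are disjoint, hence independent, and each of them is
    half of the prefix that ends with it: being frequent in one of them is being
    frequent in a prefix.  Positive upper density follows without the law of large
    numbers. *)
Definition rare_windows j0 k u := forall j, (j0 <= j < j0 + k)%N ->
  (occ (take (2 ^ j) (drop (2 ^ j) u)))%:R < dl / 4 * (2 ^ j)%:R.

Lemma wprob_rare_windows j0 k : (size W * 2 <= 2 ^ j0)%N ->
  wprob (2 ^ (j0 + k)) [set u | rare_windows j0 k u] <= (1 - dl / 4) ^+ k.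
Proof.
move=> Wj0; have r0 : 0 <= 1 - dl / 4 by have := dl_le1; lra.
elim: k => [|k IH].
  rewrite expr0 -[leRHS](wexp_cst (2 ^ (j0 + 0))); apply: wexp_le => w _.
  by rewrite lern1 leq_b1.
rewrite addnS expnS mul2n -addnn /wprob wexp_cat.
set N := (2 ^ (j0 + k))%N in IH *.
apply: (@le_trans _ _ (wexp N (fun v => (1 - dl / 4) * `[< rare_windows j0 k v >]%:R))); last first.
  by rewrite wexpZ exprS ler_wpM2l.
apply: wexp_le => v vN.
have N0 : (0 < N)%N by rewrite expn_gt0.
have WN : (size W * 2 <= N)%N by rewrite (leq_trans Wj0)// leq_pexp2l// leq_addr.
have old u : rare_windows j0 k.+1 (v ++ u) -> rare_windows j0 k v.
  move=> H j /andP[j1 j2]; have := H j; rewrite j1 addnS ltnS (ltnW j2) => /(_ isT).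
  have jN : (2 ^ j + 2 ^ j <= size v)%N.
    by rewrite vN addnn -mul2n -expnS leq_pexp2l.
  rewrite drop_cat (_ : (2 ^ j < size v)%N); last first.
    by rewrite (leq_trans _ jN)// -[X in (X < _)%N]addn0 ltn_add2l expn_gt0.
  by rewrite takel_cat// size_drop leq_subRL// (leq_trans _ jN)// leq_addr.
case: (asboolP (rare_windows j0 k v)) => [Hv|NHv]; last first.
  rewrite mulr0 -[leRHS](wexp_cst N); apply: wexp_le => u _.
  by case: asboolP => // /old.
rewrite mulr1; apply: le_trans (wprob_rare WN N0); apply: wexp_le => u uN.
rewrite ler_nat; case: asboolP => // H; rewrite asboolT//=.
have := H (j0 + k)%N; rewrite leq_addr addnS ltnSn => /(_ isT).
by rewrite -/N drop_size_cat// take_oversize ?uN.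
Qed.

End WordExpectation.

(** * Windows of a Bernoulli sequence *)
Section BernoulliWindows.
Context {R : realType} {s : nat} {hs : (2 <= s)%N}.
Local Notation S := (shift_space R hs).
Local Notation mu := (@bernoulli_measure R s hs).
Local Notation word := (seq 'I_s).
Implicit Types (Q : set word) (om : S).

Let s0 : (0 < s)%N := ltnW hs.

Definition window (j n : nat) om : word := [seq om (Posz m) | m <- iota j n].

Lemma size_window j n om : size (window j n om) = n.
Proof. by rewrite size_map size_iota. Qed.

Lemma window_cat j n m om : window j (n + m) om = window j n om ++ window (j + n) m om.
Proof. by rewrite /window iotaD map_cat. Qed.

Lemma windowS j n om : window j n.+1 om = om (Posz j) :: window j.+1 n om.
Proof. by []. Qed.

Lemma measurable_coord (n : int) (i : 'I_s) : measurable [set om : S | om n = i].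
Proof. by apply: sub_sigma_algebra; exists n, i. Qed.

Lemma measurable_window j n Q : measurable [set om : S | Q (window j n om)].
Proof.
elim: n j Q => [|n IH] j Q.
  have [Q0|NQ0] := pselect (Q [::]).
    by rewrite (_ : mkset _ = setT) //; apply/seteqP; split.
  by rewrite (_ : mkset _ = set0) //; apply/seteqP; split.
rewrite (_ : mkset _ = \bigcup_(i in [set: 'I_s]) ([set om : S | om (Posz j) = i] `&`
    [set om : S | [set w | Q (i :: w)] (window j.+1 n om)])); last first.
  apply/seteqP; split => om /=; rewrite windowS; first by exists (om (Posz j)).
  by move=> [i _ [-> ]].
apply: fin_bigcup_measurable => // i _.
by apply: measurableI; [exact: measurable_coord|exact: IH].
Qed.

Lemma bernoulli_prefix u : mu [set om : S | window 0 (size u) om = u] =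
  ((s%:R^-1 ^+ size u)%:E)%E.
Proof.
pose J := [seq Posz m | m <- iota 0 (size u)].
pose c (n : int) := nth (Ordinal s0) u `|n|%N.
have uJ : uniq J by rewrite map_inj_uniq ?iota_uniq// => ? ? [].
have := bernoulli_measureP c uJ.
rewrite size_map size_iota exprVn => <-; congr (mu _).
apply/seteqP; split => om /=.
  move=> omu j /mapP[m]; rewrite mem_iota /= add0n => mu_ ->.
  by rewrite /c -omu (nth_map 0%N) ?size_map ?size_iota//= ?size_window ?nth_iota// size_iota.
move=> H; apply: (@eq_from_nth _ (Ordinal s0)); first by rewrite size_window.
move=> m; rewrite size_window => mu_.
rewrite (nth_map 0%N) ?size_iota// nth_iota// add0n H//.
by apply/mapP; exists m => //; rewrite mem_iota.
Qed.

(** The prefix u is there for the induction on n, which moves the first letter of the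
    window into it. *)
Lemma bernoulli_window u n Q :
  mu [set om : S | window 0 (size u) om = u /\ Q (window (size u) n om)] =
  ((s%:R^-1 ^+ size u * wprob n Q)%:E)%E.
Proof.
elim: n u Q => [|n IH] u Q.
  rewrite /wprob /=; case: asboolP => [Q0|NQ0].
    rewrite mulr1 -bernoulli_prefix; congr (mu _).
    by apply/seteqP; split => om /= => [[]|].
  rewrite mulr0 (_ : mkset _ = set0) ?measure0//.
  by apply/seteqP; split => om //= -[].
pose part (i : 'I_s) := [set om : S | window 0 (size (rcons u i)) om = rcons u i /\
  [set w | Q (i :: w)] (window (size (rcons u i)) n om)].
rewrite (_ : mkset _ = \big[setU/set0]_(i < s) part i); last first.
  rewrite -bigcup_seq; apply/seteqP; split => om /=.
    move=> [omu Qom]; exists (om (Posz (size u))); first exact: mem_index_enum.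
    split; rewrite size_rcons; last exact: Qom.
    by rewrite -addn1 window_cat omu cats1.
  move=> [i _ []]; rewrite size_rcons -addn1 window_cat /= -cats1 /=.
  rewrite add0n addn1 => /eqP; rewrite eqseq_cat ?size_window// => /andP[/eqP -> /eqP[E]].
  by split => //; rewrite windowS E.
rewrite measure_semi_additive_ord.
- rewrite (eq_bigr (fun i => (s%:R^-1 ^+ (size u).+1 * wprob n [set w | Q (i :: w)])%:E)).
    rewrite sumEFin; congr (_%:E); rewrite -mulr_sumr exprSr -mulrA.
    by congr (_ * (_ * _)); apply: eq_bigr.
  by move=> i _; rewrite -(size_rcons u i); exact: (IH (rcons u i) [set w | Q (i :: w)]).
- move=> i; apply: measurableI; last exact: measurable_window.
  exact: (measurable_window 0 _ [set w | w = rcons u i]).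
- apply/trivIsetP => i i' _ _ ii'; rewrite -subset0 => om [[+ _] [+ _]].
  by rewrite !size_rcons => -> /eqP; rewrite eqseq_rcons eqxx (negbTE ii').
- apply: bigsetU_measurable => i _; apply: measurableI; last exact: measurable_window.
  exact: (measurable_window 0 _ [set w | w = rcons u i]).
Qed.

Lemma bernoulli_wprob n Q : mu [set om : S | Q (window 0 n om)] = ((wprob n Q)%:E)%E.
Proof.
rewrite -[wprob n Q]mul1r -(bernoulli_window [::]); congr (mu _).
by apply/seteqP; split => om /= => [|[]].
Qed.

Lemma null_of_geometric (A : set S) (B : nat -> set S) (lam : R) : measurable A ->
  (forall k, measurable (B k)) -> (forall k, A `<=` B k) -> 0 <= lam < 1 ->
  (forall k, (mu (B k) <= (lam ^+ k)%:E)%E) -> mu A = 0%E.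
Proof.
move=> mA mB AB hl HB; apply/eqP; rewrite eq_le measure_ge0 andbT.
apply/lee_addgt0Pr => e e0; rewrite add0e.
have [k [_ Hk]] := exists_expr_lt hl e0 ler01.
apply: (@le_trans _ _ (mu (B k))); first by apply: le_measure; rewrite ?inE.
by apply: le_trans (HB k) _; rewrite lee_fin ltW// -[ltLHS]mul1r.
Qed.

Lemma bernoulli_absorption (g : 'I_s -> R -> R) (K W : set R) n x :
  (forall i y, K y -> K (g i y)) -> (forall i y, W y -> W (g i y)) ->
  (forall y, K y -> exists2 v, size v = n & W (act g v y)) -> K x ->
  mu [set om : S | forall k, ~ W (act g (window 0 k om) x)] = 0%E.
Proof.
move=> Kg Wg HW Kx; have [v0 v0n Wv0] := HW x Kx.
apply: (@null_of_geometric _ (fun k => [set om : S | [set u | ~ W (act g u x)]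
  (window 0 (k * n) om)]) (1 - s%:R^-1 ^+ n)).
- rewrite (_ : mkset _ = \bigcap_k [set om : S | [set u | ~ W (act g u x)] (window 0 k om)]).
    by apply: bigcap_measurableType => k _; exact: measurable_window.
  by apply/seteqP; split => om /= H k; [move=> _; exact: H|exact: (H k Logic.I)].
- by move=> k; exact: measurable_window.
- by move=> k om /=; exact.
- have sp : 0 < s%:R^-1 :> R by rewrite invr_gt0 ltr0n.
  rewrite subr_ge0 exprn_ile1 ?(ltW sp)//=; last by rewrite invf_le1 ?ler1n ?ltr0n.
  by rewrite ltrBlDr ltrDl exprn_gt0.
- by move=> k; rewrite bernoulli_wprob lee_fin; exact: (wprob_absorption s0 k Kg Wg HW Kx).
Qed.

Lemma take_drop_window (m N : nat) om : (m + m <= N)%N ->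
  take m (drop m (window 0 N om)) = window m m om.
Proof.
move=> mN; rewrite -(subnKC (leq_trans (leq_addr _ _) mN)) window_cat.
rewrite drop_size_cat ?size_window// add0n.
have mN' : (m <= N - m)%N by rewrite leq_subRL// (leq_trans _ mN)// leq_addr.
by rewrite -(subnKC mN') window_cat take_size_cat ?size_window.
Qed.

Lemma ae_frequent_window (W : word) (j0 : nat) : {ae mu, forall om : S,
  exists2 j, (j0 <= j)%N & s%:R^-1 ^+ size W / 4 * (2 ^ j)%:R <=
    (occ W (window (2 ^ j) (2 ^ j) om))%:R :> R}.
Proof.
pose kappa : R := s%:R^-1 ^+ size W / 4.
have k0 : 0 < kappa by rewrite divr_gt0 ?(dl_gt0 s0).
have k1 : kappa <= 1 by rewrite ler_pdivrMr//; have := dl_le1 (R := R) s0 W; lra.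
pose j1 := maxn j0 (size W * 2).
have Wj1 : (size W * 2 <= 2 ^ j1)%N.
  by rewrite (leq_trans _ (ltnW (ltn_expl j1 (ltnSn 1))))// leq_maxr.
pose B k := [set om : S | [set u | @rare_windows R s W j1 k u] (window 0 (2 ^ (j1 + k)) om)].
have mB k : measurable (B k) by exact: measurable_window.
apply: (@negligibleS _ _ _ _ (\bigcap_k B k)).
  move=> om /= H k _ j /andP[j1j jk].
  rewrite take_drop_window; last by rewrite addnn -mul2n -expnS leq_pexp2l.
  rewrite ltNge; apply/negP => le; apply: H; exists j => //.
  exact: leq_trans (leq_maxl _ _) j1j.
have mC : measurable (\bigcap_k B k) by exact: bigcap_measurableType.
apply/(negligibleP _ mC); apply: (@null_of_geometric _ B (1 - kappa)) => //.
- by move=> k om; exact.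
- by rewrite subr_ge0 k1 /= ltrBlDr ltrDl.
- by move=> k; rewrite bernoulli_wprob lee_fin; exact: wprob_rare_windows.
Qed.

(** The lower bound on the frequency of a word depends only on its length, and holds
    along infinitely many prefixes: this makes an upper frequency positive. *)
Definition frequent_windows om : Prop := forall (W : word) (j0 : nat),
  exists2 j, (j0 <= j)%N & s%:R^-1 ^+ size W / 4 * (2 ^ j)%:R <=
    (occ W (window (2 ^ j) (2 ^ j) om))%:R :> R.

Lemma ae_frequent_windows : {ae mu, forall om : S, frequent_windows om}.
Proof.
pose P (n : nat) om := if unpickle n is Some (W, j0) then
  exists2 j, (j0 <= j)%N & s%:R^-1 ^+ size (W : word) / 4 * (2 ^ j)%:R <=
    (occ W (window (2 ^ j) (2 ^ j) om))%:R :> R else True.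
have /ae_foralln : forall n, {ae mu, forall om, P n om}.
  move=> n; rewrite /P; case: unpickle => [[W j0]|]; first exact: ae_frequent_window.
  exact: aeW.
apply: filterS => om H W j0.
by have := H (pickle (W, j0)); rewrite /P pickleK.
Qed.

Lemma occ_count (W : word) j n om :
  (occ W (window j n om) <= count (fun m => window m (size W) om == W) (iota j n))%N.
Proof.
elim: n j => [//|n IH] j; have -> : occ W (window j n.+1 om) =
  (prefix W (window j n.+1 om) + occ W (window j.+1 n om))%N by [].
have -> : count (fun m => window m (size W) om == W) (iota j n.+1) =
  ((window j (size W) om == W) +
   count (fun m => window m (size W) om == W) (iota j.+1 n))%N by [].
rewrite leq_add//.
case: (boolP (prefix W (window j n.+1 om))) => // pW.
suff -> : window j (size W) om == W by [].
have /subnKC Wn := size_prefix pW; rewrite size_window in Wn.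
move: pW; rewrite -Wn window_cat prefixE take_size_cat ?size_window//.
Qed.

Lemma recurrent_windows om : frequent_windows om ->
  forall (W : word) N, exists2 n, (N <= n)%N & window n (size W) om = W.
Proof.
move=> frq W N; have [j Nj Hj] := frq W N.
have sp : 0 < s%:R^-1 :> R by rewrite invr_gt0 ltr0n ltnW.
have occ0 : (0 < occ W (window (2 ^ j) (2 ^ j) om))%N.
  rewrite -(ltr_nat R); apply: lt_le_trans Hj.
  by rewrite mulr_gt0 ?divr_gt0 ?exprn_gt0 ?ltr0n ?expn_gt0.
have := leq_trans occ0 (occ_count W (2 ^ j) (2 ^ j) om).
rewrite -has_count => /hasP[m]; rewrite mem_iota => /andP[jm _] /eqP wm.
by exists m => //; rewrite (leq_trans Nj)// (leq_trans (ltnW (ltn_expl j (ltnSn 1)))).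
Qed.

End BernoulliWindows.

(** * The topology of the phase space *)
Section ShiftSpaceFacts.
Context {s : nat} {hs : (2 <= s)%N} {R : realType}.
Local Notation S := (shift_space R hs).
Local Notation word := (seq 'I_s).
Implicit Types om : S.

(** The symbols at the places -k, ..., -1, in the order in which an orbit has read
    them. *)
Definition past (k : nat) om : word := rev (mkseq (fun j => om (Negz j)) k).

Lemma size_past k om : size (past k om) = k.
Proof. by rewrite size_rev size_mkseq. Qed.

Lemma eq_past k om om' : (forall j, (j < k)%N -> om (Negz j) = om' (Negz j)) ->
  past k om = past k om'.
Proof.
move=> H; congr rev; apply: (@eq_from_nth _ (om 0)); first by rewrite !size_mkseq.
by move=> j; rewrite size_mkseq => jk; rewrite !nth_mkseq// H.
Qed.

Lemma past_inj k om om' : past k om = past k om' ->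
  forall j, (j < k)%N -> om (Negz j) = om' (Negz j).
Proof.
move=> /(congr1 rev); rewrite !revK => E j jk.
by have := congr1 (nth (om 0) ^~ j) E; rewrite !nth_mkseq.
Qed.

Lemma past_window k n om om' : (k <= n)%N ->
  (forall m, om' m = om (m + Posz n)) -> past k om' = window (n - k) k om.
Proof.
move=> kn H; apply: (@eq_from_nth _ (om 0)); rewrite ?size_past ?size_window//.
move=> j jk; rewrite /past nth_rev ?size_mkseq// nth_mkseq; last by lia.
rewrite (nth_map 0%N) ?size_iota// nth_iota// H; congr (om _); lia.
Qed.

Lemma past_shift k om : past k.+1 (shift om) = rcons (past k om) (om 0).
Proof.
rewrite /past /mkseq -[k.+1]add1n iotaD map_cat rev_cat /= -cats1; congr (_ ++ _).
rewrite (iotaDl 1 0 k) -map_comp; congr rev; apply: eq_map => j /=.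
by rewrite /shift; congr (om _); lia.
Qed.

Lemma shift_dist_lt (e : R) : 0 < e -> exists K : nat, forall w v : S,
  (forall m : int, (`|m| < K)%N -> w m = v m) -> shift_dist w v < e.
Proof.
move=> e0; have h2 : 0 <= (2^-1 : R) < 1 by lra.
have [K [_ HK]] := exists_expr_lt h2 e0 ler01.
exists K => w v wv; case: shift_distP => [//|m [n [nm wvn]] _].
have Km : (K <= m)%N.
  by rewrite leqNgt; apply/negP => mK; apply: wvn; apply: wv; rewrite nm.
apply: le_lt_trans HK; rewrite mul1r exprVn.
by rewrite lef_pV2 ?posrE ?exprn_gt0// ler_weXn2l// ler1n.
Qed.

(** An ultrafilter decides every coordinate, because the alphabet is finite, and
    converges to the sequence of its decisions. *)
Lemma compact_shift_space : compact [set: S].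
Proof.
rewrite compact_ultra => F FU _.
have FF : Filter F by exact: ultra_proper.
have /choice[om Hom] : forall n : int, exists i, F [set om : S | om n = i].
  move=> n; apply: contrapT => N.
  have : F [set om : S | forall i, om n <> i].
    apply: (@filter_forall S 'I_s (fun i om => om n <> i) F) => i.
    have [Fi|//] := in_ultra_setVsetC [set om : S | om n = i] FU.
    by exfalso; apply: N; exists i.
  by move=> /filter_ex[om /(_ (om n))].
exists om; split => // U /nbhs_ballP[e e0 omU].
have [K HK] := shift_dist_lt e0.
have H1 : F [set om' : S | forall j : 'I_K, om (Posz j) = om' (Posz j)].
  apply: (@filter_forall S 'I_K (fun j om' => om (Posz j) = om' (Posz j)) F) => j.
  by apply: filterS (Hom (Posz j)) => om' /= ->.
have H2 : F [set om' : S | forall j : 'I_K, om (Negz j) = om' (Negz j)].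
  apply: (@filter_forall S 'I_K (fun j om' => om (Negz j) = om' (Negz j)) F) => j.
  by apply: filterS (Hom (Negz j)) => om' /= ->.
apply: filterS (filterI H1 H2) => om' [h1 h2]; apply: omU; rewrite ballEmdist /=.
apply: HK => -[m|m] mK; first exact: (h1 (Ordinal mK)).
have mK' : (m < K)%N by apply: leq_trans mK; rewrite NegzE abszN /=.
exact: (h2 (Ordinal mK')).
Qed.

End ShiftSpaceFacts.

Section Orbits.
Context {r s : nat} {hs : (2 <= s)%N} {R : realType} {a b : R} {hab : a < b}.
Local Notation S := (shift_space R hs).
Local Notation X := (S * segment hab)%type.
Local Notation TI := (skew_products r s hab).
Local Notation word := (seq 'I_s).
Implicit Types (x y z : X) (om : S) (F : TI).

Lemma iter_skew F n x :
  (forall m, (iter n (skew_map F) x).1 m = x.1 (m + Posz n)) /\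
  set_val (iter n (skew_map F) x).2 = act (fibers F) (window 0 n x.1) (set_val x.2).
Proof.
elim: n => [|n [IH1 IH2]]; first by split => // m; rewrite addr0.
rewrite iterS; split => [m|].
  by rewrite /skew_map /shift /= IH1 -addrA -PoszD add1n.
rewrite -addn1 window_cat act_cat -IH2 /= add0n.
by rewrite /fibers ext_val IH1 add0r.
Qed.

(** Unlike balls, cylinders keep the base and the fiber apart. *)
Lemma nbhs_cylinderP z (U : set X) : nbhs z U <-> exists (K : nat) (e : R), 0 < e /\
  forall y, (forall m : int, (`|m| < K)%N -> z.1 m = y.1 m) ->
    `|set_val z.2 - set_val y.2| < e -> U y.
Proof.
split=> [/nbhs_sum_dist[e e0 H]|[K [e [e0 H]]]].
  have e20 : 0 < e / 2 by rewrite divr_gt0.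
  have [K HK] := shift_dist_lt (hs := hs) e20.
  exists K, (e / 2); split => // y zy dzy; apply: H.
  by rewrite [e]splitr ltrD// HK.
apply/nbhs_sum_dist; exists (Num.min e (2 ^- K)).
  by rewrite lt_min e0 invr_gt0 exprn_gt0.
move=> y; rewrite lt_min => /andP[d1 d2].
have sd0 : 0 <= shift_dist (R := R) z.1 y.1.
  by case: shift_distP => // m _ _; rewrite invr_ge0 exprn_ge0.
apply: H; last by apply: le_lt_trans d1; rewrite lerDr.
move=> m mK; apply: contrapT => zy; move: d2; apply/negP; rewrite -leNgt.
apply: ler_wpDr => //; case: shift_distP => [E|k _ kmin]; first by rewrite E in zy.
have km : (k <= `|m|)%N by apply: kmin; exists m.
rewrite lef_pV2 ?posrE ?exprn_gt0// ler_weXn2l ?ler1n//.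
by rewrite (leq_trans km)// ltnW.
Qed.

Lemma visitsE F x (U : set X) N :
  visits (skew_map F) x U N = count (fun n => `[< U (iter n (skew_map F) x) >]) (iota 0 N).
Proof.
rewrite /visits -val_enum_ord count_map -size_filter cardE; congr size.
rewrite {1}/enum_mem -enumT; apply: eq_filter => n.
by apply/idP/idP => [/set_mem//|Un]; exact: mem_set.
Qed.

Lemma freq_le0 F x (U : set X) (N0 : nat) :
  (forall N, (visits (skew_map F) x U N <= N0)%N) -> (freq (skew_map F) x U <= 0)%E.
Proof.
move=> H; apply/lee_addgt0Pr => e e0; rewrite add0e /freq limn_esup_lim.
apply: lime_le; first exact: is_cvg_esups.
pose M := (Num.truncn (N0%:R / e)).+1.
exists M => // n /= Mn; apply: ge_ereal_sup => _ [N /= nN <-].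
have MN : (M <= N)%N by exact: leq_trans Mn nN.
have N_gt0 : 0 < N%:R :> R by rewrite ltr0n; apply: leq_trans MN.
rewrite lee_fin ler_pdivrMr//.
apply: (@le_trans _ _ N0%:R); first by rewrite ler_nat.
rewrite mulrC -ler_pdivrMr//; apply: le_trans (ltW (truncnS_gt _)) _.
by rewrite ler_nat.
Qed.

Lemma freq_gt0 F x (U : set X) (kappa : R) : 0 < kappa ->
  (forall N0, exists2 N, (N0 <= N)%N & kappa <= (visits (skew_map F) x U N)%:R / N%:R) ->
  (0 < freq (skew_map F) x U)%E.
Proof.
move=> k0 H; apply: (@lt_le_trans _ _ kappa%:E); first by rewrite lte_fin.
rewrite /freq limn_esup_lim; apply: lime_ge; first exact: is_cvg_esups.
apply: nearW => n; have [N nN kN] := H n.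
apply: (@le_trans _ _ ((visits (skew_map F) x U N)%:R / N%:R)%:E).
  by rewrite lee_fin.
by apply: ereal_sup_ubound; exists N.
Qed.

Lemma omega_stat_omega_limit F x : omega_stat (skew_map F) x `<=` omega_limit (skew_map F) x.
Proof.
move=> z Hz A B [N0 _ HN0] zB; apply: contrapT => NAB.
have := Hz B zB; apply/negP; rewrite -leNgt; apply: (@freq_le0 _ _ _ N0) => N.
rewrite visitsE -size_filter -(size_iota 0 N0); apply: uniq_leq_size.
  by rewrite filter_uniq// iota_uniq.
move=> n; rewrite mem_filter !mem_iota /= add0n => /andP[/asboolP Bn _].
rewrite ltnNge; apply/negP => N0n; apply: NAB; exists (iter n (skew_map F) x).
by split => //; exact: HN0.
Qed.

Lemma compact_segment : compact [set: segment hab].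
Proof.
rewrite (_ : setT = clamp (hab := hab) @` `[a, b]).
  apply: continuous_compact; last exact: segment_compact.
  apply: continuous_subspaceT => x U /nbhs_set_typeP[e e0 H].
  apply/nbhs_ballP; exists e => // y xy; apply: H; apply: le_lt_trans xy.
  have [xy|/ltW yx] := leP x y.
    have /andP[? ?] := dist_clamp (hab := hab) xy.
    by rewrite distrC [leRHS]distrC ger0_norm// ger0_norm// subr_ge0.
  have /andP[? ?] := dist_clamp (hab := hab) yx.
  by rewrite ger0_norm// ger0_norm// subr_ge0.
apply/seteqP; split => // p _; exists (set_val p); last exact: clampK.
by rewrite /= in_itv; exact: val_segment.
Qed.

Lemma compact_skew_space : compact [set: X].
Proof.
rewrite -setXTT; apply: compact_setX; [exact: compact_shift_space|exact: compact_segment].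
Qed.

Lemma uniform_margin (A U : set X) : closed A -> set_nbhs A U ->
  exists (K : nat) (e : R), 0 < e /\ forall z y, A z ->
    (forall m : int, (`|m| < K)%N -> z.1 m = y.1 m) ->
    `|set_val z.2 - set_val y.2| < e -> U y.
Proof.
move=> cA AU.
have /compact_near_coveringP cov : compact A.
  by apply: (subclosed_compact cA compact_skew_space).
pose P (n : nat) z := forall y, (forall m : int, (`|m| < n)%N -> z.1 m = y.1 m) ->
  `|set_val z.2 - set_val y.2| < n.+1%:R^-1 -> U y.
have [z0 Az0|N _ HN] := cov nat \oo P _.
  have /nbhs_cylinderP[K [e [e0 H]]] := AU z0 Az0.
  have e20 : 0 < e / 2 by rewrite divr_gt0.
  exists ([set z | (forall m : int, (`|m| < K)%N -> z0.1 m = z.1 m) /\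
    `|set_val z0.2 - set_val z.2| < e / 2], [set n | (K <= n)%N /\ n.+1%:R^-1 < e / 2]).
    split => /=.
      by apply/nbhs_cylinderP; exists K, (e / 2); split.
    apply: filterI; first by exists K.
    exact: (near_infty_natSinv_lt (PosNum e20)).
  move=> [z n] [/= [h1 h2] [Kn hn]] y zy dzy; apply: H.
    by move=> m mK; rewrite h1// zy// (leq_trans mK).
  apply: le_lt_trans (ler_distD (set_val z.2) _ _) _.
  by rewrite [e]splitr ltrD// (lt_trans dzy).
exists N, N.+1%:R^-1; split => [|z y Az zy dzy]; first by rewrite invr_gt0.
exact: (HN N (leqnn N) z Az y zy dzy).
Qed.

End Orbits.

(** * The piece of the attractor over a good interval *)
Section Piece.
Context {r s : nat} {hs : (2 <= s)%N} {R : realType} {a b : R} {hab : a < b}.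
Local Notation S := (shift_space R hs).
Local Notation X := (S * segment hab)%type.
Local Notation TI := (skew_products r s hab).
Local Notation word := (seq 'I_s).
Implicit Types (x y z : X) (om : S).
Variables (F : TI) (i : 'I_s) (c d p L : R).
Local Notation g := (fibers F).
Local Notation Fm := (@skew_map r s hs R a b hab F).
Hypothesis L1 : 1 <= L.
Hypothesis gL : forall i (x y : R), x <= y -> g i y - g i x <= L * (y - x).
Hypothesis tr : trapped F c d.
Hypothesis fp : g i p = p.
Hypothesis close : forall e : R, 0 < e -> exists v, forall y : R, c <= y <= d ->
  `|act g v y - p| < e.
Hypothesis stab : forall e : R, 0 < e -> exists2 del : R, 0 < del & forall (x : R) v w, a <= x <= b ->
  `|x - act g v p| < del -> exists v', `|act g w x - act g v' p| < e.

Let L0 : 0 < L. Proof. exact: lt_le_trans L1. Qed.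

Lemma act_dist w (x y : R) : `|act g w x - act g w y| <= L ^+ size w * `|x - y|.
Proof.
apply: increment_dist; first exact: act_fibers_homo.
apply: act_lipschitz => //; first exact: ltW.
by move=> j; exact: fibers_homo.
Qed.

Lemma act_dist_lt w (x y e : R) : `|x - y| < e / L ^+ size w -> `|act g w x - act g w y| < e.
Proof.
move=> xy; apply: le_lt_trans (act_dist w x y) _.
by rewrite mulrC -ltr_pdivlMr// exprn_gt0.
Qed.

Let pab : a <= p <= b. Proof. by rewrite -fp; exact: fibers_itv. Qed.

Let act_p_ab w : a <= act g w p <= b.
Proof. by apply: act_itv => // j y; exact: fibers_itv. Qed.

(** The closure of the set of points (om, act g w p) such that the past of om reads
    i^oo w, that is, of the unstable set of the fixed point (i^oo, p) of the skew
    product.  Conditions on finite pasts make closedness and invariance easy; points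
    of the explicit form are recovered in [piece_witness]. *)
Definition piece : set X := [set x | forall k e, 0 < e ->
  exists u, `|set_val x.2 - act g (u ++ past k x.1) p| < e].

Lemma closed_piece : closed piece.
Proof.
move=> z clz k e e0; have e20 : 0 < e / 2 by rewrite divr_gt0.
have [|y [py [zy dzy]]] := clz [set y | (forall m : int, (`|m| < k.+1)%N -> z.1 m = y.1 m) /\
    `|set_val z.2 - set_val y.2| < e / 2].
  by apply/nbhs_cylinderP; exists k.+1, (e / 2).
have [u Hu] := py k _ e20; exists u.
have -> : past k z.1 = past k y.1 by apply: eq_past => j jk; apply: zy.
apply: le_lt_trans (ler_distD (set_val y.2) _ _) _.
by rewrite [e]splitr ltrD.
Qed.

Lemma piece_invariant x : piece x -> piece (Fm x).
Proof.
move=> px k e e0.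
have eL : 0 < e / L by rewrite divr_gt0.
have [u Hu] := px k _ eL.
exists (rcons u (shift x.1 (Negz k))); rewrite cat_rcons.
have -> : shift x.1 (Negz k) :: past k (shift x.1) = rcons (past k x.1) (x.1 0).
  by rewrite -past_shift /past mkseqS rev_rcons.
rewrite -rcons_cat act_rcons.
have -> : set_val (Fm x).2 = g (x.1 0) (set_val x.2) by rewrite /fibers ext_val.
by apply: (act_dist_lt (w := [:: x.1 0])); rewrite expr1.
Qed.

(** Before w the past is filled with i, which fixes p; so any part of the past that
    is longer than w acts on p as w does. *)
Lemma piece_witness w om : exists x, [/\ piece x,
  forall m, x.1 (Posz m) = om (Posz m),
  forall j, x.1 (Negz j) = nth i (rev w) j & set_val x.2 = act g w p].
Proof.
pose om' : S := fun m => if m is Negz j then nth i (rev w) j else om m.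
exists (om', clamp (act g w p)); split => //; last exact: val_clampE.
move=> k e e0; exists (rev (drop k (rev w))).
rewrite /= val_clampE// -rev_cat.
suff -> : act g (rev (mkseq (fun j => om' (Negz j)) k ++ drop k (rev w))) p = act g w p.
  by rewrite subrr normr0.
have [kw|wk] := leqP k (size w).
  rewrite (_ : mkseq _ k = take k (rev w)) ?cat_take_drop ?revK//.
  apply: (@eq_from_nth _ i); first by rewrite size_mkseq size_takel// size_rev.
  by move=> j; rewrite size_mkseq => jk; rewrite nth_mkseq// nth_take.
rewrite drop_oversize ?size_rev; last exact: ltnW.
rewrite cats0 (_ : mkseq _ k = rev w ++ nseq (k - size w) i).
  rewrite rev_cat revK act_cat; congr (act g w _).
  by rewrite rev_nseq; elim: (k - size w)%N => //= m IH; rewrite fp.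
apply: (@eq_from_nth _ i); first by rewrite size_mkseq size_cat size_rev size_nseq subnKC// ltnW.
move=> j; rewrite size_mkseq => jk; rewrite nth_mkseq// nth_cat size_rev /=.
case: ltnP => // wj; rewrite nth_default ?size_rev// nth_nseq.
by rewrite ltn_sub2r.
Qed.

(** A word v that brings (c, d) near p is read sooner or later.  From then on the
    orbit stays near the orbit of p by stability; applied k steps before the time
    considered, this describes the fiber coordinate by the last k symbols. *)
Lemma omega_limit_piece x n0 : c < act g (window 0 n0 x.1) (set_val x.2) < d ->
  (forall (W : word) N, exists2 n, (N <= n)%N & window n (size W) x.1 = W) ->
  omega_limit Fm x `<=` piece.
Proof.
move=> x0 rec z Hz k e e0.
have near_orbit (e1 : R) : 0 < e1 -> exists N, forall n, (N <= n)%N ->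
    exists v', `|act g (window 0 n x.1) (set_val x.2) - act g v' p| < e1.
  move=> e10; have [del del0 Hdel] := stab e10.
  have [v Hv] := close del0.
  have [n n0n wn] := rec v n0.
  exists (n + size v)%N => m nm.
  rewrite -(subnKC nm) window_cat act_cat; apply: (Hdel _ [::]).
    by apply: act_itv; [move=> *; exact: fibers_itv|exact: val_segment].
  rewrite window_cat add0n wn act_cat; apply: Hv.
  rewrite -(subnKC n0n) window_cat act_cat.
  by apply: (trapped_act_le _ tr); case/andP: x0 => /ltW -> /ltW ->.
have e20 : 0 < e / 2 by rewrite divr_gt0.
have eL : 0 < e / 2 / L ^+ k by rewrite divr_gt0// exprn_gt0.
have [N HN] := near_orbit _ eL.
have [||_ [[n Nn <-] [zy dzy]]] := Hz [set iter n Fm x | n in [set n | (N + k <= n)%N]]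
    [set y | (forall m : int, (`|m| < k.+1)%N -> z.1 m = y.1 m) /\
    `|set_val z.2 - set_val y.2| < e / 2].
- by exists (N + k)%N => // n /= Nn; exists n.
- by apply/nbhs_cylinderP; exists k.+1, (e / 2).
have [yn1 yn2] := iter_skew F n x.
have kn : (k <= n)%N by apply: leq_trans Nn; rewrite leq_addl.
have [v' Hv'] := HN (n - k)%N ltac:(by rewrite leq_subRL// addnC).
exists v'.
have -> : past k z.1 = window (n - k) k x.1.
  rewrite -(past_window kn yn1); apply: eq_past => j jk; exact: zy.
apply: le_lt_trans (ler_distD (set_val (iter n Fm x).2) _ _) _.
rewrite [e]splitr ltrD// yn2 -{1}(subnK kn) window_cat !act_cat add0n.
by apply: act_dist_lt; rewrite size_window.
Qed.

(** Let z be in the piece, approximated by the image of p under T, a word ending with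
    the past of z.  Each occurrence of W = v T fut, where v brings (c, d) near p and
    fut is the future of z, is a visit near z, namely at the time when v T has been
    read. *)
Lemma piece_omega_stat x : c < set_val x.2 < d ->
  frequent_windows x.1 -> piece `<=` omega_stat Fm x.
Proof.
move=> x0 frq z pz U /nbhs_cylinderP[K [e [e0 HU]]].
have e20 : 0 < e / 2 by rewrite divr_gt0.
have [u Hu] := pz K _ e20.
pose T := u ++ past K z.1.
have eL : 0 < e / 2 / L ^+ size T by rewrite divr_gt0// exprn_gt0.
have [v Hv] := close eL.
pose fut := window 0 K z.1.
pose W := v ++ (T ++ fut).
pose off := (size v + size T)%N.
have visit m : window m (size W) x.1 = W -> U (iter (off + m) Fm x).
  move=> wW; have [y1 y2] := iter_skew F (off + m) x.
  move: wW; rewrite /W size_cat window_cat => /eqP.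
  rewrite eqseq_cat ?size_window// => /andP[/eqP wv].
  rewrite size_cat window_cat eqseq_cat ?size_window// => /andP[/eqP wT /eqP wf].
  have nE : (off + m = m + size v + size T)%N by rewrite /off addnC addnA.
  apply: HU => [[j|j] jK|].
  - rewrite y1 nE; have := congr1 (nth (z.1 0) ^~ j) wf.
    have jK' : (j < K)%N by [].
    rewrite /fut ?size_window /= !(nth_map 0%N) ?size_iota// !nth_iota// add0n => <-.
    by congr (x.1 _); clear; lia.
  - have jK' : (j < K)%N by apply: leq_trans jK; rewrite NegzE abszN /=.
    have KT : (K <= size T)%N by rewrite size_cat size_past leq_addl.
    have Kn : (K <= off + m)%N by rewrite nE (leq_trans KT)// leq_addl.
    suff /past_inj -> : past K z.1 = past K (iter (off + m) Fm x).1 by [].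
    rewrite (past_window Kn y1).
    move: wT; rewrite /T size_cat window_cat => /eqP; rewrite eqseq_cat ?size_window//.
    move=> /andP[_ /eqP <-]; rewrite size_past; congr (window _ _ _).
    by rewrite nE size_cat size_past; clear; lia.
  rewrite y2 nE !window_cat !add0n wv wT !act_cat.
  set q := act g (window 0 m x.1) (set_val x.2).
  apply: le_lt_trans (ler_distD (act g (u ++ past K z.1) p) _ _) _.
  rewrite [e]splitr ltrD// -act_cat distrC; apply: act_dist_lt.
  by apply: Hv; case/andP: (trapped_act (window 0 m x.1) tr x0) => /ltW -> /ltW ->.
have sp : 0 < s%:R^-1 :> R by rewrite invr_gt0 ltr0n ltnW.
have dl0 : 0 < s%:R^-1 ^+ size W :> R by rewrite exprn_gt0.
apply: (freq_gt0 (kappa := s%:R^-1 ^+ size W / 16)) => [|N0]; first by rewrite divr_gt0.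
(* off <= 2^j bounds the time by 3 * 2^j, so that kappa = s^-|W| / 16 is a lower
   bound for the frequency *)
have [j j0 Hj] := frq W (maxn N0 off).
have jlt : (j < 2 ^ j)%N by exact: ltn_expl.
exists (off + 2 ^ j + 2 ^ j)%N.
  by apply: leq_trans (leq_addl _ _); rewrite (leq_trans _ (ltnW jlt))// (leq_trans _ j0)// leq_maxl.
have cnt : (occ W (window (2 ^ j) (2 ^ j) x.1) <=
    visits Fm x U (off + 2 ^ j + 2 ^ j))%N.
  rewrite visitsE iotaD count_cat add0n (leq_trans _ (leq_addl _ _))//.
  rewrite iotaDl count_map; apply: leq_trans (occ_count _ _ _ _) _.
  by apply: sub_count => m /= /eqP/visit Um; exact/asboolP.
have N0' : 0 < (off + 2 ^ j + 2 ^ j)%:R :> R.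
  by rewrite ltr0n addn_gt0 expn_gt0 orbT.
rewrite ler_pdivlMr//; move: cnt; rewrite -(ler_nat R) => cnt.
apply: le_trans cnt; apply: le_trans Hj.
have offj : off%:R <= (2 ^ j)%:R :> R.
  by rewrite ler_nat (leq_trans _ (ltnW jlt))// (leq_trans _ j0)// leq_maxr.
rewrite (natrD _ (off + 2 ^ j)%N) (natrD _ off).
have : 0 <= (2 ^ j)%:R :> R by [].
move: dl0 offj; move: (s%:R^-1 ^+ _) ((2 ^ j)%:R) (off%:R) => /= D Z o D0 oZ Z0.
have := ler_wpM2l (ltW D0) oZ; have := mulr_ge0 (ltW D0) Z0.
lra.
Qed.

(** The point y starts near a point z of the piece, and z' is to be near the n-th
    iterate of y.  For n < K the iterate of z will do.  Later, by stability, y was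
    at time n - K near the image of p under some v', and the point with past
    i^oo v' followed by the last K symbols read is in the piece. *)
Lemma piece_stable K (e : R) : 0 < e -> exists K' (e' : R), 0 < e' /\
  forall z y, piece z -> (forall m : int, (`|m| < K')%N -> z.1 m = y.1 m) ->
    `|set_val z.2 - set_val y.2| < e' -> forall n, exists z', [/\ piece z',
      forall m : int, (`|m| < K)%N -> z'.1 m = (iter n Fm y).1 m &
      `|set_val z'.2 - set_val (iter n Fm y).2| < e].
Proof.
move=> e0; have eL : 0 < e / L ^+ K by rewrite divr_gt0// exprn_gt0.
have [del del0 Hdel] := stab eL.
have del20 : 0 < del / 2 by rewrite divr_gt0.
exists (K + K)%N, (Num.min (del / 2) (e / L ^+ K)); split.
  by rewrite lt_min del20.
move=> z y pz zy; rewrite lt_min => /andP[d1 d2] n.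
have [yn1 yn2] := iter_skew F n y.
have [nK|Kn] := ltnP n K.
  have [zn1 zn2] := iter_skew F n z.
  exists (iter n Fm z); split.
  - by elim: n {nK zn1 zn2 yn1 yn2} => //= n; exact: piece_invariant.
  - by move=> m mK; rewrite zn1 yn1 zy//; clear -mK nK; lia.
  rewrite zn2 yn2.
  have -> : window 0 n z.1 = window 0 n y.1.
    apply/eq_in_map => m; rewrite mem_iota add0n => /= mn; apply: zy => /=.
    by rewrite (leq_trans mn)// (leq_trans (ltnW nK))// leq_addr.
  apply: act_dist_lt; rewrite size_window; apply: lt_le_trans d2 _.
  by rewrite ler_pM2l// lef_pV2 ?posrE ?exprn_gt0// ler_weXn2l// ltnW.
have [u Hu] := pz 0%N _ del20.
have yu : `|set_val y.2 - act g (u ++ past 0 z.1) p| < del.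
  apply: le_lt_trans (ler_distD (set_val z.2) _ _) _.
  by rewrite [del]splitr ltrD// distrC.
have [v' Hv'] := Hdel _ _ (window 0 (n - K) y.1) (val_segment y.2) yu.
pose w := v' ++ window (n - K) K y.1.
have [z' [pz' zp zn zv]] := piece_witness w (iter n Fm y).1.
exists z'; split => //.
- move=> [m _|j jK]; first exact: zp.
  have jK' : (j < K)%N by apply: leq_trans jK; rewrite NegzE abszN /=.
  rewrite zn /w rev_cat nth_cat size_rev size_window jK'.
  rewrite -(past_window Kn yn1) /past revK nth_mkseq//.
- rewrite zv yn2 /w -{2}(subnK Kn) window_cat add0n !act_cat distrC.
  by apply: act_dist_lt; rewrite size_window.
Qed.

End Piece.

(** * Null sets of the product measure *)
Section ProductNull.
Context {r s : nat} {hs : (2 <= s)%N} {R : realType} {a b : R} {hab : a < b}.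
Local Notation S := (shift_space R hs).
Local Notation I := (segment hab).
Local Notation X := (S * I)%type.
Local Notation TI := (skew_products r s hab).
Local Notation mu := (@bernoulli_measure R s hs).
Local Notation muX := (@skew_measure s hs R a b hab).

Lemma ae_fst (P : S -> Prop) : {ae mu, forall om, P om} -> {ae muX, forall x, P x.1}.
Proof.
move=> [M [mM M0 PM]]; exists (M `*` setT); split.
- exact: measurableX.
- transitivity (mu M * @segment_lebesgue R a b hab setT)%E.
    exact: product_measure1E.
  by rewrite M0 mul0e.
- by move=> x /= nPx; split => //; exact: PM.
Qed.

Lemma product_null (B : set X) : measurable B ->
  (forall y, mu (ysection B y) = 0%E) -> muX B = 0%E.
Proof.
move=> mB B0; rewrite /skew_measure.
rewrite (@product_measure_unique _ _ _ _ _ _ _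
  (mu \x^ @segment_lebesgue R a b hab)%E)//; last by move=> *; exact: product_measure2E.
by rewrite /product_measure2; apply: integral0_eq => y _ /=; exact: B0.
Qed.

Lemma measurable_segment_preimage (A : set R) : measurable A ->
  measurable [set y : I | A (set_val y)].
Proof. by move=> mA; exists A => //; rewrite setTI. Qed.

Lemma measurable_act (F : TI) (W : set R) k : open W ->
  measurable [set x : X | W (act (fibers F) (window 0 k x.1) (set_val x.2))].
Proof.
move=> oW.
pose cyl (o : option (seq 'I_s)) : set X := if o is Some u then
  [set om : S | window 0 k om = u] `*` [set y : I | W (act (fibers F) u (set_val y))]
  else set0.
rewrite (_ : mkset _ = \bigcup_n cyl (unpickle n)); last first.
  apply/seteqP; split => [x Wx|x [n _]].
    by exists (pickle (window 0 k x.1)); [|rewrite pickleK].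
  by case: (unpickle n : option (seq 'I_s)) => // u [/= <-].
apply: bigcup_measurable => n _.
case: (unpickle n : option (seq 'I_s)) => [u|]; last exact: measurable0.
apply: measurableX; first exact: (measurable_window 0 k [set w | w = u]).
apply: (measurable_segment_preimage (A := [set y | W (act (fibers F) u y)])).
apply: open_measurable.
by have /continuousP := @continuous_act_fibers _ _ _ _ _ _ F u; apply.
Qed.

Lemma ae_absorbed (F : TI) (W : set R) n : open W ->
  (forall i y, W y -> W (fibers F i y)) ->
  (forall y, a <= y <= b -> exists2 v, size v = n & W (act (fibers F) v y)) ->
  {ae muX, forall x, exists k, W (act (fibers F) (window 0 k x.1) (set_val x.2))}.
Proof.
move=> oW Wg HW.
pose B := [set x : X | forall k, ~ W (act (fibers F) (window 0 k x.1) (set_val x.2))].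
have mB : measurable B.
  rewrite (_ : B = \bigcap_k ~` [set x : X | W (act (fibers F) (window 0 k x.1) (set_val x.2))]).
    by apply: bigcap_measurableType => k _; apply: measurableC; exact: measurable_act.
  by apply/seteqP; split => x /= H k; [move=> _; exact: H|exact: (H k Logic.I)].
exists B; split => //.
  apply: product_null => // y.
  rewrite (_ : ysection B y = [set om : S | forall k, ~ W (act (fibers F) (window 0 k om) (set_val y))]).
    apply: (@bernoulli_absorption _ _ _ (fibers F) [set y | a <= y <= b] W n) => //.
    - by move=> *; exact: fibers_itv.
    - exact: val_segment.
  by apply/seteqP; split => om; rewrite ysectionE.
by move=> x /= H k Wk; apply: H; exists k.
Qed.

Lemma strip_measure_gt0 (c d p : R) : c < p < d -> a <= p <= b ->
  (0 < muX [set x : X | (c < set_val x.2 < d)%R])%E.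
Proof.
move=> /andP[cp pd] /andP[ap pb].
rewrite (_ : mkset _ = setT `*` [set y : I | `]c, d[%classic (set_val y)]); last first.
  by apply/seteqP; split => x /=; rewrite in_itv => // -[].
have mJ : measurable [set y : I | `]c, d[%classic (set_val y)].
  exact: measurable_segment_preimage.
rewrite /skew_measure product_measure1E//= probability_setT mul1e /segment_lebesgue.
pose lo := Num.max a c; pose hi := Num.min b d.
have lohi : lo < hi.
  rewrite gt_max !lt_min hab (le_lt_trans ap pd) (lt_le_trans cp pb) /=.
  exact: lt_trans pd.
apply: (@lt_le_trans _ _ (lebesgue_measure `]lo, hi[%classic)).
  by rewrite lebesgue_measure_itv /= lte_fin lohi -EFinD lte_fin subr_gt0.
apply: le_measure; rewrite ?inE; first exact: measurable_itv.
  rewrite (_ : _ @` _ = `[a, b] `&` `]c, d[).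
    by apply: measurableI; exact: measurable_itv.
  apply/seteqP; split => [_ [y /= ycd <-]|x [xab xcd]].
    by split => //; rewrite /= in_itv; exact: val_segment.
  have vx : set_val (clamp (hab := hab) x) = x by apply: val_clampE; rewrite /= in_itv in xab.
  by exists (clamp x) => //=; rewrite vx.
move=> x; rewrite /= in_itv /= gt_max lt_min => /andP[/andP[ax cx] /andP[xb xd]].
have vx : set_val (clamp (hab := hab) x) = x by apply: val_clampE; rewrite !ltW.
by exists (clamp x) => //=; rewrite vx in_itv /= cx.
Qed.

End ProductNull.

(** * The attractor of a generic skew product *)
Section Generic.
Context {r s : nat} {hs : (2 <= s)%N} {R : realType} {a b : R} {hab : a < b}.
Hypothesis r0 : (0 < r)%N.
Local Notation S := (shift_space R hs).
Local Notation I := (segment hab).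
Local Notation X := (S * I)%type.
Local Notation TI := (skew_products r s hab).
Local Notation word := (seq 'I_s).
Local Notation mu := (@bernoulli_measure R s hs).
Local Notation muX := (@skew_measure s hs R a b hab).

Lemma generic_maps_inside (F : TI) : generic F -> maps_inside F.
Proof. by move=> /(_ None Logic.I)[]. Qed.

Definition rational_good (F : TI) (J : rat * rat) : Prop := good F (ratr J.1 : R) (ratr J.2 : R).

Definition between (J : rat * rat) (y : R) : bool := ratr J.1 < y < ratr J.2.

(** The gap between c and the images of c under the letters leaves room for a
    rational end, and likewise at d. *)
Lemma good_rational (F : TI) (c d y : R) : good F c d -> c < y < d ->
  exists2 J, rational_good F J & between J y.
Proof.
move=> [[cd tr] [i [c1 [d1 [lam [w [hl dl h1 [h2 h3]]]]]]]] /andP[cy yd].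
pose c' := \big[Num.min/y]_i fibers F i c.
have cc' : c < c' by apply: lt_bigmin => // j _; exact: (tr j).1.
pose d' := \big[Num.max/y]_i fibers F i d.
have dd' : d' < d by apply: bigmax_lt => // j _; exact: (tr j).2.
have [q1] := rat_in_itvoo cc'; rewrite in_itv /= => /andP[cq1 q1c'].
have [q2] := rat_in_itvoo dd'; rewrite in_itv /= => /andP[d'q2 q2d].
have q1y : (ratr q1 : R) < y by apply: lt_le_trans q1c' _; exact: bigmin_le_id.
have yq2 : y < (ratr q2 : R) by apply: le_lt_trans d'q2; exact: bigmax_ge_id.
exists (q1, q2); last by rewrite /between /= q1y.
split.
  split => [|j] /=; first exact: lt_trans q1y yq2.
  split.
    apply: (@lt_le_trans _ _ (fibers F j c)).
      by apply: lt_le_trans q1c' _; exact: bigmin_le.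
    by apply: fibers_homo; exact: ltW.
  apply: (@le_lt_trans _ _ (fibers F j d)); first by apply: fibers_homo; exact: ltW.
  by apply: le_lt_trans d'q2; exact: le_bigmax.
exists i, c1, d1, lam, w; split => //=; split.
  by apply: lt_le_trans h2 _; apply: act_fibers_homo; exact: ltW.
by apply: le_lt_trans h3; apply: act_fibers_homo; exact: ltW.
Qed.

Definition attracting_data (F : TI) (J : rat * rat) (p : R) (i : 'I_s) : Prop :=
  [/\ between J p, fibers F i p = p,
    (forall e : R, 0 < e -> exists v, forall y : R, ratr J.1 <= y <= ratr J.2 ->
      `|act (fibers F) v y - p| < e)
  & (forall e : R, 0 < e -> exists2 del : R, 0 < del & forall (x : R) v w,
      a <= x <= b -> `|x - act (fibers F) v p| < del ->
      exists v', `|act (fibers F) w x - act (fibers F) v' p| < e)].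

Lemma good_attracting_data (F : TI) J : generic F -> rational_good F J ->
  exists p i, attracting_data F J p i.
Proof.
move=> genF [tr [i [c1 [d1 [lam [w ctr]]]]]].
have cd : ratr J.1 <= ratr J.2 :> R by case: tr => /ltW.
have [p hp fp] := contracting_fixpoint cd ctr.
have inF := generic_maps_inside genF.
have [cp pd] := andP (fixpoint_in_trap r0 tr ctr hp fp).
exists p, i; split => //.
- rewrite /between; have := fibers_homo F i cp; have := fibers_homo F i pd.
  by rewrite fp; have := tr.2 i; lra.
- move=> e e0; have [hl _ _ [h1 h2]] := ctr.
  have cd1 : 0 <= d1 - c1 by case/andP: hp; lra.
  have [k [_ Hk]] := exists_expr_lt hl e0 cd1.
  exists (w ++ nseq k i) => y hy.
  exact: le_lt_trans (contracting_to_fixpoint r0 ctr k hp fp hy) Hk.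
- apply: (stable_orbit r0 inF tr ctr hp fp) => q1 q2.
  exact: (genF (Some (inr (J, (q1, q2)))) Logic.I).
Qed.

(** One bound N serves for the good intervals and, in [uniform_absorption], for the
    length of the words, so that it is a single compactness argument. *)
Definition trap_union (F : TI) (N : nat) : set R :=
  \bigcup_(J in [set J | (pickle J <= N)%N /\ rational_good F J]) [set y | between J y].

Lemma trap_union_invariant F N w y : trap_union F N y -> trap_union F N (act (fibers F) w y).
Proof.
move=> [J [JN gJ] yJ]; exists J => //=.
by apply: trapped_act => //; case: gJ.
Qed.

Lemma open_trap_union F N : open (trap_union F N).
Proof.
apply: bigcup_open => J _.
rewrite (_ : mkset _ = `]ratr J.1, ratr J.2[%classic); first exact: itv_open.
by apply/seteqP; split => y /=; rewrite in_itv.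
Qed.

Lemma uniform_absorption F : generic F -> exists N, forall y, a <= y <= b ->
  exists2 w, size w = N & trap_union F N (act (fibers F) w y).
Proof.
move=> genF; have s0 : (0 < s)%N := ltnW hs.
pose P (n : nat) y := exists2 w, size w = n & trap_union F n (act (fibers F) w y).
have /compact_near_coveringP cov := @segment_compact R a b.
have [y0|N _ HN] := cov nat \oo P _; last first.
  by exists N => y yab; apply: (HN N (leqnn N)); rewrite /= in_itv.
rewrite /= in_itv /= => y0ab.
have [w [c [d [gcd hw]]]] := reach_good r0 genF y0ab.
have [J gJ bJ] := good_rational gcd hw.
exists ([set y | between J (act (fibers F) w y)],
  [set n | (maxn (size w) (pickle J) <= n)%N]).
  split => /=; last by exists (maxn (size w) (pickle J)).
  apply: (@continuous_act_fibers _ _ _ _ _ _ F w y0 [set z | between J z]).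
  have o : open `](ratr J.1 : R), (ratr J.2 : R)[%classic by exact: itv_open.
  have m : `](ratr J.1 : R), (ratr J.2 : R)[%classic (act (fibers F) w y0).
    by rewrite /= in_itv.
  by apply: filterS (open_nbhs_nbhs (conj o m)) => z; rewrite /= in_itv.
move=> [y n] [/= yJ]; rewrite geq_max => /andP[wn Jn].
(* a good interval is not left again, so the word may be prolonged to length n *)
exists (w ++ nseq (n - size w) (Ordinal s0)); first by rewrite size_cat size_nseq subnKC.
by rewrite act_cat; apply: trap_union_invariant; exists J.
Qed.

Section Attractor.
Variable F : TI.
Hypothesis genF : generic F.

(** The union A of the pieces over the finitely many good intervals that absorb almost
    every orbit contains the omega-limit sets, hence also the statistical ones, of
    almost all points.  Conversely each piece consists of statistical limits of almost
    all points of a set of positive measure, the strip over its good interval.  Both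
    attractors are thus caught between A and A. *)
Lemma generic_attractor : exists A : set X,
  [/\ is_statistical_attractor (skew_map F) A, is_milnor_attractor (skew_map F) A
    & lyapunov_stable (skew_map F) A].
Proof.
have [N HN] := uniform_absorption genF.
have [L L1 HL] := fibers_lipschitz r0 F.
pose D := [set J | (pickle J <= N)%N /\ rational_good F J].
have /choice[data Hdata] : forall J, exists pi : R * 'I_s, D J -> attracting_data F J pi.1 pi.2.
  move=> J; have [[_ gJ]|NJ] := pselect (D J).
    by have [p [i H]] := good_attracting_data genF gJ; exists (p, i).
  by exists (0, Ordinal (ltnW hs)).
pose pc J : set X := piece F (data J).1.
pose A := \bigcup_(J in D) pc J.
have finD : finite_set D.
  apply: (@sub_finite_set _ _ ((fun m => odflt (0, 0) (unpickle m)) @` `I_N.+1)).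
    by move=> J [JN _]; exists (pickle J); [exact: JN|rewrite pickleK].
  by apply: finite_image; exact: finite_II.
have trD J : D J -> trapped F (ratr J.1) (ratr J.2) by case=> _ [].
have closedA : closed A.
  apply: closed_bigcup => // J _; exact: (@closed_piece _ _ _ _ _ _ _ F (data J).1).
have invA x : A x -> A (skew_map F x).
  by move=> [J DJ pJ]; exists J => //; exact: (piece_invariant L1 HL pJ).
have freq_ae := ae_fst (hab := hab) (@ae_frequent_windows R s hs).
have limA : {ae muX, forall x, omega_limit (skew_map F) x `<=` A}.
  have abs : {ae muX, forall x : X, exists k,
      trap_union F N (act (fibers F) (window 0 k x.1) (set_val x.2))}.
    apply: (ae_absorbed (n := N)) => //; first exact: open_trap_union.
    by move=> i y; exact: (@trap_union_invariant F N [:: i]).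
  apply: filterS2 freq_ae abs => x frq [k [J DJ bJ]] z zx; exists J => //.
  have [hp fp close stab] := Hdata J DJ.
  exact: (omega_limit_piece L1 HL (trD J DJ) close stab bJ (recurrent_windows frq) zx).
have statA B : closed B -> {ae muX, forall x, omega_stat (skew_map F) x `<=` B} -> A `<=` B.
  move=> cB statB z [J DJ pJ].
  have [hp fp close stab] := Hdata J DJ.
  pose E := [set x : X | (ratr J.1 < set_val x.2 < ratr J.2)%R].
  have [x [Ex frq Bx]] : exists x : X, [/\ E x, frequent_windows x.1 &
      omega_stat (skew_map F) x `<=` B].
    apply: contrapT => Nx.
    have mE : measurable E.
      rewrite (_ : E = setT `*` [set y : I | `]ratr J.1 : R, ratr J.2 : R[%classic (set_val y)]).
        by apply: measurableX => //; apply: measurable_segment_preimage; exact: measurable_itv.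
      by apply/seteqP; split => y; rewrite /E /= in_itv => // -[].
    have NE : muX.-negligible E.
      apply: negligibleS (filterI freq_ae statB) => y Ey /= [frq By].
      by apply: Nx; exists y.
    have pab : a <= (data J).1 <= b by rewrite -fp; exact: fibers_itv.
    have E0 : muX E = 0%E by exact: measure_negligible mE NE.
    have := strip_measure_gt0 (hs := hs) (hab := hab) hp pab.
    by rewrite -[X in (_ < X)%E]/(muX E) E0 ltxx.
  apply: Bx; exact: (piece_omega_stat L1 HL (trD J DJ) close Ex frq pJ).
exists A; split.
- split; last by move=> B [cB statB]; exact: statA.
  split => //; apply: filterS limA => x lim z zx; apply: lim.
  exact: omega_stat_omega_limit zx.
- split; first by split.
  move=> B [cB limB]; apply: statA => //; apply: filterS limB => x lim z zx; apply: lim.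
  exact: omega_stat_omega_limit zx.
- split => //; first by move=> _ [x Ax <-]; exact: invA.
  move=> U AU; have [K [e [e0 HU]]] := uniform_margin closedA AU.
  have exst : forall J : rat * rat, exists Ke : nat * R, D J -> 0 < Ke.2 /\
      forall z y : X, pc J z -> (forall m : int, (`|m| < Ke.1)%N -> z.1 m = y.1 m) ->
      `|set_val z.2 - set_val y.2| < Ke.2 -> forall n, exists z' : X, [/\ pc J z',
      forall m : int, (`|m| < K)%N -> z'.1 m = (iter n (skew_map F) y).1 m &
      `|set_val z'.2 - set_val (iter n (skew_map F) y).2| < e].
    move=> J; have [DJ|NJ] := pselect (D J); last by exists (0%N, 0).
    have [hp fp close stab] := Hdata J DJ.
    have [K' [e' [e'0 H]]] := piece_stable (hs := hs) L1 HL fp stab K e0.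
    by exists (K', e').
  have [st Hst] := choice exst.
  pose V : set X := [set y | exists J z, [/\ D J, pc J z,
    forall m : int, (`|m| < (st J).1)%N -> z.1 m = y.1 m &
    `|set_val z.2 - set_val y.2| < (st J).2]].
  have VU y n : V y -> U (iter n (skew_map F) y).
    move=> [J [z [DJ pz zy dzy]]]; have [_ H] := Hst J DJ.
    have [z' [pz' zy' dzy']] := H z y pz zy dzy n.
    by apply: (HU z') => //; exists J.
  exists V; split => // [z [J DJ pz]|y]; last exact: (VU y 0%N).
  apply/nbhs_cylinderP; exists (st J).1, (st J).2; split; first exact: (Hst J DJ).1.
  by move=> y zy dzy; exists J, z.
Qed.

End Attractor.

End Generic.

Unset Implicit Arguments.

Theorem corollary5p3 (R : realType) (r s : nat) (hr : (1 <= r)%N)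
  (hs : (2 <= s)%N) (a b : R) (hab : a < b) :
  exists RI : set (skew_products r s hab),
    residual RI /\
    forall F, RI F ->
      exists Astat AM : set (shift_space R hs * segment hab),
        [/\ is_statistical_attractor (skew_map F) Astat,
            is_milnor_attractor (skew_map F) AM,
            lyapunov_stable (skew_map F) Astat
          & Astat = AM].
Proof.
exists generic; split; first exact: residual_generic.
move=> F /(generic_attractor (hs := hs) hr)[A [stA miA lyA]].
by exists A, A.
Qed.
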